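(* Let $n\in\mathbb{N}$ and let $D\subset\mathbb{T}^n$ be an origin-symmetric convex body. Then $$|D|^{-1}W_n(D)\le (a_{\mathbb{T}^n}(D))^{-1}\le (a_{\mathbb{R}^n}(D))^{-1}\le \bigl|\tfrac12 D\bigr|^{-1}.$$
   Context: $\mathbb{T}^n=\mathbb{R}^n/\mathbb{Z}^n$, identified with $[-1/2,1/2)^n$ and equipped with Lebesgue measure; an origin-symmetric convex body $D\subset\mathbb{T}^n$ is an origin-symmetric convex body in $\mathbb{R}^n$ contained in $[-1/2,1/2)^n$; $|D|$ is its volume. For $f\in L^1(\mathbb{T}^n)$ (complex-valued), $\widehat f_\nu=\int_{\mathbb{T}^n}f(x)e^{-2\pi i\nu x}\,dx$, $\nu\in\mathbb{Z}^n$; for $h\in L^1(\mathbb{R}^n)$, $\widehat h(\xi)=\int_{\mathbb{R}^n}h(x)e^{-2\pi i\xi x}\,dx$, $\xi\in\mathbb{R}^n$. $\operatorname{supp}$ denotes the closure of the set where a function is non-zero. $L^1_+(\mathbb{T}^n)=\{f\in L^1(\mathbb{T}^n):\widehat f_\nu\ge 0\text{ for all }\nu\in\mathbb{Z}^n\}$. The sharp Wiener constant is $$W_n(D)=\sup_{f\in L^1_+(\mathbb{T}^n)\setminus\{0\}}\frac{\int_{\mathbb{T}^n}|f|^2\,dx}{|D|^{-1}\int_D|f|^2\,dx},$$ where functions with $\int_D|f|^2\,dx=\infty$ are disregarded and $c/0=+\infty$ for $c>0$; that is, $W_n(D)$ is the smallest constant $W$ with $\int_{\mathbb{T}^n}|f|^2\,dx\le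 W|D|^{-1}\int_D|f|^2\,dx$ for all $f\in L^1_+(\mathbb{T}^n)$. Periodic Turán problem: $a_{\mathbb{T}^n}(D)=\sup\widehat g_0$ over all (continuous) $g\in L^1(\mathbb{T}^n)$ with $\widehat g_\nu\ge0$ for all $\nu\in\mathbb{Z}^n$, $\operatorname{supp}g\subset D$, $g(0)=1$. Non-periodic Turán problem: $a_{\mathbb{R}^n}(D)=\sup\widehat h(0)$ over all (continuous) $h\in L^1(\mathbb{R}^n)$ with $\widehat h\ge0$, $\operatorname{supp}h\subset D$, $h(0)=1$. *)

(* Defs.v *)
From HB Require Import structures.
From mathcomp Require Import all_boot all_order all_algebra.
From mathcomp Require Import all_classical all_reals all_analysis.
From mathcomp Require Import complex.

Set Implicit Arguments.
Unset Strict Implicit.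
Unset Printing Implicit Defensive.

Import Order.TTheory GRing.Theory Num.Theory.
Import numFieldTopology.Exports numFieldNormedType.Exports.

Local Open Scope classical_set_scope.
Local Open Scope ring_scope.
Local Open Scope complex_scope.

(* The $\sigma$-algebra generated by the coordinates; for [T] the real numbers it
   is the Borel $\sigma$-algebra. *)
Section measurable_rV.
Context {d} {T : measurableType d}.
Variable n : nat.

Let coors : 'I_n -> 'rV[T]_n -> T := fun i x => x ord0 i.

Let rV_set0 : g_sigma_preimage coors set0.
Proof. exact: sigma_algebra0. Qed.

Let rV_setC A : g_sigma_preimage coors A -> g_sigma_preimage coors (~` A).
Proof. exact: sigma_algebraC. Qed.

Let rV_bigcup (F : _^nat) : (forall i, g_sigma_preimage coors (F i)) ->
  g_sigma_preimage coors (\bigcup_i (F i)).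
Proof. exact: sigma_algebra_bigcup. Qed.

HB.instance Definition _ := @isMeasurable.Build (measure_tuple_display d)
  'rV[T]_n (g_sigma_preimage coors) rV_set0 rV_setC rV_bigcup.

End measurable_rV.

Lemma measurable_rV_coord d (T : measurableType d) n (i : 'I_n) :
  measurable_fun [set: 'rV[T]_n] (fun x : 'rV[T]_n => x ord0 i).
Proof.
move=> _ Y mY; rewrite setTI; apply: sub_sigma_algebra => /=.
rewrite -bigcup_seq/=; exists i => /=; first by rewrite mem_index_enum.
by exists Y => //; rewrite setTI.
Qed.

Lemma measurable_fun_rVP d1 d2 (T1 : measurableType d1)
    (T2 : measurableType d2) n (f : T1 -> 'rV[T2]_n) :
  (forall i, measurable_fun [set: T1] (fun x => f x ord0 i)) ->
  measurable_fun [set: T1] f.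
Proof.
move=> mf; suff H : g_sigma_preimage
    (fun i => (fun x : 'rV[T2]_n => x ord0 i) \o f) `<=` measurable.
  move=> _ A mA; apply: H; rewrite g_sigma_preimage_comp.
  by exists A.
apply: smallest_sub; first exact: sigma_algebra_measurable.
case: n f mf => [|n] f mf; first by rewrite big_ord0.
rewrite -bigcup_mkord_ord; apply: bigcup_sub => i Ii.
by move=> A [B mB <-]; exact: mf.
Qed.

Section lebesgue_rV.
Context {R : realType}.

Definition cons_rV n (p : measurableTypeR R * 'rV[R]_n) : 'rV[R]_n.+1 :=
  row_mx (const_mx p.1 : 'rV[R]_1) p.2.

Lemma measurable_cons_rV n : measurable_fun setT (@cons_rV n).
Proof.
apply: measurable_fun_rVP => i.
case: (@splitP 1 n i) => j ij.
  rewrite (_ : (fun _ => _) = fst); first exact: measurable_fst.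
  apply/funext => p; rewrite /cons_rV (_ : i = lshift n j); last exact/val_inj.
  by rewrite (@row_mxEl _ 1 1 n) mxE.
rewrite (_ : (fun _ => _) = (fun v : 'rV[R]_n => v ord0 j) \o snd).
  apply: measurableT_comp; [exact: measurable_rV_coord|exact: measurable_snd].
apply/funext => p; rewrite /cons_rV (_ : i = rshift 1 j); last exact/val_inj.
by rewrite (@row_mxEr _ 1 1 n).
Qed.

Definition uncons_rV n (v : 'rV[R]_n.+1) : measurableTypeR R * 'rV[R]_n :=
  (v ord0 ord0, @rsubmx _ 1 1 n v).

Lemma cons_rVK n : cancel (@cons_rV n) (@uncons_rV n).
Proof.
move=> [x v]; rewrite /cons_rV /uncons_rV/= row_mxKr; congr pair.
transitivity (row_mx (const_mx x : 'rV[R]_1) v ord0 (lshift n ord0)).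
  by congr (row_mx _ _ _ _); exact/val_inj.
by rewrite row_mxEl mxE.
Qed.

Lemma uncons_rVK n : cancel (@uncons_rV n) (@cons_rV n).
Proof.
move=> v; rewrite /cons_rV /uncons_rV/=.
have -> : const_mx (v ord0 ord0) = @lsubmx _ 1 1 n v.
  apply/rowP => i; rewrite !mxE; congr (v _ _); apply/val_inj.
  by rewrite (ord1 i).
exact: (@hsubmxK _ 1 1 n v).
Qed.

Lemma measurable_uncons_rV n : measurable_fun setT (@uncons_rV n).
Proof.
apply/measurable_fun_pair.
  exact: measurable_rV_coord.
apply: measurable_fun_rVP => i.
rewrite (_ : (fun _ => _) = (fun v : 'rV[R]_n.+1 => v ord0 (rshift 1 i))).
  exact: measurable_rV_coord.
by apply/funext => v; rewrite mxE.
Qed.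

Section step.
Variables (n : nat) (mu : {sigma_finite_measure set 'rV[R]_n -> \bar R}).

Definition lebesgue_rV_step : set 'rV[R]_n.+1 -> \bar R :=
  pushforward (@lebesgue_measure R \x mu)%E (@cons_rV n).

Let step0 : lebesgue_rV_step set0 = 0%E.
Proof. by rewrite /lebesgue_rV_step /pushforward preimage_set0 measure0. Qed.

Let step_ge0 A : (0 <= lebesgue_rV_step A)%E.
Proof.
by rewrite /lebesgue_rV_step /pushforward; exact: (measure_ge0 (@lebesgue_measure R \x mu)%E).
Qed.

Let step_sigma_additive : semi_sigma_additive lebesgue_rV_step.
Proof.
rewrite /lebesgue_rV_step.
have mcons := @measurable_cons_rV n.
exact: measure_semi_sigma_additive.
Qed.

HB.instance Definition _ := isMeasure.Build _ _ _ lebesgue_rV_step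
  step0 step_ge0 step_sigma_additive.

Let step_sigma_finite : sigma_finite setT lebesgue_rV_step.
Proof.
have /sigma_finiteP[F [FT ndF Foo]] := sigma_finiteT (@lebesgue_measure R).
have /sigma_finiteP[G [GT ndG Goo]] := sigma_finiteT mu.
exists (fun k => @uncons_rV n @^-1` (F k `*` G k)).
  rewrite -preimage_bigcup (_ : \bigcup_k _ = setT) ?preimage_setT//.
  apply/seteqP; split=> // -[x v] _.
  have [i _ Fix] : (\bigcup_i F i) x by rewrite -FT.
  have [j _ Gjv] : (\bigcup_i G i) v by rewrite -GT.
  exists (maxn i j) => //; split.
    by move: Fix; exact/subsetPset/ndF/leq_maxl.
  by move: Gjv; exact/subsetPset/ndG/leq_maxr.
move=> k; have [mF Fk] := Foo k; have [mG Gk] := Goo k.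
have mFG : measurable (F k `*` G k) by exact: measurableX.
split.
  by rewrite -[X in measurable X]setTI; exact: measurable_uncons_rV.
rewrite /lebesgue_rV_step /pushforward -comp_preimage.
rewrite (_ : _ \o _ = id); last by apply/funext => p; exact: cons_rVK.
by rewrite preimage_id product_measure1E// lte_mul_pinfty// ge0_fin_numE.
Qed.

HB.instance Definition _ := Measure_isSigmaFinite.Build _ _ _ lebesgue_rV_step
  step_sigma_finite.

End step.

(* Lebesgue measure on Borel sets: the $n$-fold product of the one-dimensional
   one. Completing it is immaterial here: every Lebesgue-measurable function is
   almost everywhere equal to a Borel one. *)
Fixpoint lebesgue_rV n : {sigma_finite_measure set 'rV[R]_n -> \bar R} :=
  if n is m.+1 then
    [the {sigma_finite_measure set 'rV[R]_m.+1 -> \bar R} of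
      lebesgue_rV_step (lebesgue_rV m)]
  else [the {sigma_finite_measure set 'rV[R]_0 -> \bar R} of \d_(0 : 'rV[R]_0)].

End lebesgue_rV.

Section complex_integration.
Context {R : realType} {n : nat}.
Implicit Types (A : set 'rV[R]_n) (f : 'rV[R]_n -> R[i]).

Definition cmeasurable_fun A f :=
  measurable_fun A (fun x => complex.Re (f x)) /\
  measurable_fun A (fun x => complex.Im (f x)).

Definition cintegrable A f := cmeasurable_fun A f /\
  (\int[lebesgue_rV n]_(x in A) (Normc.normc (f x))%:E < +oo)%E.

Definition cintegral A f : R[i] :=
  (\int[lebesgue_rV n]_(x in A) complex.Re (f x)) +i*
  (\int[lebesgue_rV n]_(x in A) complex.Im (f x)).

Definition sqr_integral A f : \bar R :=
  (\int[lebesgue_rV n]_(x in A) (Normc.normc (f x) ^+ 2)%:E)%E.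

(* $e^{-2\pi i\xi x}$ *)
Definition expN2pii (xi x : 'rV[R]_n) : R[i] :=
  let t := 2 * pi * \sum_(i < n) xi ord0 i * x ord0 i in cos t -i* sin t.

End complex_integration.

(* Functions on $\mathbb{R}^n/\mathbb{Z}^n$ are represented by
   $\mathbb{Z}^n$-periodic functions on $\mathbb{R}^n$, integrated over the
   fundamental domain [cube]. Since the quotient map is open and continuous,
   continuity on the torus is continuity of the periodic function, and the
   preimage of the support is the closure of the non-vanishing set. *)
Section torus.
Context {R : realType} {n : nat}.
Implicit Types (D : set 'rV[R]_n) (f g h : 'rV[R]_n -> R[i]).

Definition cube : set 'rV[R]_n :=
  [set x | forall i, - 2^-1 <= x ord0 i < 2^-1].

Definition int_vec (k : 'rV[int]_n) : 'rV[R]_n := map_mx intr k.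

Definition periodic f := forall k x, f (x + int_vec k) = f x.

Definition translates D : set 'rV[R]_n :=
  [set y | exists2 x, D x & exists k, y = x + int_vec k].

Definition supp f : set 'rV[R]_n := closure [set x | f x != 0].

Definition L1_torus f := periodic f /\ cintegrable cube f.

Definition L1_space h := cintegrable setT h.

Definition fourier_coef f (nu : 'rV[int]_n) : R[i] :=
  cintegral cube (fun x => f x * expN2pii (int_vec nu) x).

Definition fourier h (xi : 'rV[R]_n) : R[i] :=
  cintegral setT (fun x => h x * expN2pii xi x).

Definition L1_plus f := L1_torus f /\ forall nu, 0 <= fourier_coef f nu.

Definition sym_convex_body D :=
  [/\ compact D, D° !=set0, convex_set (D : set (convex_lmodType 'rV[R]_n))
    & forall x, D x -> D (- x)].

Definition volume D : \bar R := lebesgue_rV n D.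

(* The conventions $0^{-1} = +\infty$ and $(+\infty)^{-1} = 0$ of the extended
   reals give $c/0 = +\infty$ for $c > 0$; the quotient is never $0/0$ since
   [f] is not almost everywhere zero. *)
Definition wiener_constant D : \bar R :=
  ereal_sup [set (sqr_integral cube f /
                  ((volume D)^-1 * sqr_integral D f))%E | f in
    [set f | [/\ L1_plus f,
                 ~ {ae lebesgue_rV n, forall x, cube x -> f x = 0}
               & (sqr_integral D f < +oo)%E]]].

(* The coefficients of an admissible function are nonnegative, hence real, so
   taking the real part below loses nothing. *)
Definition turan_torus D : \bar R :=
  ereal_sup [set (complex.Re (fourier_coef g 0))%:E | g in
    [set g | [/\ L1_plus g, continuous (g : 'rV[R]_n -> R[i]^o),
                 supp g `<=` translates D & g 0 = 1]]].

Definition turan_space D : \bar R :=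
  ereal_sup [set (complex.Re (fourier h 0))%:E | h in
    [set h | [/\ L1_space h /\ (forall xi, 0 <= fourier h xi),
                 continuous (h : 'rV[R]_n -> R[i]^o),
                 supp h `<=` D & h 0 = 1]]].

End torus.

(* Main.v *)
(* A Turan function [g] for [D] yields the Wiener inequality: let [c] be its zeroth
   coefficient. For [f] and a continuous [G], both with nonnegative coefficients, the
   coefficients of [f G] are nonnegative (smooth [G] by powers of the trigonometric
   kernel [1 - sum_i (1 - cos (2 pi x_i)) / (2 (n + 1))], whose coefficients are nonnegative).
   Applied to [G = g - c] this gives [hat(f g) >= c hat f], so Bessel's inequality for
   [f g], which is square integrable because [g] vanishes off [D], bounds the
   coefficients of [f] in l^2 and hence puts [f] in L^2. Then
   [c int |f|^2 <= Re int |f|^2 g <= int_D |f|^2], since [Re g <= g 0 = 1].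
   The second inequality follows by periodizing a non-periodic Turan function: as [D]
   has positive distance to the boundary of the cube, continuity is preserved, and
   the Fourier coefficients are values of the Fourier transform. For the third, the
   normalized autocorrelation of [D / 2] is an admissible function whose Fourier
   transform, a multiple of a squared cosine integral, equals [|D / 2|] at the origin. *)
Require Import Defs.
From mathcomp Require Import all_boot all_order all_algebra.
From mathcomp Require Import all_classical all_reals all_analysis.
From mathcomp Require Import measurable_realfun complex.
From mathcomp Require Import ring lra.

Import Order.TTheory GRing.Theory Num.Theory.
Import numFieldTopology.Exports numFieldNormedType.Exports.
Local Open Scope classical_set_scope.
Local Open Scope ring_scope.
Local Notation Re := (@complex.Re _).
Local Notation Im := (@complex.Im _).
Local Notation normc := Normc.normc.

(** * Lebesgue measure on row vectors *)

(** The obstacle is that [f] is only known to be integrable on the cube and square integrable on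
    [D], so neither Parseval nor the density of trigonometric polynomials in L^2 applies to it at
    the outset. Density is therefore proved in L^2 of the weight 1 + |f|: one polynomial then
    approximates a bounded function both in L^2 and, by Young's inequality, when integrated against
    [f]. The positivity of the pairing of [f] with a continuous [G] avoids L^2 as well: [G] is a
    bounded pointwise limit of polynomials with nonnegative coefficients, and dominated convergence
    only asks that [f] be integrable. Subtracting c from [g] changes the zeroth coefficient alone,
    which becomes 0; c is the largest constant that keeps all coefficients nonnegative. No Fourier
    series is ever summed: every estimate concerns a finite family of frequencies, with an error t K
    for arbitrarily small t. The half body is the right set to correlate because convexity gives D/2
    + D/2 inside D. *)

Lemma rV_ballE {R : realType} {n} {c x : 'rV[R]_n} {r : R} : 0 < r ->
  ball c r x <-> forall i, `|c ord0 i - x ord0 i| < r.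
Proof.
move=> r0; split=> [[_ +] i|h]; first by move=> /(_ ord0 i).
by split=> // i j; rewrite (ord1 i); exact: h.
Qed.

Lemma measurable_rV_box {d} {T : measurableType d} {n} (B : 'I_n -> set T) :
  (forall i, measurable (B i)) ->
  measurable [set x : 'rV[T]_n | forall i, B i (x ord0 i)].
Proof.
move=> mB.
rewrite (_ : mkset _ = \bigcap_(i in [set: 'I_n]) [set x : 'rV[T]_n | B i (x ord0 i)]).
  apply: fin_bigcap_measurable => // i _.
  rewrite -[X in measurable X]setTI.
  by apply: (@measurable_rV_coord _ T n i) => //.
by apply/seteqP; split => [x h i _|x h i]; [exact: h|exact: h].
Qed.

Lemma measurable_rV_ball {R : realType} {n} (c : 'rV[R]_n) (r : R) : measurable (ball c r).
Proof.
have [r0|r0] := ltP 0 r; last first.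
  rewrite (_ : ball c r = set0)//; apply/seteqP; split => // x [/=].
  by rewrite ltNge r0.
rewrite (_ : ball c r = [set x : 'rV[R]_n | forall i, ball (c ord0 i) r (x ord0 i)]).
  by apply: (@measurable_rV_box _ R n (fun i => ball (c ord0 i) r)) => i; exact: measurable_ball.
by apply/seteqP; split => x /=; rewrite (rV_ballE r0).
Qed.

(** The sigma-algebra is generated by the coordinates, not by the open sets. Balls of the sup norm
    are boxes, hence measurable, and an open set is the union of the countably many balls with
    rational centre and radius that it contains. *)
Lemma open_measurable_rV {R : realType} {n} (U : set 'rV[R]_n) : open U -> measurable U.
Proof.
move=> oU.
pose B (p : 'rV[rat]_n * rat) : set 'rV[R]_n := @ball R 'rV[R]_n (map_mx ratr p.1) (ratr p.2).
rewrite (_ : U = \bigcup_(p : 'rV[rat]_n * rat) (if `[< B p `<=` U >] then B p else set0)).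
  apply: countable_bigcupT_measurable; first exact: countableP.
  by move=> p; case: ifPn => // _; exact: measurable_rV_ball.
apply/seteqP; split => [x Ux|x [p _]]; last first.
  by case: asboolP => // pU /pU.
have /nbhs_ballP[e /= e0 eU] : nbhs x U by exact: open_nbhs_nbhs.
have e40 : 0 < e / 4 by rewrite divr_gt0.
(* The radius lies between e/4 and e/2 and the centre within e/4 of [x]: the ball contains [x], and
   it stays in [ball x e] since e/2 + e/4 < e. *)
have [r /andP[r1 r2]] : exists r : rat, e / 4 < ratr r < e / 2.
  have : e / 4 < e / 2 by rewrite ltr_pM2l// ltf_pV2 ?posrE//; lra.
  by move=> /rat_in_itvoo[q]; rewrite in_itv/=; exists q.
have ex i : exists q : rat, `|ratr q - x ord0 i| < e / 4.
  have : x ord0 i - e / 4 < x ord0 i + e / 4 by lra.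
  move=> /rat_in_itvoo[q]; rewrite in_itv/= => qx; exists q.
  by rewrite ltr_distl; lra.
have [q hq] := choice ex.
have r0 : 0 < ratr r :> R by apply: lt_trans r1.
exists (\row_i q i, r) => //=; case: asboolP => [_|].
  by apply/rV_ballE => // i; rewrite !mxE; apply: lt_trans r1.
move=> nB; exfalso; apply: nB => y /rV_ballE -/(_ r0) h; apply: eU; apply/rV_ballE => // i.
have := h i; have := hq i; rewrite !mxE /= => a b.
rewrite (_ : _ - _ = (ratr (q i) - y ord0 i) - (ratr (q i) - x ord0 i)); last by lra.
by apply: le_lt_trans (ler_normB _ _) _; lra.
Qed.

Lemma closed_measurable_rV {R : realType} {n} (U : set 'rV[R]_n) : closed U -> measurable U.
Proof.
by move=> cU; rewrite -(setCK U); apply: measurableC; apply: open_measurable_rV; exact: closed_openC.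
Qed.

Lemma continuous_measurable_rV {R : realType} {n} (f : 'rV[R]_n -> R) :
  continuous f -> measurable_fun setT f.
Proof.
move=> cf; apply: (measurability _ (RGenOInfty.measurableE R)) => _ [_ [a ->] <-].
rewrite setTI; apply: open_measurable_rV; apply: open_comp => [x _|]; first exact: cf.
exact: interval_open.
Qed.

Lemma cons_rV_ord0 {R : realType} {n} (p : measurableTypeR R * 'rV[R]_n) : cons_rV p ord0 ord0 = p.1.
Proof. by have /(congr1 fst) := cons_rVK p. Qed.

Lemma cons_rV_lift {R : realType} {n} (p : measurableTypeR R * 'rV[R]_n) i :
  cons_rV p ord0 (lift ord0 i) = p.2 ord0 i.
Proof.
have /(congr1 snd)/rowP/(_ i) := cons_rVK p; rewrite mxE => <-.
by congr (cons_rV p _ _); exact/val_inj.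
Qed.

Lemma forall_ordS {n} (P : 'I_n.+1 -> Prop) :
  (forall i, P i) <-> P ord0 /\ (forall i, P (lift ord0 i)).
Proof.
split=> [h|[h0 h] i]; first by split.
by case: (unliftP ord0 i) => [j|] ->.
Qed.

Lemma lebesgue_rV_box {R : realType} n (B : 'I_n -> set R) :
  (forall i, measurable (B i)) ->
  lebesgue_rV n [set x : 'rV[R]_n | forall i, B i (x ord0 i)] =
  (\prod_(i < n) lebesgue_measure (B i))%E.
Proof.
elim: n B => [|n IH] B mB.
  rewrite big_ord0 /= diracE (_ : _ \in _)// inE => -[].
  by [].
rewrite big_ord_recl -IH//.
transitivity ((lebesgue_measure \x lebesgue_rV n)%E (B ord0 `*` [set x : 'rV[R]_n | forall i, B (lift ord0 i) (x ord0 i)])).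
  rewrite /= /lebesgue_rV_step /pushforward; congr (_ _).
  apply/seteqP; split => [[t v]|[t v]] /=; rewrite forall_ordS cons_rV_ord0 /=.
    by move=> [h0 h]; split => // i; have := h i; rewrite cons_rV_lift.
  by move=> [h0 h]; split => // i; rewrite cons_rV_lift; exact: h.
rewrite product_measure1E//; first exact: mB.
by apply: (@measurable_rV_box _ R n (fun i => B (lift ord0 i))) => i; exact: mB.
Qed.

Lemma measurable_cube {R : realType} {n} : measurable (@cube R n).
Proof.
rewrite (_ : cube = [set x : 'rV[R]_n | forall i, `[- 2^-1, 2^-1[%classic (x ord0 i)]).
  by apply: (@measurable_rV_box _ R n (fun=> `[- 2^-1, 2^-1[%classic)) => i; exact: measurable_itv.
by apply/seteqP; split => x h i; have := h i; rewrite /= in_itv.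
Qed.

Lemma lebesgue_cube {R : realType} {n} : lebesgue_rV n (@cube R n) = 1%E.
Proof.
rewrite (_ : cube = [set x : 'rV[R]_n | forall i, `[- 2^-1, 2^-1[%classic (x ord0 i)]); last first.
  by apply/seteqP; split => x h i; have := h i; rewrite /= in_itv.
rewrite (@lebesgue_rV_box R n (fun=> `[- 2^-1, 2^-1[%classic)).
  rewrite big1// => i _.
  rewrite lebesgue_measure_itv/= lte_fin ifT; last by lra.
  by rewrite -EFinD; congr EFin; lra.
by move=> i; exact: measurable_itv.
Qed.

Lemma lebesgue_rV_ball_gt0 {R : realType} {n} (c : 'rV[R]_n) (r : R) : 0 < r ->
  (0 < lebesgue_rV n (ball c r))%E.
Proof.
move=> r0.
rewrite (_ : ball c r = [set x : 'rV[R]_n | forall i, ball (c ord0 i) r (x ord0 i)]); last first.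
  by apply/seteqP; split => x /=; rewrite (rV_ballE r0).
rewrite (@lebesgue_rV_box R n (fun i => ball (c ord0 i) r)).
  elim/big_ind : _ => //= [x y x0 y0|i _]; first exact: mule_gt0.
  by rewrite lebesgue_measure_ball ?ltW// lte_fin mulrn_wgt0.
by move=> i; exact: measurable_ball.
Qed.

(** The measure in dimension n + 1 is by definition the image of a product measure under [cons_rV],
    so a change of variables followed by Tonelli peels off one coordinate. Every invariance of
    [lebesgue_rV] is obtained from this by induction on the dimension. *)
Lemma ge0_integral_rVS {R : realType} {n} (f : 'rV[R]_n.+1 -> \bar R) :
  measurable_fun setT f -> (forall x, 0 <= f x)%E ->
  (\int[lebesgue_rV n.+1]_x f x =
   \int[lebesgue_measure]_t \int[lebesgue_rV n]_v f (cons_rV (t, v)))%E.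
Proof.
move=> mf f0.
transitivity (\int[(lebesgue_measure \x lebesgue_rV n)%E]_p f (cons_rV p))%E.
  rewrite -[setT in RHS](@preimage_setT _ _ (@cons_rV R n)).
  by rewrite -(ge0_integral_pushforward (@measurable_cons_rV R n)) => //= x _; exact: f0.
rewrite fubini_tonelli1//.
by apply: measurableT_comp => //; exact: measurable_cons_rV.
Qed.

Lemma ge0_integral_opp {R : realType} (f : R -> \bar R) :
  measurable_fun setT f -> (forall x, 0 <= f x)%E ->
  (\int[lebesgue_measure]_t f (- t)%R = \int[lebesgue_measure]_t f t)%E.
Proof.
move=> mf f0.
transitivity (\int[pushforward (@lebesgue_measure R) (-%R : measurableTypeR R -> measurableTypeR R)]_t f t)%E.
  by rewrite ge0_integral_pushforward.
by apply: eq_measure_integral => //= A mA _; exact: lebesgue_measureN.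
Qed.

Lemma lebesgue_measureD {R : realType} (a : R) (A : set R) : measurable A ->
  pushforward lebesgue_measure ((fun t : R => (t + a)%R) : measurableTypeR R -> measurableTypeR R) A = lebesgue_measure A.
Proof.
move=> mA; apply/esym.
have mshift : measurable_fun setT ((fun t : R => (t + a)%R) : measurableTypeR R -> measurableTypeR R).
  exact: measurable_funD.
apply: lebesgue_measure_unique => //= _ [[x y]] _ <-.
rewrite /pushforward (_ : _ @^-1` _ = `]x - a, y - a]%classic); last first.
  by apply/seteqP; split => t /=; rewrite !in_itv/=; lra.
rewrite !lebesgue_measure_itv/= !lte_fin ltrD2r -!EFinD.
by case: ifP => // _; congr EFin; lra.
Qed.

Lemma ge0_integral_shift {R : realType} (a : R) (f : R -> \bar R) :
  measurable_fun setT f -> (forall x, 0 <= f x)%E ->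
  (\int[lebesgue_measure]_t f (t + a)%R = \int[lebesgue_measure]_t f t)%E.
Proof.
move=> mf f0.
have mshift : measurable_fun setT ((fun t : R => (t + a)%R) : measurableTypeR R -> measurableTypeR R).
  exact: measurable_funD.
transitivity (\int[pushforward (@lebesgue_measure R) ((fun t : R => (t + a)%R) : measurableTypeR R -> measurableTypeR R)]_t f t)%E.
  by rewrite ge0_integral_pushforward.
by apply: eq_measure_integral => //= A mA _; exact: lebesgue_measureD.
Qed.

Lemma cons_rVD {R : realType} {n} (p q : measurableTypeR R * 'rV[R]_n) :
  cons_rV p + cons_rV q = cons_rV (p.1 + q.1, p.2 + q.2).
Proof.
apply/rowP => i; rewrite [LHS]mxE.
by case: (unliftP ord0 i) => [j|] ->; rewrite ?cons_rV_lift ?cons_rV_ord0//= mxE.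
Qed.

Lemma cons_rVN {R : realType} {n} (p : measurableTypeR R * 'rV[R]_n) :
  - cons_rV p = cons_rV (- p.1, - p.2).
Proof.
apply/rowP => i; rewrite [LHS]mxE.
by case: (unliftP ord0 i) => [j|] ->; rewrite ?cons_rV_lift ?cons_rV_ord0//= mxE.
Qed.

Lemma measurable_integral_cons_rV {R : realType} {n} (f : 'rV[R]_n.+1 -> \bar R) :
  measurable_fun setT f -> (forall x, 0 <= f x)%E ->
  measurable_fun setT (fun t : R => \int[lebesgue_rV n]_v f (cons_rV (t, v)))%E.
Proof.
move=> mf f0.
apply: (@measurable_fun_fubini_tonelli_F _ _ _ _ R (lebesgue_rV n) (f \o @cons_rV R n)).
  by apply: measurableT_comp => //; exact: measurable_cons_rV.
by move=> x /=.
Qed.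

Lemma measurable_cons_rV_fix {R : realType} {n} (t : R) :
  measurable_fun setT (fun v : 'rV[R]_n => cons_rV (t, v)).
Proof.
apply: (measurableT_comp (@measurable_cons_rV R n)).
exact: measurable_pair1.
Qed.

Lemma ge0_integral_rV_shift {R : realType} {n} (a : 'rV[R]_n) (f : 'rV[R]_n -> \bar R) :
  measurable_fun setT f -> (forall x, 0 <= f x)%E ->
  (\int[lebesgue_rV n]_x f (x + a)%R = \int[lebesgue_rV n]_x f x)%E.
Proof.
elim: n a f => [|n IH] a f mf f0.
  by apply: eq_integral => x _; rewrite (thinmx0 a) addr0.
have ma : measurable_fun setT (fun x : 'rV[R]_n.+1 => x + a).
  apply: measurable_fun_rVP => i.
  rewrite (_ : (fun _ => _) = (fun x : 'rV[R]_n.+1 => x ord0 i + a ord0 i)).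
    by apply: measurable_funD => //; exact: (@measurable_rV_coord _ R).
  by apply/funext => x; rewrite !mxE.
rewrite [LHS]ge0_integral_rVS; [|exact: (measurableT_comp mf ma)|by []].
rewrite [RHS]ge0_integral_rVS; [|exact: mf|exact: f0].
set a0 := (uncons_rV a).1; set a' := (uncons_rV a).2.
rewrite -[RHS](@ge0_integral_shift _ a0); last 2 first.
- exact: measurable_integral_cons_rV.
- by move=> t; apply: integral_ge0.
apply: eq_integral => t _.
rewrite -[RHS](IH a'); [|exact: (measurableT_comp mf (measurable_cons_rV_fix (t + a0)))|by []].
by apply: eq_integral => v _; rewrite -[a]uncons_rVK cons_rVD.
Qed.

Lemma measurable_rV_opp {R : realType} {n} : measurable_fun setT (fun x : 'rV[R]_n => - x).
Proof.
apply: measurable_fun_rVP => i.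
rewrite (_ : (fun _ => _) = (fun x : 'rV[R]_n => - x ord0 i)).
  by apply: measurableT_comp => //; exact: (@measurable_rV_coord _ R).
by apply/funext => x; rewrite !mxE.
Qed.

Lemma ge0_integral_rV_opp {R : realType} {n} (f : 'rV[R]_n -> \bar R) :
  measurable_fun setT f -> (forall x, 0 <= f x)%E ->
  (\int[lebesgue_rV n]_x f (- x)%R = \int[lebesgue_rV n]_x f x)%E.
Proof.
elim: n f => [|n IH] f mf f0.
  by apply: eq_integral => x _; rewrite (thinmx0 x) oppr0.
rewrite [LHS]ge0_integral_rVS; [|exact: (measurableT_comp mf measurable_rV_opp)|by []].
rewrite [RHS]ge0_integral_rVS; [|exact: mf|exact: f0].
rewrite -[RHS]ge0_integral_opp; last 2 first.
- exact: measurable_integral_cons_rV.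
- by move=> t; apply: integral_ge0.
apply: eq_integral => t _.
rewrite -[RHS]IH; [|exact: (measurableT_comp mf (measurable_cons_rV_fix (- t)))|by []].
by apply: eq_integral => v _; rewrite cons_rVN.
Qed.

(** * Complex-valued integrals *)

Section complex_parts.
Context {R : realType}.
Implicit Types x y z : R[i].

Lemma complex_eqP x y : Re x = Re y -> Im x = Im y -> x = y.
Proof. by case: x y => [a b] [c d] /= -> ->. Qed.
Lemma Re_add x y : Re (x + y) = Re x + Re y. Proof. by case: x y => [a b] []. Qed.
Lemma Im_add x y : Im (x + y) = Im x + Im y. Proof. by case: x y => [a b] []. Qed.
Lemma Re_opp x : Re (- x) = - Re x. Proof. by case: x. Qed.
Lemma Im_opp x : Im (- x) = - Im x. Proof. by case: x. Qed.
Lemma Re_mul x y : Re (x * y) = Re x * Re y - Im x * Im y.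
Proof. by case: x y => [a b] []. Qed.
Lemma Im_mul x y : Im (x * y) = Re x * Im y + Im x * Re y.
Proof. by case: x y => [a b] []. Qed.
Lemma Re_conjc x : Re (conjc x) = Re x. Proof. by case: x. Qed.
Lemma Im_conjc x : Im (conjc x) = - Im x. Proof. by case: x. Qed.

Lemma Re_sum I (s : seq I) (F : I -> R[i]) : Re (\sum_(i <- s) F i) = \sum_(i <- s) Re (F i).
Proof. by elim: s => [|i s IH]; rewrite ?big_nil// !big_cons Re_add IH. Qed.
Lemma normc_ge0 x : 0 <= normc x. Proof. by case: x => a b; exact: sqrtr_ge0. Qed.

Lemma normc_sqrE x : normc x ^+ 2 = Re x ^+ 2 + Im x ^+ 2.
Proof. by case: x => a b /=; rewrite sqr_sqrtr// addr_ge0// sqr_ge0. Qed.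

Lemma normr_Re_le x : `|Re x| <= normc x.
Proof. by rewrite -(ler_pXn2r (n := 2))// ?nnegrE ?normc_ge0// normc_sqrE real_normK ?num_real// lerDl sqr_ge0. Qed.

Lemma normr_Im_le x : `|Im x| <= normc x.
Proof. by rewrite -(ler_pXn2r (n := 2))// ?nnegrE ?normc_ge0// normc_sqrE real_normK ?num_real// lerDr sqr_ge0. Qed.

Lemma normc_le x : normc x <= `|Re x| + `|Im x|.
Proof.
rewrite -(ler_pXn2r (n := 2))// ?nnegrE ?normc_ge0 ?addr_ge0//.
rewrite normc_sqrE sqrrD !real_normK ?num_real// lerD2r lerDl.
by rewrite mulrn_wge0// mulr_ge0.
Qed.

Lemma normc_conj x : normc (conjc x) = normc x.
Proof. by case: x => a b /=; rewrite sqrrN. Qed.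

Lemma complex_ge0P z : reflect (0 <= Re z /\ Im z = 0) (0 <= z).
Proof. by rewrite lecE /=; apply: (iffP andP) => [[/eqP]|[]] /=; split => //; apply/eqP. Qed.

End complex_parts.

Lemma integrable_eq {d} {T : measurableType d} {R : realType} {mu : {measure set T -> \bar R}}
    {A : set T} {f g : T -> \bar R} : measurable A -> mu.-integrable A f ->
  (forall x, A x -> f x = g x) -> mu.-integrable A g.
Proof. by move=> mA /[swap] fg; apply: eq_integrable => // x /set_mem /fg. Qed.

Section complex_integral.
Context {R : realType} {n : nat}.
Implicit Types (A : set 'rV[R]_n) (f g h : 'rV[R]_n -> R[i]).
Local Notation mu := (lebesgue_rV n).

Lemma normc_measurable A f : cmeasurable_fun A f -> measurable_fun A (fun x => normc (f x)).
Proof.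
move=> [mr mi].
rewrite (_ : (fun _ => _) = (fun x => Num.sqrt (Re (f x) ^+ 2 + Im (f x) ^+ 2))).
  apply: (measurableT_comp (continuous_measurable_fun (@sqrt_continuous R))).
  by apply: measurable_funD; apply: measurable_funX.
by apply/funext => x; case: (f x).
Qed.

Lemma cmeasurableM A f g : cmeasurable_fun A f -> cmeasurable_fun A g ->
  cmeasurable_fun A (fun x => f x * g x).
Proof.
move=> [fr fi] [gr gi]; split.
  rewrite (_ : (fun _ => _) = (fun x => Re (f x) * Re (g x) - Im (f x) * Im (g x))).
    by apply: measurable_funB; apply: measurable_funM.
  by apply/funext => x; rewrite Re_mul.
rewrite (_ : (fun _ => _) = (fun x => Re (f x) * Im (g x) + Im (f x) * Re (g x))).
  by apply: measurable_funD; apply: measurable_funM.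
by apply/funext => x; rewrite Im_mul.
Qed.

Lemma cmeasurableD A f g : cmeasurable_fun A f -> cmeasurable_fun A g ->
  cmeasurable_fun A (fun x => f x + g x).
Proof.
move=> [fr fi] [gr gi]; split.
  rewrite (_ : (fun _ => _) = (fun x => Re (f x) + Re (g x))).
    exact: measurable_funD.
  by apply/funext => x; rewrite Re_add.
rewrite (_ : (fun _ => _) = (fun x => Im (f x) + Im (g x))).
  exact: measurable_funD.
by apply/funext => x; rewrite Im_add.
Qed.

Lemma cmeasurable_cst A (c : R[i]) : cmeasurable_fun A (fun=> c).
Proof. by split; exact: measurable_cst. Qed.

Lemma cmeasurable_conj A f : cmeasurable_fun A f -> cmeasurable_fun A (fun x => conjc (f x)).
Proof.
move=> [fr fi]; split.
  by rewrite (_ : (fun _ => _) = (fun x => Re (f x)))//; apply/funext => x; rewrite Re_conjc.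
rewrite (_ : (fun _ => _) = (fun x => - Im (f x))); first exact: measurableT_comp.
by apply/funext => x; rewrite Im_conjc.
Qed.

Lemma cmeasurableN A f : cmeasurable_fun A f -> cmeasurable_fun A (fun x => - f x).
Proof.
move=> mf; rewrite (_ : (fun _ => _) = (fun x => (-1) * f x)).
  by apply: cmeasurableM => //; exact: cmeasurable_cst.
by apply/funext => x; rewrite mulN1r.
Qed.

Lemma cmeasurable_sum A (I : Type) (s : seq I) (F : I -> 'rV[R]_n -> R[i]) :
  (forall i, cmeasurable_fun A (F i)) -> cmeasurable_fun A (fun x => \sum_(i <- s) F i x).
Proof.
move=> mF; elim: s => [|i s IH].
  by under eq_fun do rewrite big_nil; exact: cmeasurable_cst.
by under eq_fun do rewrite big_cons; exact: cmeasurableD.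
Qed.

Lemma cintegrableP A f : measurable A ->
  cintegrable A f <-> mu.-integrable A (fun x => (Re (f x))%:E) /\
                      mu.-integrable A (fun x => (Im (f x))%:E).
Proof.
move=> mA; split=> [[[mr mi] fin]|[/[dup] /measurable_int /measurable_EFinP mr ir
    /[dup] /measurable_int /measurable_EFinP mi ii]].
  have inorm : mu.-integrable A (fun x => (normc (f x))%:E).
    apply/integrableP; split; first by apply/measurable_EFinP; exact: normc_measurable.
    apply: le_lt_trans fin; rewrite le_eqVlt; apply/orP; left; apply/eqP.
    by apply: eq_integral => x _ /=; rewrite ger0_norm ?normc_ge0.
  split; apply: (le_integrable mA _ _ inorm) => //.
  - exact/measurable_EFinP.
  - by move=> x _; rewrite lee_fin (ger0_norm (normc_ge0 _)) normr_Re_le.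
  - exact/measurable_EFinP.
  - by move=> x _; rewrite lee_fin (ger0_norm (normc_ge0 _)) normr_Im_le.
split=> //.
have := integrableD mA (integrable_norm ir) (integrable_norm ii).
move=> /integrableP[_]; apply: le_lt_trans.
apply: ge0_le_integral => //.
- by move=> x _; rewrite lee_fin normc_ge0.
- by apply/measurable_EFinP; exact: normc_measurable.
- apply: measurableT_comp => //; apply/measurable_EFinP.
  by apply: measurable_funD; apply: measurableT_comp.
- by move=> x _ /=; rewrite lee_fin ger0_norm ?addr_ge0// normc_le.
Qed.

Lemma cintegrable_meas A f : cintegrable A f -> cmeasurable_fun A f.
Proof. by case. Qed.

Lemma cintegrableD A f g : measurable A -> cintegrable A f -> cintegrable A g ->
  cintegrable A (fun x => f x + g x).
Proof.
move=> mA /(cintegrableP _ _ mA)[fr fi] /(cintegrableP _ _ mA)[gr gi]; apply/(cintegrableP _ _ mA); split.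
  by apply: (integrable_eq mA (integrableD mA fr gr)) => x _; rewrite Re_add.
by apply: (integrable_eq mA (integrableD mA fi gi)) => x _; rewrite Im_add.
Qed.

Lemma cintegrableMb A f h (M : R) : measurable A -> cintegrable A f -> cmeasurable_fun A h ->
  (forall x, A x -> normc (h x) <= M) -> cintegrable A (fun x => f x * h x).
Proof.
move=> mA if_ mh hM; have [mf fin] := if_; split; first exact: cmeasurableM.
have mnf : measurable_fun A (fun x => (normc (f x))%:E) by apply/measurable_EFinP; exact: normc_measurable.
(* The absolute value covers a negative [M], which is possible when [A] is empty. *)
apply: (@le_lt_trans _ _ (\int[mu]_(x in A) (`|M|%:E * (normc (f x))%:E))%E).
  apply: ge0_le_integral => //.
  - by move=> x _; rewrite lee_fin normc_ge0.
  - by apply/measurable_EFinP; apply: normc_measurable; exact: cmeasurableM.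
  - exact: measurable_funeM.
  - move=> x Ax; rewrite -EFinM lee_fin Normc.normcM mulrC ler_wpM2r ?normc_ge0//.
    exact: le_trans (hM _ Ax) (ler_norm _).
rewrite ge0_integralZl_EFin//; last by move=> x _; rewrite lee_fin normc_ge0.
rewrite lte_mul_pinfty//.
Qed.

Lemma cintegrableZ A (c : R[i]) f : measurable A -> cintegrable A f ->
  cintegrable A (fun x => c * f x).
Proof.
move=> mA fi; rewrite (_ : (fun _ => _) = (fun x => f x * c)).
  by apply: (@cintegrableMb _ _ _ (normc c)) => //; exact: cmeasurable_cst.
by apply/funext => x; rewrite mulrC.
Qed.

Lemma eq_cintegral A f g : (forall x, A x -> f x = g x) -> cintegral A f = cintegral A g.
Proof. by move=> fg; congr Complex; apply: eq_Rintegral => x /set_mem /fg ->. Qed.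

Lemma cintegralD A f g : measurable A -> cintegrable A f -> cintegrable A g ->
  cintegral A (fun x => f x + g x) = cintegral A f + cintegral A g.
Proof.
move=> mA /(cintegrableP _ _ mA)[fr fi] /(cintegrableP _ _ mA)[gr gi].
apply: complex_eqP; rewrite ?Re_add ?Im_add /= -RintegralD//; apply: eq_Rintegral => x _.
  by rewrite Re_add.
by rewrite Im_add.
Qed.

Lemma cintegralZ A (c : R[i]) f : measurable A -> cintegrable A f ->
  cintegral A (fun x => c * f x) = c * cintegral A f.
Proof.
move=> mA /(cintegrableP _ _ mA)[fr fi].
have Zr k := @RintegralZl _ _ _ mu A (fun x => Re (f x)) k mA fr.
have Zi k := @RintegralZl _ _ _ mu A (fun x => Im (f x)) k mA fi.
have IZr k : mu.-integrable A (EFin \o (fun x => k * Re (f x))).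
  by apply: (integrable_eq mA (integrableZl mA k fr)) => x _ /=; rewrite EFinM.
have IZi k : mu.-integrable A (EFin \o (fun x => k * Im (f x))).
  by apply: (integrable_eq mA (integrableZl mA k fi)) => x _ /=; rewrite EFinM.
apply: complex_eqP; rewrite ?Re_mul ?Im_mul /=.
  by rewrite -Zr -Zi -RintegralB//; apply: eq_Rintegral => x _; rewrite Re_mul.
by rewrite -Zr -Zi -RintegralD//; apply: eq_Rintegral => x _; rewrite Im_mul.
Qed.

Lemma cintegrable_cst0 A : cintegrable A (fun=> 0).
Proof.
split; first exact: cmeasurable_cst.
under eq_integral do rewrite Normc.normc0.
by rewrite integral0.
Qed.

Lemma cintegral_cst0 A : cintegral A (fun=> 0) = 0.
Proof. by apply: complex_eqP => /=; rewrite /Rintegral integral0. Qed.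

Lemma cintegrable_sum A (I : Type) (s : seq I) (F : I -> 'rV[R]_n -> R[i]) : measurable A ->
  (forall i, cintegrable A (F i)) -> cintegrable A (fun x => \sum_(i <- s) F i x).
Proof.
move=> mA iF; elim: s => [|i s IH].
  by under eq_fun do rewrite big_nil; exact: cintegrable_cst0.
by under eq_fun do rewrite big_cons; exact: cintegrableD.
Qed.

Lemma cintegral_sum A (I : Type) (s : seq I) (F : I -> 'rV[R]_n -> R[i]) : measurable A ->
  (forall i, cintegrable A (F i)) ->
  cintegral A (fun x => \sum_(i <- s) F i x) = \sum_(i <- s) cintegral A (F i).
Proof.
move=> mA iF; elim: s => [|i s IH].
  by under eq_fun do rewrite big_nil; rewrite big_nil cintegral_cst0.
under eq_fun do rewrite big_cons.
by rewrite cintegralD// ?IH ?big_cons//; exact: cintegrable_sum.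
Qed.

End complex_integral.

(** * Characters and trigonometric polynomials *)

Section one_dim_characters.
Context {R : realType}.

Lemma sin_pi_nat (k : nat) : sin (pi * k%:R) = 0 :> R.
Proof.
elim: k => [|k IH]; first by rewrite mulr0 sin0.
by rewrite -natr1 mulrDr mulr1 sinDpi IH oppr0.
Qed.

Lemma sin_pi_int (k : int) : sin (pi * k%:~R) = 0 :> R.
Proof.
case: (intP k) => [|m|m]; rewrite ?mulr0z ?mulr0 ?sin0//.
  exact: sin_pi_nat.
by rewrite mulrNz mulrN sinN sin_pi_nat oppr0.
Qed.

Lemma is_derive_sin_linear (a t : R) : a != 0 -> is_derive t 1 (fun t => sin (a * t) / a) (cos (a * t)).
Proof.
move=> a0; apply: is_derive_eq; rewrite /GRing.scale/= !(mulr0, mul0r, addr0, add0r, scaler0, scale0r, mulr1).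
by field.
Qed.

Lemma is_derive_cos_linear (a t : R) : a != 0 -> is_derive t 1 (fun t => - cos (a * t) / a) (sin (a * t)).
Proof.
move=> a0; apply: is_derive_eq; rewrite /GRing.scale/= !(mulr0, mul0r, addr0, add0r, scaler0, scale0r, mulr1).
by field.
Qed.

Lemma integral_derive_itv (F f : R -> R) (a b : R) : a < b ->
  (forall t : R, is_derive t (1 : R^o) (F : R^o -> R^o) (f t)) -> continuous f ->
  \int[lebesgue_measure]_(t in `[a, b[) f t = F b - F a.
Proof.
move=> ab dF cf.
have cF : continuous F.
  by move=> t; apply: differentiable_continuous; apply/derivable1_diffP; exact: ex_derive.
rewrite Rintegral_itv_bndo_bndc; last first.
  have : lebesgue_measure.-integrable `[a, b] (EFin \o f).
    apply: continuous_compact_integrable; first exact: segment_compact.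
    exact: continuous_subspaceT.
  by apply: integrableS => // t /=; rewrite !in_itv/= => /andP[-> /ltW].
rewrite /Rintegral (@continuous_FTC2 _ f F)//.
- exact: continuous_subspaceT.
- split=> [t _||].
  + exact: ex_derive.
  + by apply: cvg_at_right_filter; exact: cF.
  + by apply: cvg_at_left_filter; exact: cF.
- by move=> t _; rewrite derive1E; exact: derive_val.
Qed.

Lemma integral_cos_int (k : int) : k != 0 ->
  \int[lebesgue_measure]_(t in `[- 2^-1, 2^-1[) cos (2 * pi * k%:~R * t) = 0 :> R.
Proof.
move=> k0; have a0 : 2 * pi * k%:~R != 0 :> R.
  by rewrite !mulf_neq0// ?intr_eq0// gt_eqF// pi_gt0.
rewrite (@integral_derive_itv (fun t => sin (2 * pi * k%:~R * t) / (2 * pi * k%:~R)) _ _ _ _ (fun t => @is_derive_sin_linear _ t a0)).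
- rewrite mulrN sinN (_ : 2 * pi * _ / 2 = pi * k%:~R); last by field.
  by rewrite sin_pi_int mul0r oppr0 mul0r subrr.
- lra.
- move=> t; apply: (continuous_comp _ (@continuous_cos R _)).
  exact: mulrl_continuous.
Qed.

Lemma integral_sin_int (k : int) :
  \int[lebesgue_measure]_(t in `[- 2^-1, 2^-1[) sin (2 * pi * k%:~R * t) = 0 :> R.
Proof.
have [->|k0] := eqVneq k 0.
  by under eq_Rintegral do rewrite mulr0 mul0r sin0; rewrite /Rintegral integral0.
have a0 : 2 * pi * k%:~R != 0 :> R.
  by rewrite !mulf_neq0// ?intr_eq0// gt_eqF// pi_gt0.
rewrite (@integral_derive_itv (fun t => - cos (2 * pi * k%:~R * t) / (2 * pi * k%:~R)) _ _ _ _ (fun t => @is_derive_cos_linear _ t a0)).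
- by rewrite mulrN cosN subrr.
- lra.
- move=> t; apply: (continuous_comp _ (@continuous_sin R _)).
  exact: mulrl_continuous.
Qed.

End one_dim_characters.

Section characters.
Context {R : realType} {n : nat}.
Implicit Types (xi x y : 'rV[R]_n) (nu k : 'rV[int]_n).
Local Notation dot a b := (\sum_(i < n) a ord0 i * b ord0 i).

Lemma Re_expN2pii xi x : Re (expN2pii xi x) = cos (2 * pi * dot xi x). Proof. by []. Qed.
Lemma expN2piiDr xi x y : expN2pii xi (x + y) = expN2pii xi x * expN2pii xi y.
Proof.
have -> : expN2pii xi (x + y) =
    (let t := 2 * pi * dot xi x + 2 * pi * dot xi y in Complex (cos t) (- sin t)).
  rewrite /expN2pii -mulrDr -big_split/=.
  by congr (let t := 2 * pi * _ in Complex (cos t) (- sin t)); apply: eq_bigr => i _; rewrite mxE mulrDr.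
apply: complex_eqP; rewrite ?Re_mul ?Im_mul /= ?cosD ?sinD; lra.
Qed.

Lemma expN2piiC xi x : expN2pii xi x = expN2pii x xi.
Proof.
rewrite /expN2pii; congr (let t := 2 * pi * _ in Complex (cos t) (- sin t)).
by apply: eq_bigr => i _; rewrite mulrC.
Qed.

Lemma expN2piiDl xi eta x : expN2pii (xi + eta) x = expN2pii xi x * expN2pii eta x.
Proof. by rewrite !(expN2piiC _ x) expN2piiDr. Qed.

Lemma expN2pii0l x : expN2pii 0 x = 1.
Proof.
rewrite /expN2pii (_ : dot _ _ = 0) ?mulr0 /= ?cos0 ?sin0 ?oppr0//.
by rewrite big1// => i _; rewrite mxE mul0r.
Qed.

Lemma expN2pii0r xi : expN2pii xi 0 = 1. Proof. by rewrite expN2piiC expN2pii0l. Qed.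

Lemma expN2piiNr xi x : expN2pii xi (- x) = conjc (expN2pii xi x).
Proof.
have -> : expN2pii xi (- x) = (let t := - (2 * pi * dot xi x) in Complex (cos t) (- sin t)).
  rewrite /expN2pii -mulrN -sumrN.
  by congr (let t := 2 * pi * _ in Complex (cos t) (- sin t)); apply: eq_bigr => i _; rewrite mxE mulrN.
by rewrite /= cosN sinN.
Qed.

Lemma expN2piiNl xi x : expN2pii (- xi) x = conjc (expN2pii xi x).
Proof. by rewrite expN2piiC expN2piiNr expN2piiC. Qed.

Lemma normc_expN2pii xi x : normc (expN2pii xi x) = 1.
Proof. by rewrite /expN2pii /= sqrrN cos2Dsin2 sqrtr1. Qed.

Lemma measurable_dot xi : measurable_fun setT (fun x => 2 * pi * dot xi x).
Proof.
apply: measurable_funM => //; apply: measurable_sum => i.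
by apply: measurable_funM => //; exact: (@measurable_rV_coord _ R).
Qed.

Lemma cmeasurable_expN2pii A xi : cmeasurable_fun A (expN2pii xi).
Proof.
split; apply: measurable_funTS.
  apply: (measurableT_comp (continuous_measurable_fun (@continuous_cos R))).
  exact: measurable_dot.
have msin : measurable_fun setT (fun x => sin (2 * pi * dot xi x)).
  apply: (measurableT_comp (continuous_measurable_fun (@continuous_sin R))).
  exact: measurable_dot.
rewrite (_ : (fun _ => _) = (fun x => - sin (2 * pi * dot xi x)))//.
exact: measurableT_comp.
Qed.

Lemma int_vec0 : int_vec 0 = 0 :> 'rV[R]_n.
Proof. by apply/rowP => i; rewrite !mxE. Qed.
Lemma int_vecD k1 k2 : int_vec (k1 + k2) = int_vec k1 + int_vec k2 :> 'rV[R]_n.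
Proof. by apply/rowP => i; rewrite !mxE intrD. Qed.
Lemma int_vecN k : int_vec (- k) = - int_vec k :> 'rV[R]_n.
Proof. by apply/rowP => i; rewrite !mxE intrN. Qed.

End characters.

(** * Orthogonality of the characters on the cube *)

Section cube_orthogonality.
Context {R : realType}.

Lemma cube_cons_rV n (p : measurableTypeR R * 'rV[R]_n) :
  cube (cons_rV p) <-> `[- 2^-1, 2^-1[%classic p.1 /\ cube p.2.
Proof.
rewrite /cube /= forall_ordS cons_rV_ord0 in_itv/=.
split=> -[h0 h]; split=> // i; have := h i; by rewrite cons_rV_lift.
Qed.

Lemma expN2pii_cons_rV n (xi : 'rV[R]_n.+1) (p : measurableTypeR R * 'rV[R]_n) :
  expN2pii xi (cons_rV p) =
  (let t := 2 * pi * xi ord0 ord0 * p.1 in Complex (cos t) (- sin t)) *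
  expN2pii (\row_i xi ord0 (lift ord0 i)) p.2.
Proof.
have -> : expN2pii xi (cons_rV p) = (let t := 2 * pi * xi ord0 ord0 * p.1 +
    2 * pi * \sum_(i < n) (\row_i xi ord0 (lift ord0 i)) ord0 i * p.2 ord0 i in
    Complex (cos t) (- sin t)).
  rewrite /expN2pii -[_ * xi ord0 ord0 * _]mulrA -mulrDr big_ord_recl cons_rV_ord0.
  congr (let t := 2 * pi * (_ + _) in Complex (cos t) (- sin t)).
  by apply: eq_bigr => i _; rewrite cons_rV_lift mxE.
apply: complex_eqP; rewrite ?Re_mul ?Im_mul /= ?cosD ?sinD; lra.
Qed.

Lemma integral_rVS {n} (f : 'rV[R]_n.+1 -> R) :
  (lebesgue_rV n.+1).-integrable setT (EFin \o f) ->
  (\int[lebesgue_rV n.+1]_x (f x)%:E =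
   \int[lebesgue_measure]_t \int[lebesgue_rV n]_v (f (cons_rV (t, v)))%:E)%E.
Proof.
move=> if_; have [mf lf] := integrableP _ _ _ if_.
have mfc : measurable_fun setT ((EFin \o f) \o @cons_rV R n).
  by apply: measurableT_comp => //; exact: measurable_cons_rV.
have ic : ((@lebesgue_measure R \x lebesgue_rV n)%E).-integrable setT ((EFin \o f) \o @cons_rV R n).
  apply/integrableP; split => //; apply: le_lt_trans lf.
  rewrite [leRHS](ge0_integral_pushforward (@measurable_cons_rV R n))//=.
  by apply/measurable_EFinP; apply: measurableT_comp => //; exact/measurable_EFinP.
transitivity (\int[(@lebesgue_measure R \x lebesgue_rV n)%E]_p ((f (cons_rV p))%:E))%E.
  by rewrite [LHS](integral_pushforward (@measurable_cons_rV R n)).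
by rewrite -(integral12_prod_meas1 ic).
Qed.

End cube_orthogonality.

Lemma integrable_bounded {d} {T : measurableType d} {R : realType} {mu : {measure set T -> \bar R}}
    {A : set T} {u : T -> R} (M : R) : measurable A -> (mu A < +oo)%E -> measurable_fun A u ->
  (forall x, A x -> `|u x| <= M) -> mu.-integrable A (fun x => (u x)%:E).
Proof.
move=> mA fA mu_ uM; apply: (measurable_bounded_integrable mA fA mu_).
exists M; split; first exact: num_real.
by move=> x Mx y Ay /=; exact: le_trans (uM _ Ay) (ltW Mx).
Qed.

Lemma lebesgue_cube_lty {R : realType} n : (lebesgue_rV n (@cube R n) < +oo)%E.
Proof. by rewrite lebesgue_cube ltry. Qed.

Lemma integrable_cube {R : realType} {n} {u : 'rV[R]_n -> R} (M : R) :
  measurable_fun cube u -> (forall x, cube x -> `|u x| <= M) ->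
  (lebesgue_rV n).-integrable cube (fun x => (u x)%:E).
Proof. by move=> mu_ uM; apply: (integrable_bounded M) => //; [exact: measurable_cube|exact: lebesgue_cube_lty]. Qed.

Lemma cintegrable_cube {R : realType} {n} {f : 'rV[R]_n -> R[i]} (M : R) :
  cmeasurable_fun cube f -> (forall x, cube x -> normc (f x) <= M) -> cintegrable cube f.
Proof.
move=> [mr mi] fM; apply/cintegrableP; first exact: measurable_cube.
by split; apply: (integrable_cube M) => // x /fM; apply: le_trans;
  [exact: normr_Re_le|exact: normr_Im_le].
Qed.

Lemma cintegrable_cube_char {R : realType} {n} (nu : 'rV[int]_n) :
  cintegrable (@cube R n) (expN2pii (int_vec nu)).
Proof.
apply: (cintegrable_cube 1); first exact: cmeasurable_expN2pii.
by move=> x _; rewrite normc_expN2pii.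
Qed.

Lemma Re_cintegral {R : realType} {n} A (f : 'rV[R]_n -> R[i]) :
  Re (cintegral A f) = \int[lebesgue_rV n]_(x in A) Re (f x).
Proof. by []. Qed.

Lemma Im_cintegral {R : realType} {n} A (f : 'rV[R]_n -> R[i]) :
  Im (cintegral A f) = \int[lebesgue_rV n]_(x in A) Im (f x).
Proof. by []. Qed.

Lemma cintegral_cube_cst {R : realType} {n} (c : R[i]) : cintegral (@cube R n) (fun=> c) = c.
Proof.
have c1 : fine (lebesgue_rV n (@cube R n)) = 1 by rewrite lebesgue_cube.
by apply: complex_eqP => /=; rewrite (Rintegral_cst _ measurable_cube) -[RHS]mulr1; congr (_ * _); exact: c1.
Qed.

Lemma cintegral_cube_char {R : realType} {n} (nu : 'rV[int]_n) :
  cintegral (@cube R n) (expN2pii (int_vec nu)) = (nu == 0)%:R.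
Proof.
elim: n nu => [|n IH] nu.
  rewrite (thinmx0 nu) eqxx; have -> : @int_vec R 0 0 = 0 by exact: int_vec0.
  rewrite (@eq_cintegral _ _ _ _ (fun=> 1)) => [|x _]; last exact: expN2pii0l.
  exact: cintegral_cube_cst.
set nu' : 'rV[int]_n := \row_i nu ord0 (lift ord0 i).
have nuE : (nu == 0) = (nu ord0 ord0 == 0) && (nu' == 0).
  apply/eqP/andP => [nu0|[/eqP h0 /eqP h]].
    by rewrite nu0 mxE; split => //; apply/eqP/rowP => i; rewrite !mxE nu0 mxE.
  apply/rowP => i; rewrite mxE; case: (unliftP ord0 i) => [j|] -> //.
  by have /rowP/(_ j) := h; rewrite !mxE.
pose e' := @expN2pii R n (int_vec nu').
pose e1 (t : R) := 2 * pi * (nu ord0 ord0)%:~R * t.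
have [Ir Ii] := (cintegrableP _ e' measurable_cube).1 (cintegrable_cube_char nu').
have [Jr Ji] := (cintegrableP _ _ (@measurable_cube R n.+1)).1 (cintegrable_cube_char nu).
have Er : \int[lebesgue_rV n]_(v in cube) Re (e' v) = (nu' == 0)%:R.
  by have := congr1 Re (IH nu'); rewrite /= => ->; case: eqP.
have Ei : \int[lebesgue_rV n]_(v in cube) Im (e' v) = 0.
  by have := congr1 Im (IH nu'); rewrite /= => ->; case: eqP.
(* Both parts of a character have the form a(t) Re e' + b(t) Im e' with e' a character in the
   remaining coordinates. By induction Im e' integrates to 0 and Re e' to 1 or 0, so only the factor
   a survives. *)
have step (a b : R -> R) (u : 'rV[R]_n.+1 -> R) :
    (lebesgue_rV n.+1).-integrable cube (EFin \o u) ->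
    (forall t v, u (cons_rV (t, v)) = a t * Re (e' v) + b t * Im (e' v)) ->
    \int[lebesgue_rV n.+1]_(x in cube) u x =
    \int[lebesgue_measure]_(t in `[- 2^-1, 2^-1[) (a t * (nu' == 0)%:R).
  move=> iu uE; rewrite Rintegral_mkcond [RHS]Rintegral_mkcond; congr fine.
  rewrite integral_rVS; last first.
    by move: iu => /(integrable_mkcond _ measurable_cube); rewrite restrict_EFin.
  apply: eq_integral => t _.
  have IZr k : (lebesgue_rV n).-integrable cube (EFin \o (fun x => k * Re (e' x))).
    by apply: (integrable_eq measurable_cube (integrableZl measurable_cube k Ir)) => x _ /=; rewrite EFinM.
  have IZi k : (lebesgue_rV n).-integrable cube (EFin \o (fun x => k * Im (e' x))).
    by apply: (integrable_eq measurable_cube (integrableZl measurable_cube k Ii)) => x _ /=; rewrite EFinM.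
  transitivity (\int[lebesgue_rV n]_(v in cube)
      ((if t \in `[- 2^-1, 2^-1[ then a t else 0) * Re (e' v) +
       (if t \in `[- 2^-1, 2^-1[ then b t else 0) * Im (e' v))%:E)%E.
    rewrite [RHS]integral_mkcond; apply: eq_integral => v _.
    rewrite !patchE; case: ifPn => [/set_mem /cube_cons_rV [/= tI vc]|].
      by rewrite tI mem_set// uE.
    move=> /negP tv; case: ifPn => // /set_mem vc; case: ifPn => tI; last by rewrite !mul0r addr0.
    by exfalso; apply: tv; apply/mem_set/cube_cons_rV.
  rewrite -[LHS]fineK; last first.
    apply: integrable_fin_num; first exact: measurable_cube.
    by apply: (integrable_eq measurable_cube (integrableD measurable_cube (IZr _) (IZi _))).
  congr EFin; rewrite -/(Rintegral _ _ _) RintegralD//; last exact: measurable_cube.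
  rewrite RintegralZl//; last exact: measurable_cube.
  rewrite RintegralZl//; last exact: measurable_cube.
  rewrite Er Ei mulr0 addr0 patchE mem_setE; case: ifP => _ //.
  by rewrite mul0r.
apply: complex_eqP.
  rewrite Re_cintegral (step (fun t => cos (e1 t)) (fun t => sin (e1 t)))//; last first.
    move=> t v; rewrite expN2pii_cons_rV Re_mul /= /e' /e1 mulNr opprK mxE.
    by congr (_ * cos _ + _ * - sin _); congr (_ * _); apply: eq_bigr => i _; rewrite !mxE.
  rewrite nuE; have [_|_] := eqVneq nu' 0; rewrite ?andbT ?andbF/=; last first.
    by under eq_Rintegral do rewrite mulr0; rewrite /Rintegral integral0.
  under eq_Rintegral do rewrite mulr1.
  rewrite /e1; have [->|k0] := eqVneq (nu ord0 ord0) 0; last exact: integral_cos_int.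
  under eq_Rintegral do rewrite mulr0 mul0r cos0.
  rewrite Rintegral_cst//= lebesgue_measure_itv/= lte_fin ifT; last by lra.
  by rewrite mul1r -EFinD/=; lra.
rewrite Im_cintegral (step (fun t => - sin (e1 t)) (fun t => cos (e1 t)))//; last first.
  move=> t v; rewrite expN2pii_cons_rV Im_mul /= /e' /e1 mxE addrC.
  by congr (_ * cos _ + _ * - sin _); congr (_ * _); apply: eq_bigr => i _; rewrite !mxE.
rewrite nuE; have [_|_] := eqVneq nu' 0; rewrite ?andbT ?andbF/=; last first.
  by under eq_Rintegral do rewrite mulr0; rewrite /Rintegral integral0.
have -> : Im (nu ord0 ord0 == 0)%:R = 0 :> R by case: eqP.
rewrite -(integral_sin_int (- nu ord0 ord0)); apply: eq_Rintegral => t _.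
by rewrite /e1 mulr1 -sinN intrN mulrN mulNr.
Qed.

Section trig_poly.
Context {R : realType} {n : nat}.
Implicit Types (l : seq (R[i] * 'rV[int]_n)) (x y : 'rV[R]_n) (f g : 'rV[R]_n -> R[i]).

(** Frequencies may occur several times in the list. Sums are then concatenations and products are
    lists of pairwise products; equal frequencies are merged only where orthogonality is used, by
    [trig_poly_uniq]. *)
Definition trig_poly l x : R[i] := \sum_(q <- l) q.1 * expN2pii (int_vec q.2) x.

Lemma trig_poly_cat l1 l2 x : trig_poly (l1 ++ l2) x = trig_poly l1 x + trig_poly l2 x.
Proof. exact: big_cat. Qed.

Lemma trig_poly1 c nu x : trig_poly [:: (c, nu)] x = c * expN2pii (int_vec nu) x.
Proof. by rewrite /trig_poly big_seq1. Qed.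

Definition trig_scale (c : R[i]) l := [seq (c * q.1, q.2) | q <- l].

Lemma trig_poly_scale c l x : trig_poly (trig_scale c l) x = c * trig_poly l x.
Proof. by rewrite /trig_poly big_map mulr_sumr; apply: eq_bigr => q _ /=; rewrite mulrA. Qed.

Definition trig_mul l1 l2 := [seq (p.1 * q.1, p.2 + q.2) | p <- l1, q <- l2].

Lemma trig_poly_mul l1 l2 x : trig_poly (trig_mul l1 l2) x = trig_poly l1 x * trig_poly l2 x.
Proof.
rewrite /trig_poly /trig_mul big_allpairs_dep mulr_suml /=; apply: eq_bigr => p _.
rewrite mulr_sumr; apply: eq_bigr => q _ /=.
by rewrite int_vecD expN2piiDl mulrACA.
Qed.

Definition trig_conj l := [seq (conjc q.1, - q.2) | q <- l].

Lemma trig_poly_conj l x : trig_poly (trig_conj l) x = conjc (trig_poly l x).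
Proof.
rewrite /trig_poly big_map (big_morph _ (@rmorphD _ _ (@conjc R)) (@rmorph0 _ _ (@conjc R))).
by apply: eq_bigr => q _ /=; rewrite rmorphM int_vecN expN2piiNl.
Qed.

Lemma cmeasurable_trig_poly A l : cmeasurable_fun A (trig_poly l).
Proof.
apply: cmeasurable_sum => q; apply: cmeasurableM; first exact: cmeasurable_cst.
exact: cmeasurable_expN2pii.
Qed.

Lemma trig_poly_bounded l : exists M : R, forall x, normc (trig_poly l x) <= M.
Proof.
elim: l => [|q l [M hM]].
  by exists 0 => x; rewrite /trig_poly big_nil Normc.normc0.
exists (normc q.1 + M) => x; rewrite /trig_poly big_cons.
apply: le_trans (_ : normc (q.1 * expN2pii (int_vec q.2) x) + normc (trig_poly l x) <= _).
  by have := ler_normD (q.1 * expN2pii (int_vec q.2) x) (trig_poly l x); rewrite lecE => /andP[].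
by rewrite Normc.normcM normc_expN2pii mulr1 lerD2l.
Qed.

Lemma cintegrable_mul_trig_poly f l : cintegrable cube f ->
  cintegrable cube (fun x => f x * trig_poly l x).
Proof.
move=> fi; have [M hM] := trig_poly_bounded l.
apply: (@cintegrableMb _ _ _ _ _ M) => //; first exact: measurable_cube.
exact: cmeasurable_trig_poly.
Qed.

Lemma cintegrable_mul_char f nu : cintegrable cube f ->
  cintegrable cube (fun x => f x * expN2pii (int_vec nu) x).
Proof.
move=> fi; apply: (@cintegrableMb _ _ _ _ _ 1) => //; first exact: measurable_cube.
  exact: cmeasurable_expN2pii.
by move=> x _; rewrite normc_expN2pii.
Qed.

(** Since the polynomials are written with the characters e^{-2 pi i nu x} that define the
    coefficients, the pairing is bilinear and involves no conjugate. Conjugates appear instead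
    wherever a function is approximated by a polynomial. *)
Lemma cintegral_mul_trig_poly f l : cintegrable cube f ->
  cintegral cube (fun x => f x * trig_poly l x) = \sum_(q <- l) q.1 * fourier_coef f q.2.
Proof.
move=> fi.
rewrite (@eq_cintegral _ _ _ _ (fun x => \sum_(q <- l) q.1 * (f x * expN2pii (int_vec q.2) x))); last first.
  by move=> x _; rewrite mulr_sumr; apply: eq_bigr => q _; rewrite mulrCA.
rewrite cintegral_sum; [|exact: measurable_cube|move=> q; apply: cintegrableZ; first exact: measurable_cube].
  by apply: eq_bigr => q _; rewrite cintegralZ//; [exact: measurable_cube|exact: cintegrable_mul_char].
exact: cintegrable_mul_char.
Qed.

Definition trig_nonneg l := all (fun q : R[i] * 'rV[int]_n => 0 <= q.1) l.

Lemma trig_nonneg_mul l1 l2 : trig_nonneg l1 -> trig_nonneg l2 -> trig_nonneg (trig_mul l1 l2).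
Proof.
move=> /allP h1 /allP h2; apply/allP => _ /allpairsP[[p q] /= [/h1 p0 /h2 q0 ->]].
exact: mulr_ge0.
Qed.

Lemma trig_poly_uniq l : exists (s : seq 'rV[int]_n) (c : 'rV[int]_n -> R[i]),
  uniq s /\ forall x, trig_poly l x = \sum_(nu <- s) c nu * expN2pii (int_vec nu) x.
Proof.
exists (undup [seq q.2 | q <- l]), (fun nu => \sum_(q <- l | q.2 == nu) q.1).
split=> [|x]; first exact: undup_uniq.
under eq_bigr do rewrite mulr_suml.
rewrite /trig_poly (exchange_big_dep xpredT)//=.
rewrite big_seq [RHS]big_seq; apply: eq_bigr => q ql.
under eq_bigl do rewrite eq_sym.
by rewrite -big_filter filter_pred1_uniq ?undup_uniq ?mem_undup ?map_f// big_seq1.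
Qed.

End trig_poly.

Lemma ge0_integral_le_comb {d} {T : measurableType d} {R : realType} {mu : {measure set T -> \bar R}}
    {A : set T} (u u1 u2 : T -> R) (a b : R) : measurable A -> 0 <= a -> 0 <= b ->
  measurable_fun A u -> measurable_fun A u1 -> measurable_fun A u2 ->
  (forall x, A x -> 0 <= u x) -> (forall x, A x -> 0 <= u1 x) -> (forall x, A x -> 0 <= u2 x) ->
  (forall x, A x -> u x <= a * u1 x + b * u2 x) ->
  (\int[mu]_(x in A) (u x)%:E <=
   a%:E * \int[mu]_(x in A) (u1 x)%:E + b%:E * \int[mu]_(x in A) (u2 x)%:E)%E.
Proof.
move=> mA a0 b0 mu_ mu1 mu2 u0 u10 u20 uu.
have ? : measurable_fun A (EFin \o u1) by apply/measurable_EFinP.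
have ? : measurable_fun A (EFin \o u2) by apply/measurable_EFinP.
rewrite -(ge0_integralZl_EFin mu mA (f1 := EFin \o u1))//.
rewrite -(ge0_integralZl_EFin mu mA (f1 := EFin \o u2))//.
rewrite -ge0_integralD//; last 4 first.
- by move=> x Ax /=; rewrite -EFinM lee_fin mulr_ge0// u10.
- exact: measurable_funeM.
- by move=> x Ax /=; rewrite -EFinM lee_fin mulr_ge0// u20.
- exact: measurable_funeM.
apply: ge0_le_integral => //.
- exact/measurable_EFinP.
- by apply: emeasurable_funD; exact: measurable_funeM.
Qed.

(** * Density of trigonometric polynomials *)

Section trig_density.
Context {R : realType} {n : nat}.
Variable w : 'rV[R]_n -> R.
Hypothesis w_ge0 : forall x, cube x -> 0 <= w x.
Hypothesis w_int : (lebesgue_rV n).-integrable cube (EFin \o w).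
Local Notation mu := (lebesgue_rV n).
Local Notation mcube := (@measurable_cube R n).

(** The squared distance in L^2 of the weight [w], which will be 1 + |f|. As [w] is integrable on
    the cube, every bounded measurable function has finite distance to every polynomial. *)
Definition wdist2 (phi psi : 'rV[R]_n -> R) : \bar R :=
  (\int[mu]_(x in cube) ((phi x - psi x) ^+ 2 * w x)%:E)%E.

(** Boundedness is part of the notion because closure under products depends on it. The
    approximating polynomials are required to be real valued so that the real part of a product is
    the product of the real parts. *)
Definition trig_approx (psi : 'rV[R]_n -> R) := [/\ measurable_fun cube psi,
  exists C : R, forall x, cube x -> `|psi x| <= C &
  forall e : R, 0 < e -> exists2 l, (forall x, Im (trig_poly l x) = 0) &
    (wdist2 psi (fun x => Re (trig_poly l x)) <= e%:E)%E].

Lemma measurable_weight : measurable_fun cube w.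
Proof. by apply/measurable_EFinP; exact: measurable_int w_int. Qed.

Lemma measurable_wdist2 (phi psi : 'rV[R]_n -> R) : measurable_fun cube phi -> measurable_fun cube psi ->
  measurable_fun cube (fun x => (phi x - psi x) ^+ 2 * w x).
Proof.
move=> mphi mpsi; apply: measurable_funM; last exact: measurable_weight.
by apply: measurable_funX; exact: measurable_funB.
Qed.

Lemma measurable_Re_trig_poly l : measurable_fun cube (fun x : 'rV[R]_n => Re (trig_poly l x)).
Proof. exact: (cmeasurable_trig_poly _ l).1. Qed.

Lemma wdist2_le_comb (p1 p2 q1 q2 q3 q4 : 'rV[R]_n -> R) (a b : R) : 0 <= a -> 0 <= b ->
  measurable_fun cube p1 -> measurable_fun cube p2 -> measurable_fun cube q1 ->
  measurable_fun cube q2 -> measurable_fun cube q3 -> measurable_fun cube q4 ->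
  (forall x, cube x -> (p1 x - p2 x) ^+ 2 <= a * (q1 x - q2 x) ^+ 2 + b * (q3 x - q4 x) ^+ 2) ->
  (wdist2 p1 p2 <= a%:E * wdist2 q1 q2 + b%:E * wdist2 q3 q4)%E.
Proof.
move=> a0 b0 mp1 mp2 mq1 mq2 mq3 mq4 h.
apply: ge0_integral_le_comb => //; first exact: measurable_cube; try exact: measurable_wdist2;
  try by move=> x cx; rewrite mulr_ge0 ?sqr_ge0 ?w_ge0.
move=> x cx; apply: le_trans (ler_wpM2r (w_ge0 _ cx) (h x cx)) _.
by rewrite le_eqVlt; apply/orP; left; apply/eqP; ring.
Qed.

Lemma trig_approx_eq phi psi : (forall x, cube x -> phi x = psi x) ->
  trig_approx phi -> trig_approx psi.
Proof.
move=> eq_ [mphi [C hC] h]; split.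
- by apply: eq_measurable_fun mphi => x /set_mem /eq_ ->.
- by exists C => x cx; rewrite -eq_//; exact: hC.
- move=> e /h [l l0 le]; exists l => //; apply: le_trans le; rewrite le_eqVlt.
  by apply/orP; left; apply/eqP; apply: eq_integral => x /set_mem cx; rewrite eq_.
Qed.

Lemma trig_approx_trig l : (forall x, Im (trig_poly l x) = 0) ->
  trig_approx (fun x => Re (trig_poly l x)).
Proof.
move=> l0; split; first exact: measurable_Re_trig_poly.
- have [M hM] := trig_poly_bounded (R := R) l; exists M => x _.
  exact: le_trans (normr_Re_le _) (hM x).
- move=> e e0; exists l => //; rewrite /wdist2.
  by under eq_integral do rewrite subrr expr0n mul0r; rewrite integral0 lee_fin ltW.
Qed.

Lemma trig_approxD phi psi : trig_approx phi -> trig_approx psi ->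
  trig_approx (fun x => phi x + psi x).
Proof.
move=> [m1 [C1 h1] a1] [m2 [C2 h2] a2]; split.
- exact: measurable_funD.
- exists (C1 + C2) => x cx; apply: le_trans (ler_normD _ _) _.
  by rewrite lerD ?h1 ?h2.
- move=> e e0; have e40 : 0 < e / 4 by rewrite divr_gt0.
  have [l1 l10 d1] := a1 _ e40; have [l2 l20 d2] := a2 _ e40.
  exists (l1 ++ l2) => [x|]; first by rewrite trig_poly_cat Im_add l10 l20 addr0.
  apply: le_trans (@wdist2_le_comb _ _ phi (fun x => Re (trig_poly l1 x)) psi
    (fun x => Re (trig_poly l2 x)) 2 2 _ _ _ _ _ _ _ _ _) _ => //;
    try exact: measurable_Re_trig_poly; first exact: measurable_funD.
  + move=> x _; rewrite trig_poly_cat Re_add.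
    set a := phi x; set b := psi x; set c := Re _; set d := Re _.
    rewrite -subr_ge0 (_ : _ - _ = ((a - c) - (b - d)) ^+ 2); last by ring.
    exact: sqr_ge0.
  + apply: le_trans (_ : 2%:E * (e / 4)%:E + 2%:E * (e / 4)%:E <= _)%E.
      by apply: leeD; apply: lee_wpmul2l.
    by rewrite -!EFinM -EFinD lee_fin; lra.
Qed.

(** From ab - cd = (a - c) b + c (b - d). The factor b is bounded by [C2], whereas c is the
    approximating polynomial, on which [C1] gives no control: the second polynomial is therefore
    chosen after the first, with a tolerance depending on the supremum [M] of the first. *)
Lemma trig_approxM phi psi : trig_approx phi -> trig_approx psi ->
  trig_approx (fun x => phi x * psi x).
Proof.
move=> [m1 [C1 h1] a1] [m2 [C2 h2] a2]; split.
- exact: measurable_funM.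
- exists (`|C1| * `|C2|) => x cx; rewrite normrM ler_pM//.
    exact: le_trans (h1 _ cx) (ler_norm _).
  exact: le_trans (h2 _ cx) (ler_norm _).
- move=> e e0.
  pose K2 := 2 * (C2 ^+ 2 + 1).
  have K20 : 0 < K2 by rewrite mulr_gt0// ltr_wpDl// sqr_ge0.
  have [l1 l10 d1] := a1 (e / 2 / K2) ltac:(by rewrite !divr_gt0).
  have [M hM] := trig_poly_bounded (R := R) l1.
  pose K1 := 2 * (M ^+ 2 + 1).
  have K10 : 0 < K1 by rewrite mulr_gt0// ltr_wpDl// sqr_ge0.
  have [l2 l20 d2] := a2 (e / 2 / K1) ltac:(by rewrite !divr_gt0).
  exists (trig_mul l1 l2) => [x|]; first by rewrite trig_poly_mul Im_mul l10 l20 mulr0 mul0r addr0.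
  apply: le_trans (@wdist2_le_comb _ _ phi (fun x => Re (trig_poly l1 x)) psi
    (fun x => Re (trig_poly l2 x)) K2 K1 _ _ _ _ _ _ _ _ _) _ => //;
    try exact: measurable_Re_trig_poly; try exact: ltW; first exact: measurable_funM.
  + move=> x cx; rewrite trig_poly_mul Re_mul l10 mul0r subr0.
    have hb : psi x ^+ 2 <= C2 ^+ 2.
      rewrite -[leLHS]real_normK ?num_real// ler_pXn2r// ?nnegrE// ?h2//.
      by apply: le_trans (h2 _ cx).
    have hc : Re (trig_poly l1 x) ^+ 2 <= M ^+ 2.
      have := le_trans (normr_Re_le _) (hM x) => hMx.
      rewrite -[leLHS]real_normK ?num_real// ler_pXn2r// ?nnegrE//.
      by apply: le_trans hMx.
    move: hb hc; rewrite /K1 /K2.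
    set a := phi x; set b := psi x; set c := Re _; set d := Re _ => hb hc.
    apply: (@le_trans _ _ (2 * b ^+ 2 * (a - c) ^+ 2 + 2 * c ^+ 2 * (b - d) ^+ 2)).
      rewrite -subr_ge0 (_ : _ - _ = ((a - c) * b - c * (b - d)) ^+ 2); last by ring.
      exact: sqr_ge0.
    by apply: lerD; apply: ler_wpM2r; rewrite ?sqr_ge0// ler_pM2l//; lra.
  + apply: le_trans (_ : K2%:E * (e / 2 / K2)%:E + K1%:E * (e / 2 / K1)%:E <= _)%E.
      by apply: leeD; apply: lee_wpmul2l => //; rewrite lee_fin ltW.
    rewrite -!EFinM -EFinD lee_fin.
    rewrite (mulrC K2) (mulrC K1) !divfK ?gt_eqF//; lra.
Qed.

Lemma trig_approx_cst (c : R) : trig_approx (fun=> c).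
Proof.
have E (x : 'rV[R]_n) : trig_poly [:: (Complex c 0, 0)] x = Complex c 0 :> R[i].
  by rewrite trig_poly1 int_vec0 expN2pii0l mulr1.
have := @trig_approx_trig [:: (Complex c 0, 0)] (fun x => congr1 Im (E x)).
by apply: trig_approx_eq => x _; rewrite E.
Qed.

(** Dominated convergence with the majorant (2 C)^2 w turns bounded pointwise convergence into
    convergence for [wdist2]; a polynomial close to a late term of the sequence is then close to the
    limit. *)
Lemma trig_approx_lim (phi : ('rV[R]_n -> R)^nat) (psi : 'rV[R]_n -> R) (C : R) :
  (forall k, trig_approx (phi k)) -> (forall k x, cube x -> `|phi k x| <= C) ->
  (forall x, cube x -> phi ^~ x @ \oo --> psi x) -> trig_approx psi.
Proof.
move=> aphi bphi cphi.
have mphi k : measurable_fun cube (phi k) by have [] := aphi k.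
have mpsi : measurable_fun cube psi.
  exact: (measurable_fun_cvg mphi).
have bpsi x : cube x -> `|psi x| <= C.
  move=> cx; have cn : (fun k => `|phi k x|) @ \oo --> `|psi x| by apply: cvg_norm; exact: cphi.
  rewrite -(cvg_lim _ cn)//; apply: limr_le; first by apply/cvg_ex; exists `|psi x|.
  by near=> k; exact: bphi.
split => //; first by exists C.
move=> e e0.
have cv : (\int[mu]_(x in cube) ((psi x - phi k x) ^+ 2 * w x)%:E)%E @[k --> \oo] -->
    (\int[mu]_(x in cube) (cst 0 x))%E.
  apply: (@dominated_cvg _ _ _ _ _ mcube _ _ (fun x => ((2 * C) ^+ 2 * w x)%:E)) => //.
  - by move=> k; apply/measurable_EFinP; exact: measurable_wdist2.
  - move=> x cx; apply: cvg_EFin; first by near=> k.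
    rewrite -(mul0r (w x)); apply: cvgM; last exact: cvg_cst.
    rewrite (_ : 0 = (psi x - psi x) * (psi x - psi x)); last by rewrite subrr mul0r.
    by under eq_cvg do rewrite expr2; apply: cvgM; apply: cvgB => //; (exact: cvg_cst || exact: cphi).
  - by apply: (integrable_eq mcube (integrableZl mcube ((2 * C) ^+ 2) w_int)) => x _ /=; rewrite EFinM.
  - move=> k x cx; rewrite lee_fin normrM (ger0_norm (w_ge0 _ cx)) ler_wpM2r ?w_ge0//.
    rewrite ger0_norm ?sqr_ge0// -real_normK ?num_real// ler_pXn2r ?nnegrE//.
      by rewrite (le_trans (ler_normB _ _))// mulr_natl mulr2n lerD ?bphi ?bpsi.
    by rewrite mulr_ge0// (le_trans _ (bpsi _ cx)).
rewrite integral0 in cv.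
have [N _ HN] : \forall k \near \oo, (wdist2 psi (phi k) < (e / 4)%:E)%E.
  apply: (cv [set y | (y < (e / 4)%:E)%E]); apply: open_ereal_lt'.
  by rewrite lte_fin divr_gt0.
have [_ _ aN] := aphi N.
have [l l0 dl] := aN (e / 4) ltac:(by rewrite divr_gt0).
exists l => //.
apply: le_trans (@wdist2_le_comb _ _ psi (phi N) (phi N)
    (fun x => Re (trig_poly l x)) 2 2 _ _ _ _ _ _ _ _ _) _ => //;
    try exact: measurable_Re_trig_poly.
- move=> x _; set a := psi x; set b := phi N x; set c := Re _.
  rewrite -subr_ge0 (_ : _ - _ = ((a - b) - (b - c)) ^+ 2); last by ring.
  exact: sqr_ge0.
- apply: le_trans (_ : 2%:E * (e / 4)%:E + 2%:E * (e / 4)%:E <= _)%E.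
    by apply: leeD; apply: lee_wpmul2l => //; exact: ltW (HN N (leqnn N)).
  by rewrite -!EFinM -EFinD lee_fin; lra.
Unshelve. all: end_near. Qed.

Arguments trig_approxD {phi psi}.
Arguments trig_approxM {phi psi}.
Arguments trig_approx_eq {phi psi}.

(* Its iterates converge to the sign function on [-1, 1], while being polynomial keeps
   them approximable. *)
Definition sign_step (s : R) : R := 2^-1 * (3 * s - s ^+ 3).

Lemma sign_step_bound (s : R) : `|s| <= 1 -> `|sign_step s| <= 1.
Proof.
rewrite !ler_norml /sign_step => /andP[s1 s2]; apply/andP; split.
  rewrite -subr_ge0 (_ : _ - _ = 2^-1 * ((1 + s) ^+ 2 * (2 - s))); last by field.
  by rewrite !mulr_ge0// ?sqr_ge0//; lra.
rewrite -subr_ge0 (_ : _ - _ = 2^-1 * ((1 - s) ^+ 2 * (2 + s))); last by field.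
by rewrite !mulr_ge0// ?sqr_ge0//; lra.
Qed.

(** Since 1 - [sign_step] s = (1 - s) (1 - s) (1 + s/2) and the iterates never fall below a, the
    distance to 1 shrinks at each step by the factor (1 - s) (1 + s/2), which is at most 1 - a/2. *)
Lemma sign_step_pos (a : R) : 0 < a <= 1 -> iter k sign_step a @[k --> \oo] --> (1 : R).
Proof.
move=> /andP[a0 a1].
have H k : a <= iter k sign_step a <= 1 /\ 1 - iter k sign_step a <= (1 - a / 2) ^+ k.
  elim: k => [|k [/andP[ak k1] IH]]; first by rewrite /= lexx a1 expr0; split=> //; lra.
  rewrite iterS; set s := iter k sign_step a in ak k1 IH *.
  have E : 1 - sign_step s = (1 - s) * ((1 - s) * (1 + s / 2)) by rewrite /sign_step; field.
  have s1 : 0 <= 1 - s by lra.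
  have s0 : 0 <= s by lra.
  have B : (1 - s) * (1 + s / 2) <= 1 - a / 2.
    rewrite (_ : _ * _ = 1 - s / 2 - s ^+ 2 / 2); last by field.
    by have := sqr_ge0 s; lra.
  split.
    have := @sign_step_bound s; rewrite !ler_norml => /(_ ltac:(lra)) /andP[_ ->]; rewrite andbT.
    apply: le_trans ak _; rewrite -subr_ge0 (_ : _ - _ = 2^-1 * (s * ((1 - s) * (1 + s)))); last first.
      by rewrite /sign_step; field.
    by rewrite !mulr_ge0//; lra.
  by rewrite E exprSr; apply: ler_pM => //; rewrite mulr_ge0//; lra.
apply/cvgrPdist_le => e e0.
have : (1 - a / 2) ^+ k @[k --> \oo] --> (0 : R).
  by apply: cvg_expr; rewrite ger0_norm; lra.
move=> /cvgrPdist_le /(_ e e0); apply: filterS => k.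
have [/andP[_ h1] h2] := H k.
rewrite sub0r normrN ger0_norm; last by rewrite exprn_ge0//; lra.
by rewrite ger0_norm ?subr_ge0//; exact: le_trans.
Qed.

Lemma sign_stepN (a : R) : sign_step (- a) = - sign_step a.
Proof. by rewrite /sign_step; ring. Qed.

Lemma iter_sign_stepN k (a : R) : iter k sign_step (- a) = - iter k sign_step a.
Proof. by elim: k => // k IH; rewrite !iterS IH sign_stepN. Qed.

Lemma trig_approx_pos (c : 'rV[R]_n -> R) : trig_approx c -> (forall x, cube x -> `|c x| <= 1) ->
  trig_approx (fun x => if 0 < c x then 1 else 0).
Proof.
move=> ac c1.
pose s k x := iter k sign_step (c x).
have as_ k : trig_approx (s k).
  elim: k => [|k IH]; first exact: ac.
  have := trig_approxM (trig_approx_cst 2^-1) (trig_approxD (trig_approxM (trig_approx_cst 3) IH)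
    (trig_approxM (trig_approx_cst (-1)) (trig_approxM IH (trig_approxM IH IH)))).
  by apply: trig_approx_eq => x _; rewrite /s iterS /sign_step; ring.
have bs k x : cube x -> `|s k x| <= 1.
  by move=> cx; elim: k => [|k IH]; [exact: c1|exact: sign_step_bound].
(* The polynomial (s + s^2)/2 maps the possible limits 1, 0 and -1 of the iterates to 1, 0 and 0,
   and keeps [-1, 1] within [-1, 1]. *)
apply: (@trig_approx_lim (fun k x => 2^-1 * (s k x + s k x * s k x)) _ 1).
- by move=> k; apply: trig_approxM; [exact: trig_approx_cst|apply: trig_approxD => //; exact: trig_approxM].
- move=> k x cx; have := bs k x cx; rewrite !ler_norml => /andP[h1 h2].
  have := sqr_ge0 (s k x + 2^-1); have : s k x * s k x <= 1.
    by rewrite -expr2 -[leLHS]real_normK ?num_real// expr_le1// bs.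
  by move=> h3 h4; apply/andP; split; lra.
- move=> x cx.
  have lim_s (l : R) : s k x @[k --> \oo] --> l ->
      2^-1 * (s k x + s k x * s k x) @[k --> \oo] --> 2^-1 * (l + l * l).
    by move=> h; apply: cvgM; [exact: cvg_cst|apply: cvgD => //; exact: cvgM].
  have := c1 x cx; rewrite ler_norml => /andP[h1 h2].
  have [c0|c0] := ltP 0 (c x).
    have /lim_s := @sign_step_pos (c x) ltac:(by rewrite c0).
    by rewrite mulr1 (_ : 2^-1 * (1 + 1) = 1)//; field.
  move: c0; rewrite le_eqVlt => /orP[/eqP c0|c0].
    have -> : (fun k => 2^-1 * (s k x + s k x * s k x)) = (fun=> 0); last exact: cvg_cst.
    apply/funext => k; have -> : s k x = 0; last by ring.
    by rewrite /s c0; elim: k => // k IH; rewrite iterS IH /sign_step; ring.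
  have := @sign_step_pos (- c x) ltac:(lra).
  under eq_cvg do rewrite iter_sign_stepN.
  move=> /cvgN; under eq_cvg do rewrite opprK.
  by move=> /lim_s; rewrite (_ : 2^-1 * _ = 0)//; ring.
Qed.

Definition trig_set (A : set 'rV[R]_n) := trig_approx (\1_A : 'rV[R]_n -> R).

Lemma trig_setC A : trig_set A -> trig_set (~` A).
Proof.
move=> aA; have := trig_approxD (trig_approx_cst 1) (trig_approxM (trig_approx_cst (-1)) aA).
apply: trig_approx_eq => x _; rewrite !indicE in_setC.
by case: (x \in A) => /=; ring.
Qed.

Lemma trig_set0 : trig_set set0.
Proof. by apply: trig_approx_eq (trig_approx_cst 0) => x _; rewrite indicE in_set0. Qed.

Lemma trig_setI A B : trig_set A -> trig_set B -> trig_set (A `&` B).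
Proof.
move=> aA aB; apply: trig_approx_eq (trig_approxM aA aB) => x _.
by rewrite !indicE in_setI; case: (x \in A); rewrite ?mul1r ?mul0r.
Qed.

Lemma trig_set_bigcup (F : (set 'rV[R]_n)^nat) : (forall k, trig_set (F k)) ->
  trig_set (\bigcup_k F k).
Proof.
move=> aF.
pose G k := \big[setU/set0]_(i < k) F i.
have aG k : trig_set (G k).
  rewrite /G; elim: k => [|k IH]; first by rewrite big_ord0; exact: trig_set0.
  rewrite big_ord_recr/= -[_ `|` _]setCK setCU; apply: trig_setC.
  by apply: trig_setI; apply: trig_setC.
apply: (@trig_approx_lim (fun k => \1_(G k)) _ 1) => //.
  by move=> k x _; rewrite indicE ger0_norm//; case: (_ \in _).
move=> x _; have [[k _ Fkx]|nx] := pselect ((\bigcup_k F k) x).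
  apply: (@cvg_near_cst _ _ _ _ (nbhs \oo)); exists k.+1 => // m /= km.
  rewrite !indicE !mem_set//; first by exists k.
  by rewrite /G -bigcup_mkord; exists k.
rewrite (_ : (fun k => _) = fun=> 0).
  by rewrite indicE memNset//; exact: cvg_cst.
apply/funext => k; rewrite indicE memNset// /G -bigcup_mkord => -[i _ Fix].
by apply: nx; exists i.
Qed.

Lemma trig_approx_Re_char nu : trig_approx (fun x => Re (expN2pii (int_vec nu) x)).
Proof.
pose l := [:: (Complex (2^-1 : R) 0, nu); (Complex (2^-1 : R) 0, - nu)].
have E (x : 'rV[R]_n) : trig_poly l x = Complex (Re (expN2pii (int_vec nu) x)) 0.
  rewrite /l /trig_poly big_cons big_seq1 /= int_vecN expN2piiNl.
  by apply: complex_eqP; rewrite ?Re_add ?Im_add ?Re_mul ?Im_mul ?Re_conjc ?Im_conjc /=; field.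
have := trig_approx_trig l (fun x => congr1 Im (E x)).
by apply: trig_approx_eq => x _; rewrite E.
Qed.

Lemma trig_approx_Im_char nu : trig_approx (fun x => Im (expN2pii (int_vec nu) x)).
Proof.
pose l := [:: (Complex 0 (- 2^-1 : R), nu); (Complex 0 (2^-1 : R), - nu)].
have E (x : 'rV[R]_n) : trig_poly l x = Complex (Im (expN2pii (int_vec nu) x)) 0.
  rewrite /l /trig_poly big_cons big_seq1 /= int_vecN expN2piiNl.
  by apply: complex_eqP; rewrite ?Re_add ?Im_add ?Re_mul ?Im_mul ?Re_conjc ?Im_conjc /=; field.
have := trig_approx_trig l (fun x => congr1 Im (E x)).
by apply: trig_approx_eq => x _; rewrite E.
Qed.

Lemma expN2pii_delta (i : 'I_n) (x : 'rV[R]_n) : expN2pii (int_vec (delta_mx ord0 i)) x =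
  Complex (cos (2 * pi * x ord0 i)) (- sin (2 * pi * x ord0 i)).
Proof.
rewrite /expN2pii (_ : \sum_(j < n) _ = x ord0 i)//.
rewrite (bigD1 i)//= !mxE !eqxx /= mul1r big1 ?addr0// => j ji.
by rewrite !mxE (negPf ji) andbF mul0r.
Qed.

(* On the cube [x_i > a] amounts to [cos (pi x_i) sin (pi (x_i - a)) > 0], and this
   product is a trigonometric polynomial of integral frequencies. *)
Lemma trig_set_coord_gt (i : 'I_n) (a : R) : trig_set [set x | a < x ord0 i].
Proof.
have [ah|ah] := ltP a 2^-1; last first.
  apply: trig_approx_eq trig_set0 => x cx; rewrite !indicE in_set0 memNset// => /= ax.
  by have := cx i; lra.
have [al|al] := ltP a (- 2^-1).
  apply: trig_approx_eq (trig_approx_cst 1) => x cx; rewrite !indicE mem_set//=.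
  by have := cx i; lra.
pose c (x : 'rV[R]_n) := cos (pi * x ord0 i) * sin (pi * x ord0 i - pi * a).
have cE x : c x = 2^-1 * (sin (2 * pi * x ord0 i) * cos (pi * a) -
    cos (2 * pi * x ord0 i) * sin (pi * a) - sin (pi * a)).
  rewrite /c sinB (_ : 2 * pi * _ = pi * x ord0 i + pi * x ord0 i); last by ring.
  rewrite sinD cosD; have := cos2Dsin2 (pi * x ord0 i).
  set u := cos (pi * _); set v := sin (pi * x _ _) => h.
  by have := congr1 (fun z => z * sin (pi * a)) h; rewrite mul1r => h'; lra.
have ac : trig_approx c.
  have := trig_approxM (trig_approx_cst 2^-1) (trig_approxD (trig_approxD
    (trig_approxM (trig_approx_cst (- cos (pi * a))) (trig_approx_Im_char (delta_mx ord0 i)))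
    (trig_approxM (trig_approx_cst (- sin (pi * a))) (trig_approx_Re_char (delta_mx ord0 i))))
    (trig_approx_cst (- sin (pi * a)))).
  by apply: trig_approx_eq => x _; rewrite expN2pii_delta cE /=; ring.
have c1 x : cube x -> `|c x| <= 1.
  move=> _; rewrite /c normrM -[1]mulr1; apply: ler_pM => //.
    by rewrite ler_norml cos_geN1 cos_le1.
  by rewrite ler_norml sin_geN1 sin_le1.
apply: trig_approx_eq (trig_approx_pos c ac c1) => x cx.
have {cx} /andP[x1 x2] := cx i; have pi0 := pi_gt0 R.
suff -> : (0 < c x) = (a < x ord0 i).
  by rewrite indicE; case: ifP => h; [rewrite mem_set|rewrite memNset//= h].
(* On the face x_i = -1/2 the cosine vanishes and the product is 0; this agrees with x_i > a being
   false there, because a is at least -1/2. *)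
move: x1; rewrite le_eqVlt => /orP[/eqP xE|x1].
  rewrite /c -xE (_ : pi * - 2^-1 = - (pi / 2)); last by ring.
  by rewrite cosN cos_pihalf mul0r ltxx; apply/esym/negbTE; rewrite -leNgt.
have cos0 : 0 < cos (pi * x ord0 i).
  apply: cos_gt0_pihalf; apply/andP; split.
    by rewrite -mulrN ltr_pM2l.
  by rewrite ltr_pM2l.
rewrite /c pmulr_rgt0// -mulrBr; set t := x ord0 i - a.
have [at_|at_] := ltP a (x ord0 i).
  apply: sin_gt0_pi; rewrite /t; apply/andP; split; first by rewrite mulr_gt0// subr_gt0.
  by rewrite gtr_pMr//; lra.
apply: negbTE; rewrite -leNgt -oppr_ge0 -sinN -mulrN.
apply: sin_ge0_pi; apply/andP; split; first by apply: mulr_ge0; [exact: ltW|rewrite /t; lra].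
by rewrite ger_pMr// /t; lra.
Qed.

Lemma trig_set_measurable (A : set 'rV[R]_n) : measurable A -> trig_set A.
Proof.
have S0 : sigma_algebra setT trig_set.
  split; first exact: trig_set0.
  - by move=> B aB; rewrite setTD; exact: trig_setC.
  - exact: trig_set_bigcup.
apply: smallest_sub => //.
have coordP (i : 'I_n) : preimage_set_system setT (fun x : 'rV[R]_n => x ord0 i) measurable `<=` trig_set.
  move=> _ [B mB <-]; rewrite setTI.
  suff H : @measurable _ R `<=` [set B | trig_set ((fun x : 'rV[R]_n => x ord0 i) @^-1` B)].
    exact: H.
  have -> : @measurable _ R = <<s @RGenOInfty.G R >> by exact: RGenOInfty.measurableE.
  apply: smallest_sub => [|_ [a ->]].
    split => /=.
    + by rewrite preimage_set0; exact: trig_set0.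
    + by move=> C aC; rewrite setTD preimage_setC; exact: trig_setC.
    + by move=> F aF; rewrite preimage_bigcup; exact: trig_set_bigcup.
  rewrite (_ : mkset _ _ = trig_set [set x | a < x ord0 i]); first exact: trig_set_coord_gt.
  by rewrite /=; congr trig_set; apply/seteqP; split => x /=; rewrite in_itv/= andbT.
move=> A'; rewrite -bigcup_seq => -[i _]; exact: coordP.
Qed.

Import HBNNSimple.
Lemma trig_approx_sum I (s : seq I) (F : I -> 'rV[R]_n -> R) : (forall i, trig_approx (F i)) ->
  trig_approx (fun x => \sum_(i <- s) F i x).
Proof.
move=> aF; elim: s => [|i s IH].
  by under eq_fun do rewrite big_nil; exact: trig_approx_cst.
by under eq_fun do rewrite big_cons; exact: trig_approxD.
Qed.

Lemma trig_approx_nnsfun (f : {nnsfun 'rV[R]_n >-> R}) : trig_approx f.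
Proof.
have E x : f x = \sum_(y <- finmap.enum_fset (fset_set (range f))) (y * \1_(f @^-1` [set y]) x).
  by rewrite fimfunE fsbig_finite.
apply: trig_approx_eq (fun x _ => esym (E x)) _.
apply: trig_approx_sum => y; apply: trig_approxM; first exact: trig_approx_cst.
exact: trig_set_measurable.
Qed.

Lemma trig_approx_nonneg (psi : 'rV[R]_n -> R) (C : R) : measurable_fun cube psi ->
  (forall x, cube x -> 0 <= psi x <= C) -> trig_approx psi.
Proof.
move=> mpsi bpsi.
have mp : measurable_fun cube (EFin \o psi) by apply/measurable_EFinP.
have p0 x : cube x -> (0 <= (EFin \o psi) x)%E by move=> /bpsi /andP[].
apply: (@trig_approx_lim (nnsfun_approx mcube mp) _ C) => [k|k x cx|x cx].
- exact: trig_approx_nnsfun.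
- rewrite ger0_norm// nnsfun_approxE -lee_fin.
  apply: le_trans (le_approx k p0 cx) _.
  by rewrite lee_fin; have /andP[] := bpsi x cx.
- by under eq_fun do rewrite nnsfun_approxE; exact: (cvg_approx p0 cx (ltry _)).
Qed.

Lemma trig_approx_measurable (psi : 'rV[R]_n -> R) (C : R) : measurable_fun cube psi ->
  (forall x, cube x -> `|psi x| <= C) -> trig_approx psi.
Proof.
move=> mpsi bpsi.
have := trig_approxD (@trig_approx_nonneg (fun x => psi x + C) (2 * C) _ _) (trig_approx_cst (- C)).
move=> /(_ _ _)/(@trig_approx_eq _ psi); apply.
- by move=> x _; ring.
- exact: measurable_funD.
- by move=> x /bpsi; rewrite ler_norml => /andP[h1 h2]; apply/andP; split; lra.
Qed.

(* The sets whose indicators are approximable form a sigma-algebra, which contains the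
   half-spaces. *)
Lemma trig_density (psi : 'rV[R]_n -> R[i]) (C e : R) : cmeasurable_fun cube psi ->
  (forall x, cube x -> normc (psi x) <= C) -> 0 < e -> exists l,
  (\int[mu]_(x in cube) (normc (psi x - trig_poly l x) ^+ 2 * w x)%:E <= e%:E)%E.
Proof.
move=> [mr mi] bpsi e0; have e20 : 0 < e / 2 by rewrite divr_gt0.
have [_ _ /(_ _ e20)[l1 l10 h1]] := trig_approx_measurable _ C mr
  (fun x cx => le_trans (normr_Re_le _) (bpsi x cx)).
have [_ _ /(_ _ e20)[l2 l20 h2]] := trig_approx_measurable _ C mi
  (fun x cx => le_trans (normr_Im_le _) (bpsi x cx)).
exists (l1 ++ trig_scale (Complex 0 1) l2).
have E x : normc (psi x - trig_poly (l1 ++ trig_scale (Complex 0 1) l2) x) ^+ 2 =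
    (Re (psi x) - Re (trig_poly l1 x)) ^+ 2 + (Im (psi x) - Re (trig_poly l2 x)) ^+ 2.
  rewrite normc_sqrE trig_poly_cat trig_poly_scale Re_add Im_add Re_opp Im_opp Re_add Im_add.
  by rewrite Re_mul Im_mul l10 l20 /=; ring.
apply: le_trans (_ : 1%:E * (e / 2)%:E + 1%:E * (e / 2)%:E <= _)%E; last first.
  by rewrite -!EFinM -EFinD lee_fin; lra.
apply: le_trans (leeD (lee_wpmul2l _ h1) (lee_wpmul2l _ h2)); rewrite ?lee_fin//.
have mw := measurable_weight.
apply: ge0_integral_le_comb => //; first exact: measurable_cube.
- apply: measurable_funM => //; under eq_fun do rewrite E.
  apply: measurable_funD; apply: measurable_funX; apply: measurable_funB => //;
    exact: measurable_Re_trig_poly.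
- by apply: measurable_wdist2 => //; exact: measurable_Re_trig_poly.
- by apply: measurable_wdist2 => //; exact: measurable_Re_trig_poly.
- by move=> x cx; rewrite mulr_ge0 ?sqr_ge0 ?w_ge0.
- by move=> x cx; rewrite mulr_ge0 ?sqr_ge0 ?w_ge0.
- by move=> x cx; rewrite mulr_ge0 ?sqr_ge0 ?w_ge0.
- by move=> x cx; rewrite E !mul1r mulrDl.
Qed.

End trig_density.

(** * Functions with nonnegative Fourier coefficients *)

Section positive_trig.
Context {R : realType} {n : nat}.
Implicit Types (u v : 'rV[R]_n -> R).

(** The signs are imposed on a representing list, so closure under sums and products is read off
    from concatenations and pairwise products of lists. *)
Definition pos_trig u := exists2 l, trig_nonneg l & forall x, trig_poly l x = Complex (u x) 0.

Lemma pos_trig_eq u v : u =1 v -> pos_trig u -> pos_trig v.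
Proof. by move=> uv [l l0 lE]; exists l => // x; rewrite lE uv. Qed.

Lemma pos_trig_cst (c : R) : 0 <= c -> pos_trig (fun=> c).
Proof.
move=> c0; exists [:: (Complex c 0, 0)]; first by rewrite /trig_nonneg /= lecE /= eqxx c0.
by move=> x; rewrite trig_poly1 int_vec0 expN2pii0l mulr1.
Qed.

Lemma pos_trigD u v : pos_trig u -> pos_trig v -> pos_trig (fun x => u x + v x).
Proof.
move=> [l1 l10 E1] [l2 l20 E2]; exists (l1 ++ l2); first by rewrite /trig_nonneg all_cat; apply/andP.
move=> x; rewrite trig_poly_cat E1 E2.
by apply: complex_eqP; rewrite ?Re_add ?Im_add //= addr0.
Qed.

Lemma pos_trigM u v : pos_trig u -> pos_trig v -> pos_trig (fun x => u x * v x).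
Proof.
move=> [l1 l10 E1] [l2 l20 E2]; exists (trig_mul l1 l2); first exact: trig_nonneg_mul.
move=> x; rewrite trig_poly_mul E1 E2.
by apply: complex_eqP; rewrite ?Re_mul ?Im_mul /=; ring.
Qed.

Lemma pos_trigX u k : pos_trig u -> pos_trig (fun x => u x ^+ k).
Proof.
move=> pu; elim: k => [|k IH].
  by apply: pos_trig_eq (pos_trig_cst 1 _) => // x; rewrite expr0.
by apply: pos_trig_eq (pos_trigM _ _ pu IH) => x; rewrite exprS.
Qed.

Lemma pos_trig_sum (I : Type) (s : seq I) (F : I -> 'rV[R]_n -> R) : (forall i, pos_trig (F i)) ->
  pos_trig (fun x => \sum_(i <- s) F i x).
Proof.
move=> pF; elim: s => [|i s IH].
  by apply: pos_trig_eq (pos_trig_cst 0 _) => // x; rewrite big_nil.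
by apply: pos_trig_eq (pos_trigD _ _ (pF i) IH) => x; rewrite big_cons.
Qed.

Lemma pos_trig_cos (i : 'I_n) : pos_trig (fun x => cos (2 * pi * x ord0 i)).
Proof.
exists [:: (Complex (2^-1 : R) 0, delta_mx ord0 i); (Complex (2^-1 : R) 0, - delta_mx ord0 i)].
  by rewrite /trig_nonneg /= !lecE /= eqxx invr_ge0 ler0n.
move=> x; rewrite /trig_poly big_cons big_seq1 /= int_vecN expN2piiNl expN2pii_delta.
by apply: complex_eqP; rewrite ?Re_add ?Im_add ?Re_mul ?Im_mul ?Re_conjc ?Im_conjc /=; field.
Qed.

End positive_trig.

(** * A summation kernel with nonnegative coefficients *)

Section kernel.
Context {R : realType} {n : nat}.
Implicit Types (x y z : 'rV[R]_n) (l : seq (R[i] * 'rV[int]_n)).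
Local Notation mu := (lebesgue_rV n).
Local Notation mcube := (@measurable_cube R n).

(** The mean of the n + 1 numbers 1 and (1 + cos (2 pi z_i))/2, all in [0, 1]. In this form the
    coefficients are visibly nonnegative, while [kernel_base1B] gives the form that measures the
    distance of z to the lattice. *)
Definition kernel_base z : R :=
  n.+1%:R^-1 * (1 + \sum_(i < n) 2^-1 * (1 + cos (2 * pi * z ord0 i))).
Local Notation q := kernel_base.

Lemma pos_trig_kernel k : pos_trig (fun z => q z ^+ k).
Proof.
apply: pos_trigX; apply: pos_trigM; first by apply: pos_trig_cst; rewrite invr_ge0.
apply: pos_trigD; first exact: pos_trig_cst.
apply: pos_trig_sum => i; apply: pos_trigM; first by apply: pos_trig_cst; rewrite invr_ge0.
by apply: pos_trigD; [exact: pos_trig_cst|exact: pos_trig_cos].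
Qed.

Lemma kernel_base1B z : 1 - q z = n.+1%:R^-1 * \sum_(i < n) 2^-1 * (1 - cos (2 * pi * z ord0 i)).
Proof.
apply: (mulfI (x := n.+1%:R)); first by rewrite pnatr_eq0.
rewrite mulrBr mulr1 /q !mulrA divff ?pnatr_eq0// !mul1r opprD addrA.
rewrite -natr1 addrK (_ : n%:R = \sum_(i < n) 1); last by rewrite sumr_const card_ord.
rewrite -sumrB.
by apply: eq_bigr => i _; field.
Qed.

Lemma kernel_base_ge0 z : 0 <= q z.
Proof.
apply: mulr_ge0 => //; apply: addr_ge0 => //; apply: sumr_ge0 => i _.
by apply: mulr_ge0 => //; have := cos_geN1 (2 * pi * z ord0 i); lra.
Qed.

Lemma kernel_base_le1 z : q z <= 1.
Proof.
rewrite -subr_ge0 kernel_base1B; apply: mulr_ge0 => //; apply: sumr_ge0 => i _.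
by apply: mulr_ge0 => //; have := cos_le1 (2 * pi * z ord0 i); lra.
Qed.

Lemma cos_2pi_int (t : R) (k : int) : cos (2 * pi * (t - k%:~R)) = cos (2 * pi * t).
Proof.
rewrite mulrBr cosB.
have -> : 2 * pi * k%:~R = pi * k%:~R + pi * k%:~R :> R by ring.
have := cos2Dsin2 (pi * k%:~R : R).
rewrite sinD cosD sin_pi_int !(mulr0, mul0r, addr0, subr0) expr0n /= addr0 -expr2 => ->.
by rewrite mulr1.
Qed.

(** All summands of 1 - q are nonnegative, so 1 - q < eta bounds each of them separately. After z_i
    is reduced to its distance from the nearest integer, the bound on the cosine becomes a bound on
    that distance, the cosine being decreasing on [0, pi]. *)
Lemma kernel_far (d : R) : 0 < d -> exists2 eta : R, 0 < eta < 1 &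
  forall z, 1 - eta < q z -> exists k, forall i, `|z ord0 i - int_vec k ord0 i| < d.
Proof.
move=> d0.
pose d' := Num.min d 4^-1.
have d'0 : 0 < d' by rewrite lt_min d0/=; lra.
have d'd : d' <= d by rewrite ge_min lexx.
have d'4 : d' <= 4^-1 by rewrite ge_min lexx orbT.
have pi0 := pi_gt0 R.
have in_pi (t : R) : 0 <= t <= 2^-1 -> 2 * pi * t \in `[0, pi].
  move=> /andP[t0 t1]; rewrite in_itv/=; apply/andP; split; nra.
have cd : cos (2 * pi * d') < 1.
  rewrite -[ltRHS]cos0 ltr_cos; first by rewrite !mulr_gt0.
    by rewrite in_itv/= lexx ltW.
  by apply: in_pi; lra.
have cd1 := cos_geN1 (2 * pi * d').
(* One factor 1/2 comes from the summands of 1 - q; the other is slack which, with cos >= -1 only,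
   already makes eta < 1. *)
pose eta := n.+1%:R^-1 * (2^-1 * 2^-1 * (1 - cos (2 * pi * d'))).
have eta0 : 0 < eta by rewrite !mulr_gt0 ?invr_gt0// subr_gt0.
exists eta.
  rewrite eta0 /=; apply: (@le_lt_trans _ _ (1 * (2^-1 * 2^-1 * (1 - cos (2 * pi * d'))))); last lra.
  by apply: ler_wpM2r; [lra|rewrite invf_le1 ?ler1n].
move=> z; rewrite ltrBlDr -ltrBlDl kernel_base1B /eta ltr_pM2l ?invr_gt0// => h.
exists (\row_i Num.floor (z ord0 i + 2^-1)) => i; rewrite !mxE.
set k := Num.floor _; apply: lt_le_trans d'd.
have [k1 k2] : k%:~R <= z ord0 i + 2^-1 /\ z ord0 i + 2^-1 < k%:~R + 1.
  by split; [exact: ge_floor|rewrite -intrD1 floorD1_gt].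
have hi : 2^-1 * (1 - cos (2 * pi * z ord0 i)) < 2^-1 * 2^-1 * (1 - cos (2 * pi * d')).
  apply: le_lt_trans h; rewrite [leRHS](bigD1 i)//= lerDl; apply: sumr_ge0 => j _.
  by apply: mulr_ge0 => //; have := cos_le1 (2 * pi * z ord0 j); lra.
have hc : cos (2 * pi * d') < cos (2 * pi * `|z ord0 i - k%:~R|).
  have -> : cos (2 * pi * `|z ord0 i - k%:~R|) = cos (2 * pi * z ord0 i).
    rewrite -(cos_2pi_int (z ord0 i) k); case: (ger0P (z ord0 i - k%:~R)) => // _.
    by rewrite mulrN cosN.
  by have := cos_le1 (2 * pi * d'); lra.
move: hc; rewrite ltr_cos.
- by rewrite ltr_pM2l// mulr_gt0.
- by apply: in_pi; rewrite normr_ge0 ler_norml; apply/andP; split; lra.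
- by apply: in_pi; lra.
Qed.

(** Convolution multiplies coefficients. The sign in - p.2 reflects that the index p.2 of a
    polynomial stands for e^{-2 pi i p.2 x}, whose frequency is - p.2. *)
Lemma cintegral_trig_poly_conv l x (G : 'rV[R]_n -> R[i]) : cintegrable cube G ->
  cintegral cube (fun y => G y * trig_poly l (x - y)) =
  trig_poly [seq (p.1 * fourier_coef G (- p.2), p.2) | p <- l] x.
Proof.
move=> iG.
rewrite (@eq_cintegral _ _ _ _ (fun y => G y *
    trig_poly [seq (p.1 * expN2pii (int_vec p.2) x, - p.2) | p <- l] y)).
  rewrite cintegral_mul_trig_poly// /trig_poly !big_map; apply: eq_bigr => p _ /=.
  by rewrite mulrAC.
move=> y _; congr (_ * _); rewrite /trig_poly big_map; apply: eq_bigr => p _ /=.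
by rewrite expN2piiDr expN2piiNr int_vecN expN2piiNl mulrA.
Qed.

Lemma trig_nonneg_conv l (G : 'rV[R]_n -> R[i]) : (forall nu, 0 <= fourier_coef G nu) ->
  trig_nonneg l -> trig_nonneg [seq (p.1 * fourier_coef G (- p.2), p.2) | p <- l].
Proof.
move=> G0 /allP l0; apply/allP => _ /mapP[p /l0 p0 ->] /=; exact: mulr_ge0.
Qed.

Lemma Re_trig_poly_le0 l x : trig_nonneg l -> Re (trig_poly l x) <= Re (trig_poly l 0).
Proof.
move=> /allP l0; rewrite /trig_poly !Re_sum big_seq [leRHS]big_seq; apply: ler_sum => p /l0.
rewrite expN2pii0r mulr1 => /complex_ge0P[r0 i0]; rewrite Re_mul i0 mul0r subr0.
by rewrite -[leRHS]mulr1 ler_wpM2l// Re_expN2pii cos_le1.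
Qed.

Definition kernel_mass k : R := \int[mu]_(y in cube) (q (0 - y)) ^+ k.

Lemma continuous_affine (T : topologicalType) (a b : R) (f : T -> R) : continuous f ->
  continuous (fun t => a * (b + f t)).
Proof. by move=> cf t; apply: cvgM; [exact: cvg_cst|apply: cvgD; [exact: cvg_cst|exact: cf]]. Qed.

Lemma continuous_sumr (T : topologicalType) (I : Type) (s : seq I) (F : I -> T -> R) :
  (forall i, continuous (F i)) -> continuous (fun t => \sum_(i <- s) F i t).
Proof.
move=> cF; elim: s => [|i s IH] t.
  by under eq_fun do rewrite big_nil; exact: cvg_cst.
by under eq_fun do rewrite big_cons; apply: cvgD; [exact: cF|exact: IH].
Qed.

Lemma continuous_kernel_base : continuous q.
Proof.
apply: continuous_affine; apply: continuous_sumr => i; apply: continuous_affine => z.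
apply: (@continuous_comp _ _ _ (fun z : 'rV[R]_n => 2 * pi * z ord0 i) cos); last exact: continuous_cos.
apply: (@continuous_comp _ _ _ (fun z : 'rV[R]_n => z ord0 i) (fun t => 2 * pi * t)).
  exact: coord_continuous.
exact: mulrl_continuous.
Qed.

Lemma continuous_subr_rV (V : normedModType R) (a : V) : continuous (fun y : V => a - y).
Proof. by move=> y; apply: cvgB; [exact: cvg_cst|exact: cvg_id]. Qed.

Lemma continuous_kernel_sub x : continuous (fun y => q (x - y)).
Proof.
move=> y; apply: (@continuous_comp _ _ _ (fun y => x - y) q); last exact: continuous_kernel_base.
exact: continuous_subr_rV.
Qed.

Lemma measurable_kernel x k : measurable_fun cube (fun y => q (x - y) ^+ k).
Proof.
apply: measurable_funTS; apply: continuous_measurable_rV => y.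
apply: (@continuous_comp _ _ _ (fun y => q (x - y)) (fun t => t ^+ k)); last exact: exprn_continuous.
exact: continuous_kernel_sub.
Qed.

Lemma kernel_le1 x y k : 0 <= q (x - y) ^+ k <= 1.
Proof. by rewrite exprn_ge0 ?kernel_base_ge0// exprn_ile1 ?kernel_base_ge0 ?kernel_base_le1. Qed.

Lemma integrable_kernel x k : mu.-integrable cube (EFin \o (fun y => q (x - y) ^+ k)).
Proof.
apply: (integrable_cube 1); first exact: measurable_kernel.
by move=> y _; have /andP[h1 h2] := kernel_le1 x y k; rewrite ger0_norm.
Qed.

(** Both sides are the coefficient at frequency 0 of the polynomial that represents the kernel,
    which does not depend on x. *)
Lemma integral_kernel x k : \int[mu]_(y in cube) (q (x - y)) ^+ k = kernel_mass k.
Proof.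
have [l _ lE] := pos_trig_kernel k.
have E z : \int[mu]_(y in cube) (q (z - y)) ^+ k = Re (\sum_(p <- l) p.1 * (p.2 == 0)%:R).
  transitivity (Re (cintegral cube (fun y => 1 * trig_poly l (z - y)))).
    by rewrite Re_cintegral; apply: eq_Rintegral => y _; rewrite mul1r lE.
  have i1 : cintegrable cube (fun _ : 'rV[R]_n => 1 : R[i]).
    apply: (cintegrable_cube 1); first exact: cmeasurable_cst.
    by move=> y _; rewrite Normc.normc1.
  rewrite cintegral_trig_poly_conv// /trig_poly big_map; congr Re; apply: eq_bigr => p _ /=.
  rewrite /fourier_coef; under eq_cintegral => y _ do rewrite mul1r.
  rewrite cintegral_cube_char oppr_eq0; have [->|_] := eqVneq p.2 0; last by rewrite !mulr0 mul0r.
  by rewrite int_vec0 expN2pii0l !mulr1.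
by rewrite /kernel_mass !E.
Qed.

(** The kernel base equals 1 at the origin, hence exceeds a on a ball around it, and v is the volume
    of that ball. The mass thus decays more slowly than any geometric sequence of ratio below 1, in
    particular than the kernel away from the lattice. *)
Lemma kernel_mass_ge (a : R) : 0 <= a < 1 -> exists2 v : R, 0 < v &
  forall k, a ^+ k * v <= kernel_mass k.
Proof.
move=> /andP[a0 a1].
have q0 : q (0 - 0) = 1.
  apply/eqP; rewrite eq_sym -subr_eq0 kernel_base1B big1 ?mulr0// => i _.
  by rewrite !mxE subr0 mulr0 cos0 subrr mulr0.
have : \forall y \near (0 : 'rV[R]_n), a < q (0 - y).
  have h : q (0 - y) @[y --> (0 : 'rV[R]_n)] --> q (0 - 0) by exact: continuous_kernel_sub.
  by rewrite q0 in h; apply: (cvgr_gt 1 h).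
move=> /nbhs_ballP[r /= r0 hr].
pose r' := Num.min r 2^-1.
have r'0 : 0 < r' by rewrite lt_min r0/=; lra.
pose B := @ball R 'rV[R]_n 0 r'.
have mB : measurable B by exact: measurable_rV_ball.
have Bc : B `<=` cube.
  move=> y /(rV_ballE r'0) By i; have := By i; rewrite mxE sub0r normrN lt_min => /andP[_].
  by rewrite ltr_norml => /andP[/ltW -> ->].
have vB : (mu B < +oo)%E.
  by apply: le_lt_trans (le_measure mu _ _ Bc) (lebesgue_cube_lty n); rewrite inE//; exact: measurable_cube.
exists (fine (mu B)); first by rewrite fine_gt0// vB andbT; exact: lebesgue_rV_ball_gt0.
move=> k; rewrite -lee_fin EFinM fineK; last first.
  by rewrite ge0_fin_numE.
rewrite -(integral_cst mu mB) /kernel_mass fineK; last first.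
  exact: (integrable_fin_num mcube (integrable_kernel 0 k)).
apply: (@le_trans _ _ (\int[mu]_(y in B) ((q (0 - y)) ^+ k)%:E)%E).
  apply: ge0_le_integral => //.
  - by move=> y _; rewrite lee_fin exprn_ge0.
  - apply/measurable_EFinP; apply: measurable_funS (measurable_kernel 0 k) => //; exact: mcube.
  - move=> y /(rV_ballE r'0) By; rewrite lee_fin lerXn2r ?nnegrE ?kernel_base_ge0//.
    apply/ltW/hr/(rV_ballE r0) => i; apply: lt_le_trans (By i) _.
    by rewrite ge_min lexx.
apply: ge0_subset_integral => //; first exact: mcube.
  by apply/measurable_EFinP; exact: measurable_kernel.
by move=> y _; rewrite lee_fin; have /andP[] := kernel_le1 0 y k.
Qed.

Definition kernel_mean (u : 'rV[R]_n -> R) k x : R :=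
  (\int[mu]_(y in cube) (u y * q (x - y) ^+ k)) / kernel_mass k.

Lemma kernel_mass_gt0 k : 0 < kernel_mass k.
Proof.
have [|v v0 /(_ k)] := @kernel_mass_ge 2^-1; first lra.
by apply: lt_le_trans; rewrite mulr_gt0// exprn_gt0// invr_gt0.
Qed.

Lemma integrable_mul_kernel (u : 'rV[R]_n -> R) (M : R) x k : measurable_fun cube u ->
  (forall y, `|u y| <= M) -> mu.-integrable cube (EFin \o (fun y => u y * q (x - y) ^+ k)).
Proof.
move=> mu_ uM; apply: (integrable_cube M).
  by apply: measurable_funM => //; exact: measurable_kernel.
move=> y _; rewrite normrM; have /andP[h1 h2] := kernel_le1 x y k.
by rewrite (ger0_norm h1) -[leRHS]mulr1; apply: ler_pM.
Qed.

Lemma kernel_mean_le (u : 'rV[R]_n -> R) (M : R) k x : measurable_fun cube u ->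
  (forall y, `|u y| <= M) -> `|kernel_mean u k x| <= M.
Proof.
move=> mu_ uM; have c0 := kernel_mass_gt0 k.
rewrite /kernel_mean normrM normfV (gtr0_norm c0) ler_pdivrMr//.
apply: le_trans (le_normr_Rintegral mcube (integrable_mul_kernel u M x k mu_ uM)) _.
rewrite -(integral_kernel x) -(RintegralZl M mcube (integrable_kernel x k)).
apply: le_Rintegral; first exact: mcube.
- exact: (integrable_norm (integrable_mul_kernel u M x k mu_ uM)).
- by apply: (integrable_eq mcube (integrableZl mcube M (integrable_kernel x k))) => y _ /=; rewrite EFinM.
- move=> y _; rewrite normrM; have /andP[h1 h2] := kernel_le1 x y k.
  by rewrite (ger0_norm h1) ler_wpM2r.
Qed.

(** Where q > 1 - eta, the point y is close to x modulo the lattice and continuity together with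
    periodicity gives e/2. Elsewhere the kernel is at most (1 - eta)^k, and division by the mass
    leaves a geometric sequence tending to 0. *)
Lemma kernel_mean_cvg (u : 'rV[R]_n -> R) (M : R) x : continuous u ->
  (forall k y, u (y + int_vec k) = u y) -> (forall y, `|u y| <= M) ->
  kernel_mean u k x @[k --> \oo] --> u x.
Proof.
move=> cu pu uM; have mu_ : measurable_fun cube u.
  by apply: measurable_funTS; exact: continuous_measurable_rV.
have M0 : 0 <= M by apply: le_trans (uM 0).
apply/cvgrPdist_le => /= e e0; have e20 : 0 < e / 2 by rewrite divr_gt0.
have := cu x => /cvgrPdist_le /(_ _ e20) /nbhs_ballP[d /= d0 hd].
have [eta /andP[eta0 eta1] far] := kernel_far d d0.
have close y : 1 - eta < q (x - y) -> `|u x - u y| <= e / 2.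
  move=> /far [k hk]; rewrite -(pu k y); apply: hd; apply/(rV_ballE d0) => i.
  by have := hk i; rewrite !mxE opprD addrA.
(* Any base strictly between 1 - eta and 1 would do: it makes the ratio r below less than 1. *)
have [|v v0 hv] := @kernel_mass_ge (1 - eta / 2); first lra.
pose r := (1 - eta) / (1 - eta / 2).
have r0 : 0 <= r < 1.
  apply/andP; split; first by apply: divr_ge0; lra.
  by rewrite /r ltr_pdivrMr; lra.
have main k : `|u x - kernel_mean u k x| <= e / 2 + 2 * M / v * r ^+ k.
  have c0 := kernel_mass_gt0 k.
  have iK := integrable_kernel x k.
  have iuK := integrable_mul_kernel u M x k mu_ uM.
  have iZK c : mu.-integrable cube (EFin \o (fun y => c * q (x - y) ^+ k)).
    by apply: (integrable_eq mcube (integrableZl mcube c iK)) => y _ /=; rewrite EFinM.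
  have icst (c : R) : mu.-integrable cube (EFin \o (fun _ : 'rV[R]_n => c)).
    by apply: (integrable_cube `|c|) => //; exact: measurable_cst.
  have iD : mu.-integrable cube (EFin \o (fun y => u x * q (x - y) ^+ k - u y * q (x - y) ^+ k)).
    by apply: (integrable_eq mcube (integrableB mcube (iZK (u x)) iuK)) => y _ /=; rewrite EFinB.
  have E : u x - kernel_mean u k x =
      (\int[mu]_(y in cube) (u x * q (x - y) ^+ k - u y * q (x - y) ^+ k)) / kernel_mass k.
    rewrite (RintegralB mcube (iZK (u x)) iuK).
    rewrite (RintegralZl (u x) mcube iK) integral_kernel mulrBl mulfK//.
    by rewrite gt_eqF.
  rewrite E normrM normfV (gtr0_norm c0) ler_pdivrMr//.
  apply: le_trans (le_normr_Rintegral mcube iD) _.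
  apply: (@le_trans _ _ (\int[mu]_(y in cube) (e / 2 * q (x - y) ^+ k + 2 * M * (1 - eta) ^+ k))).
    apply: le_Rintegral; first exact: mcube.
    - exact: (integrable_norm iD).
    - by apply: (integrable_eq mcube (integrableD mcube (iZK (e / 2)) (icst _))) => y _ /=; rewrite EFinD.
    - move=> y _; rewrite -mulrBl normrM; have /andP[h1 h2] := kernel_le1 x y k.
      rewrite (ger0_norm h1); have [qy|qy] := ltP (1 - eta) (q (x - y)).
        apply: le_trans (ler_wpM2r h1 (close _ qy)) _.
        by rewrite lerDl !mulr_ge0// exprn_ge0//; lra.
      apply: (@le_trans _ _ (2 * M * (1 - eta) ^+ k)).
        apply: ler_pM => //.
          by rewrite (le_trans (ler_normB _ _))// mulr_natl mulr2n lerD.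
        by rewrite lerXn2r ?nnegrE ?kernel_base_ge0//; lra.
      by rewrite lerDr mulr_ge0// ltW.
  rewrite (RintegralD mcube (iZK (e / 2)) (icst _)).
  rewrite (RintegralZl (e / 2) mcube iK) integral_kernel [leRHS]mulrDl; apply: lerD => //.
  have -> : \int[mu]_(y in cube) (2 * M * (1 - eta) ^+ k) = 2 * M * (1 - eta) ^+ k.
    by have /(congr1 Re) := cintegral_cube_cst (n := n) (Complex (2 * M * (1 - eta) ^+ k) 0).
  rewrite /r expr_div_n -!mulrA; apply: ler_wpM2l => //; apply: ler_wpM2l => //.
  rewrite mulrCA -[leLHS]mulr1; apply: ler_wpM2l; first by rewrite exprn_ge0//; lra.
  have a0 : 0 < (1 - eta / 2) ^+ k by rewrite exprn_gt0//; lra.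
  rewrite mulrA -invfM mulrC ler_pdivlMr ?mul1r; last exact: mulr_gt0.
  by rewrite mulrC; exact: hv.
have : 2 * M / v * r ^+ k @[k --> \oo] --> 2 * M / v * 0.
  apply: cvgM; first exact: cvg_cst.
  by apply: cvg_expr; have /andP[h1 h2] := r0; rewrite ger0_norm.
rewrite mulr0 => /cvgrPdist_le /(_ _ e20); apply: filterS => k.
rewrite sub0r normrN => h; apply: le_trans (main k) _.
by have := le_trans (ler_norm _) h; lra.
Qed.

(** The mean is the convolution of G with the kernel, divided by the mass: its coefficients are
    products of nonnegative numbers, and the two real means are the parts of a single polynomial. *)
Lemma kernel_mean_trig (G : 'rV[R]_n -> R[i]) k : cintegrable cube G ->
  (forall nu, 0 <= fourier_coef G nu) -> exists2 l, trig_nonneg l & forall x, trig_poly l x =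
  Complex (kernel_mean (fun y => Re (G y)) k x) (kernel_mean (fun y => Im (G y)) k x).
Proof.
move=> iG G0; have [l l0 lE] := pos_trig_kernel k.
exists (trig_scale (Complex (kernel_mass k)^-1 0) [seq (p.1 * fourier_coef G (- p.2), p.2) | p <- l]).
  have /allP h := trig_nonneg_conv _ _ G0 l0; apply/allP => _ /mapP[p /h p0 ->] /=.
  by apply: mulr_ge0 => //; rewrite lecE /= eqxx invr_ge0 ltW ?kernel_mass_gt0.
move=> x; rewrite trig_poly_scale -cintegral_trig_poly_conv// /kernel_mean.
by apply: complex_eqP; rewrite ?Re_mul ?Im_mul mul0r ?subr0 ?addr0 mulrC;
  congr (_ * _); apply: eq_Rintegral => y _; rewrite lE ?Re_mul ?Im_mul /= mulr0 ?subr0 ?add0r.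
Qed.

Lemma Rintegral_dominated_cvg {d} {T : measurableType d} {m : {measure set T -> \bar R}}
    {A : set T} (f_ : (T -> R)^nat) (f g : T -> R) : measurable A ->
  (forall k, measurable_fun A (f_ k)) -> (forall t, A t -> f_ k t @[k --> \oo] --> f t) ->
  m.-integrable A (EFin \o g) -> (forall k t, A t -> `|f_ k t| <= g t) ->
  (\int[m]_(t in A) f_ k t) @[k --> \oo] --> \int[m]_(t in A) f t.
Proof.
move=> mA mf cf ig fg.
have mf' : measurable_fun A (EFin \o f) by apply/measurable_EFinP; exact: measurable_fun_cvg cf.
have bf t : A t -> `|f t| <= g t.
  move=> At; have h : `|f_ k t| @[k --> \oo] --> `|f t| by apply: cvg_norm; exact: cf.
  by apply: (ler_cvg_to h (cvg_cst (g t))); apply: nearW => k; exact: fg.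
have if_ : m.-integrable A (EFin \o f).
  apply: (le_integrable mA mf' _ ig) => t At /=.
  by rewrite lee_fin; exact: le_trans (bf t At) (ler_norm _).
apply: fine_cvg; rewrite fineK; last exact: (integrable_fin_num mA if_).
apply: (@dominated_cvg _ _ _ _ _ mA _ _ (EFin \o g)) => //.
- by move=> k; exact/measurable_EFinP.
- by move=> t At; apply: cvg_EFin; [exact: nearW|exact: cf].
Qed.

(** * Continuous functions with nonnegative coefficients *)

Section continuous_positive_definite.
Variables (G : 'rV[R]_n -> R[i]) (M : R).
Hypotheses (cG : continuous (fun x => Re (G x))) (cG' : continuous (fun x => Im (G x))).
Hypotheses (pG : Defs.periodic G) (bG : forall x, normc (G x) <= M).
Hypothesis G_ge0 : forall nu, 0 <= fourier_coef G nu.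

Let bG_Re x : `|Re (G x)| <= M.
Proof. exact: le_trans (normr_Re_le _) (bG x). Qed.

Let bG_Im x : `|Im (G x)| <= M.
Proof. exact: le_trans (normr_Im_le _) (bG x). Qed.

Lemma cmeasurable_continuous A : cmeasurable_fun A G.
Proof. by split; apply: measurable_funTS; exact: continuous_measurable_rV. Qed.

Lemma cintegrable_continuous : cintegrable cube G.
Proof. by apply: (cintegrable_cube M) => //; exact: cmeasurable_continuous. Qed.

(** A polynomial with nonnegative coefficients has its largest real part at 0, because every cosine
    is 1 there. The kernel means carry this over to G. *)
Lemma pos_def_Re_le0 x : Re (G x) <= Re (G 0).
Proof.
have h z := kernel_mean_cvg (fun x => Re (G x)) M z cG (fun k y => congr1 Re (pG k y)) bG_Re.
apply: (ler_cvg_to (h x) (h 0)); apply: nearW => k.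
have [l l0 lE] := kernel_mean_trig G k cintegrable_continuous G_ge0.
by have := Re_trig_poly_le0 l x l0; rewrite !lE.
Qed.

(** With a kernel mean in place of G the integral is a finite sum of products of nonnegative
    coefficients. The means are bounded by M uniformly in k, so a multiple of |Re F| + |Im F|
    dominates, and the sign of the real part and the vanishing of the imaginary part pass to the
    limit. *)
Lemma pos_def_pairing (F : 'rV[R]_n -> R[i]) : cintegrable cube F ->
  (forall nu, 0 <= fourier_coef F nu) -> 0 <= cintegral cube (fun x => F x * G x).
Proof.
move=> iF F0.
pose H k x := Complex (kernel_mean (fun y => Re (G y)) k x) (kernel_mean (fun y => Im (G y)) k x).
have [Fr Fi] := (cintegrableP _ _ mcube).1 iF.
have [mFr mFi] := cintegrable_meas _ _ iF.
have mG := cmeasurable_continuous cube.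
have H0 k : 0 <= cintegral cube (fun x => F x * H k x).
  have [l /allP l0 lE] := kernel_mean_trig G k cintegrable_continuous G_ge0.
  have -> : H k = trig_poly l by apply/funext => x; rewrite lE.
  rewrite cintegral_mul_trig_poly// big_seq; apply: sumr_ge0 => p /l0 p0.
  exact: mulr_ge0.
have mH k : cmeasurable_fun cube (H k).
  have [l _ lE] := kernel_mean_trig G k cintegrable_continuous G_ge0.
  by rewrite (_ : H k = trig_poly l); [exact: cmeasurable_trig_poly|apply/funext => x; rewrite lE].
have bH k x : `|Re (H k x)| <= M /\ `|Im (H k x)| <= M.
  by split; apply: kernel_mean_le => //; have [] := mG.
have cHr x : Re (H k x) @[k --> \oo] --> Re (G x).
  exact: (kernel_mean_cvg (fun x => Re (G x)) M x cG (fun k y => congr1 Re (pG k y)) bG_Re).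
have cHi x : Im (H k x) @[k --> \oo] --> Im (G x).
  exact: (kernel_mean_cvg (fun x => Im (G x)) M x cG' (fun k y => congr1 Im (pG k y)) bG_Im).
pose D x := M * `|Re (F x)| + M * `|Im (F x)|.
have iD : mu.-integrable cube (EFin \o D).
  by apply: (integrable_eq mcube (integrableD mcube
    (integrableZl mcube M (integrable_norm Fr)) (integrableZl mcube M (integrable_norm Fi)))).
have prod_le (a b c d : R) : `|c| <= M -> `|d| <= M -> `|a * c - b * d| <= M * `|a| + M * `|b|.
  move=> cM dM; apply: le_trans (ler_normB _ _) _; rewrite !normrM.
  by rewrite ![M * _]mulrC; apply: lerD; apply: ler_wpM2l.
have cvRe : Re (cintegral cube (fun x => F x * H k x)) @[k --> \oo] -->
    Re (cintegral cube (fun x => F x * G x)).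
  apply: (@Rintegral_dominated_cvg _ _ _ _ _ _ D) => //; first exact: mcube.
  - by move=> k; have [] := cmeasurableM _ _ _ (cintegrable_meas _ _ iF) (mH k).
  - move=> x cx; under eq_cvg do rewrite Re_mul.
    by rewrite Re_mul; apply: cvgB; [apply: cvgM (cHr x)|apply: cvgM (cHi x)]; exact: cvg_cst.
  - by move=> k x cx; rewrite Re_mul; have [h1 h2] := bH k x; exact: prod_le.
have cvIm : Im (cintegral cube (fun x => F x * H k x)) @[k --> \oo] -->
    Im (cintegral cube (fun x => F x * G x)).
  apply: (@Rintegral_dominated_cvg _ _ _ _ _ _ D) => //; first exact: mcube.
  - by move=> k; have [] := cmeasurableM _ _ _ (cintegrable_meas _ _ iF) (mH k).
  - move=> x cx; under eq_cvg do rewrite Im_mul.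
    by rewrite Im_mul; apply: cvgD; [apply: cvgM (cHi x)|apply: cvgM (cHr x)]; exact: cvg_cst.
  - move=> k x cx; rewrite Im_mul -[Im (F x) * _]opprK -mulNr; have [h1 h2] := bH k x.
    by have := @prod_le (Re (F x)) (- Im (F x)) _ _ h2 h1; rewrite normrN.
apply/complex_ge0P; split.
  apply: (ler_cvg_to (cvg_cst 0) cvRe); apply: nearW => k.
  by have /complex_ge0P[] := H0 k.
have h k : Im (cintegral cube (fun x => F x * H k x)) = 0.
  by have /complex_ge0P[] := H0 k.
apply/eqP; rewrite eq_le; apply/andP; split.
  by apply: (ler_cvg_to cvIm (cvg_cst 0)); apply: nearW => k; rewrite h.
by apply: (ler_cvg_to (cvg_cst 0) cvIm); apply: nearW => k; rewrite h.
Qed.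

End continuous_positive_definite.
End kernel.

(** * Bessel's inequality *)

Section parseval.
Context {R : realType} {n : nat}.
Implicit Types (l : seq (R[i] * 'rV[int]_n)) (f h : 'rV[R]_n -> R[i]) (s : seq 'rV[int]_n) (c : 'rV[int]_n -> R[i]).
Local Notation mu := (lebesgue_rV n).
Local Notation mcube := (@measurable_cube R n).
Local Notation N2 h := (\int[mu]_(x in cube) (normc (h x) ^+ 2)).
Local Notation L2 h := (mu.-integrable cube (EFin \o (fun x => normc (h x) ^+ 2))).
Local Notation char_sum s c := (fun x => \sum_(nu <- s) c nu * expN2pii (int_vec nu) x).

Lemma char_sumE s c (x : 'rV[R]_n) : trig_poly [seq (c nu, nu) | nu <- s] x =
  \sum_(nu <- s) c nu * expN2pii (int_vec nu) x.
Proof. by rewrite /trig_poly big_map. Qed.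

Lemma L2_bounded h (M : R) : cmeasurable_fun cube h -> (forall x, cube x -> normc (h x) <= M) -> L2 h.
Proof.
move=> mh hM; apply: (integrable_cube (M ^+ 2)).
  by apply: measurable_funX; exact: normc_measurable.
move=> x cx; rewrite ger0_norm ?sqr_ge0// lerXn2r ?nnegrE ?normc_ge0 ?hM//.
by apply: le_trans (hM _ cx); exact: normc_ge0.
Qed.

Lemma L2_trig_poly l : L2 (trig_poly l : 'rV[R]_n -> R[i]).
Proof.
have [M hM] := trig_poly_bounded (R := R) l.
by apply: (@L2_bounded _ M); [exact: cmeasurable_trig_poly|move=> x _].
Qed.

Lemma N2_ge0 h : 0 <= N2 h.
Proof. by apply: Rintegral_ge0 => x _; exact: sqr_ge0. Qed.

Lemma integrable_Re_trig_poly h l : cintegrable cube h ->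
  mu.-integrable cube (EFin \o (fun x => Re (h x * trig_poly l x))).
Proof. by move=> ih; have [] := (cintegrableP _ _ mcube).1 (cintegrable_mul_trig_poly _ l ih). Qed.

(** The approximant is the conjugate of a polynomial so that the cross term is the bilinear pairing
    of [cintegral_mul_trig_poly]. *)
Lemma N2_sub_conj h l : cintegrable cube h -> L2 h ->
  N2 (fun x => h x - conjc (trig_poly l x)) =
  N2 h - 2 * Re (\sum_(q <- l) q.1 * fourier_coef h q.2) + N2 (trig_poly l).
Proof.
move=> ih lh; rewrite -cintegral_mul_trig_poly// Re_cintegral.
have iP := L2_trig_poly l; have iR := integrable_Re_trig_poly _ l ih.
have iR2 : mu.-integrable cube (EFin \o (fun x => 2 * Re (h x * trig_poly l x))).
  by apply: (integrable_eq mcube (integrableZl mcube 2 iR)) => x _ /=; rewrite EFinM.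
rewrite -(RintegralZl 2 mcube iR) -(RintegralB mcube lh iR2) -RintegralD//; last 2 first.
- exact: mcube.
- by apply: (integrable_eq mcube (integrableB mcube lh iR2)) => x _ /=; rewrite EFinB.
apply: eq_Rintegral => x _.
by rewrite !normc_sqrE Re_add Im_add Re_opp Im_opp Re_conjc Im_conjc Re_mul; ring.
Qed.

Lemma N2_char_sum s c : uniq s -> N2 (char_sum s c) = \sum_(nu <- s) normc (c nu) ^+ 2.
Proof.
move=> us.
transitivity (Re (cintegral cube (fun x => trig_poly (trig_conj [seq (c nu, nu) | nu <- s]) x *
    trig_poly [seq (c nu, nu) | nu <- s] x))).
  rewrite Re_cintegral; apply: eq_Rintegral => x _.
  by rewrite -char_sumE trig_poly_conj Re_mul Re_conjc Im_conjc normc_sqrE; ring.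
have iT l : cintegrable cube (trig_poly l : 'rV[R]_n -> R[i]).
  have [M hM] := trig_poly_bounded (R := R) l.
  by apply: (cintegrable_cube M); [exact: cmeasurable_trig_poly|move=> x _].
rewrite cintegral_mul_trig_poly// big_map Re_sum /=.
rewrite big_seq [RHS]big_seq; apply: eq_bigr => nu nus.
suff -> : fourier_coef (trig_poly (trig_conj [seq (c nu, nu) | nu <- s])) nu = conjc (c nu).
  by rewrite Re_mul Re_conjc Im_conjc normc_sqrE; ring.
rewrite /fourier_coef -[expN2pii (int_vec nu)]/(fun x => expN2pii (int_vec nu) x).
under eq_cintegral => x _ do rewrite mulrC.
rewrite cintegral_mul_trig_poly; last exact: cintegrable_cube_char.
rewrite !big_map/= (bigD1_seq nu)//= big1 ?addr0.
  rewrite /fourier_coef; under eq_cintegral => x _ do rewrite -expN2piiDl -int_vecD.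
  by rewrite cintegral_cube_char subrr eqxx mulr1.
move=> k /negPf knu; rewrite /fourier_coef; under eq_cintegral => x _ do rewrite -expN2piiDl -int_vecD.
by rewrite cintegral_cube_char subr_eq0 eq_sym knu mulr0.
Qed.

Lemma Rintegral_lin (u v : 'rV[R]_n -> R) (a b : R) :
  mu.-integrable cube (EFin \o u) -> mu.-integrable cube (EFin \o v) ->
  mu.-integrable cube (EFin \o (fun x => a * u x + b * v x)) /\
  \int[mu]_(x in cube) (a * u x + b * v x) = a * \int[mu]_(x in cube) u x + b * \int[mu]_(x in cube) v x.
Proof.
move=> iu iv.
have Z (c : R) (h : 'rV[R]_n -> R) : mu.-integrable cube (EFin \o h) ->
    mu.-integrable cube (EFin \o (fun x => c * h x)).
  by move=> ih; apply: (integrable_eq mcube (integrableZl mcube c ih)) => x _ /=; rewrite EFinM.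
split.
  by apply: (integrable_eq mcube (integrableD mcube (Z a _ iu) (Z b _ iv))) => x _ /=; rewrite EFinD.
by rewrite (RintegralD mcube (Z a _ iu) (Z b _ iv)) (RintegralZl a mcube iu) (RintegralZl b mcube iv).
Qed.

(** The approximation arguments end here: approximating within t^2 for the squared norm, an error
    divided by t in Young's inequality is still of order t. *)
Lemma ler_linear_eps (a b K : R) : (forall t : R, 0 < t <= 1 -> a <= b + t * K) -> a <= b.
Proof.
move=> h; apply/ler_addgt0Pr => /= e e0.
pose t := Num.min 1 (e / (`|K| + 1)).
have K0 : 0 < `|K| + 1 by rewrite ltr_wpDl.
have t0 : 0 < t by rewrite lt_min ltr01 divr_gt0.
apply: le_trans (h t _) _; first by rewrite t0 ge_min lexx.
rewrite lerD2l; apply: (@le_trans _ _ (t * (`|K| + 1))).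
  apply: ler_wpM2l; first exact: ltW.
  by apply: le_trans (ler_norm _) _; rewrite lerDl.
by rewrite -ler_pdivlMr// ge_min lexx orbT.
Qed.

Lemma sqr_normc_sub_le (a b : R[i]) (t : R) : 0 < t ->
  normc b ^+ 2 <= (1 + t) * normc a ^+ 2 + (1 + t^-1) * normc (a - b) ^+ 2.
Proof.
move=> t0; rewrite !normc_sqrE Re_add Im_add Re_opp Im_opp.
have H (x y : R) : y ^+ 2 <= (1 + t) * x ^+ 2 + (1 + t^-1) * (x - y) ^+ 2.
  rewrite -subr_ge0 (_ : _ - _ = t^-1 * (t * x + (x - y)) ^+ 2); last by field; rewrite gt_eqF.
  by rewrite mulr_ge0 ?sqr_ge0// invr_ge0 ltW.
by have := H (Re a) (Re b); have := H (Im a) (Im b); lra.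
Qed.

(** Young's inequality applied to |b| alone: |a| remains as a factor. For a = f x this is what turns
    closeness for the weight |f| into closeness of integrals against f. *)
Lemma Re_mul_le (a b : R[i]) (t : R) : 0 < t ->
  2 * Re (a * b) <= normc a * (t + t^-1 * normc b ^+ 2).
Proof.
move=> t0; have h : Re (a * b) <= normc a * normc b.
  by rewrite -Normc.normcM; exact: le_trans (ler_norm _) (normr_Re_le _).
apply: le_trans (_ : normc a * (2 * normc b) <= _); first by lra.
apply: ler_wpM2l; first exact: normc_ge0.
rewrite -subr_ge0 (_ : _ - _ = t^-1 * (t - normc b) ^+ 2); last by field; rewrite gt_eqF.
by rewrite mulr_ge0 ?sqr_ge0// invr_ge0 ltW.
Qed.

Lemma Re_mul_le_sqr (a b : R[i]) : 2 * Re (a * b) <= normc a ^+ 2 + normc b ^+ 2.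
Proof.
rewrite !normc_sqrE Re_mul; have := sqr_ge0 (Re a - Re b); have := sqr_ge0 (Im a + Im b); lra.
Qed.

Section bessel.
Variables (f : 'rV[R]_n -> R[i]).
Hypothesis intf : cintegrable cube f.
(** The summand 1 of the weight controls the L^2 norm, the summand |f| the pairing with f. The
    truncation [psi] is that of the conjugate of f, so that f psi = |psi|^2. *)
Let w x := 1 + normc (f x).
Let psi (m : nat) x : R[i] := if normc (f x) <= m%:R then conjc (f x) else 0.

Let mf : cmeasurable_fun cube f. Proof. exact: cintegrable_meas intf. Qed.

Let mnf : measurable_fun cube (fun x => normc (f x)).
Proof. exact: normc_measurable. Qed.

Let inf : mu.-integrable cube (EFin \o (fun x => normc (f x))).
Proof.
apply/integrableP; split; first exact/measurable_EFinP.
have [_] := intf; apply: le_lt_trans; rewrite le_eqVlt; apply/orP; left; apply/eqP.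
by apply: eq_integral => x _ /=; rewrite ger0_norm ?normc_ge0.
Qed.

Let w_ge1 x : 1 <= w x. Proof. by rewrite lerDl normc_ge0. Qed.

Let w_ge0 x : cube x -> 0 <= w x.
Proof. by move=> _; apply: le_trans (w_ge1 x). Qed.

Let iw : mu.-integrable cube (EFin \o w).
Proof.
have i1 : mu.-integrable cube (EFin \o (fun _ : 'rV[R]_n => 1 : R)).
  by apply: (integrable_cube 1) => [|x _]; [exact: measurable_cst|rewrite normr1].
by apply: (integrable_eq mcube (integrableD mcube i1 inf)) => x _.
Qed.

Let mpsi m : cmeasurable_fun cube (psi m).
Proof.
have mb : measurable_fun cube (fun x => normc (f x) <= m%:R).
  by apply: measurable_fun_ler => //; exact: measurable_cst.
have [mr mi] := cmeasurable_conj _ _ mf.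
split.
  rewrite (_ : (fun _ => _) = fun x => if normc (f x) <= m%:R then Re (conjc (f x)) else 0).
    apply: (measurable_fun_if mcube mb); last exact: measurable_cst.
    exact: (measurable_funS mcube (@subIsetl _ _ _) mr).
  by apply/funext => x; rewrite /psi; case: ifP.
rewrite (_ : (fun _ => _) = fun x => if normc (f x) <= m%:R then Im (conjc (f x)) else 0).
  apply: (measurable_fun_if mcube mb); last exact: measurable_cst.
  exact: (measurable_funS mcube (@subIsetl _ _ _) mi).
by apply/funext => x; rewrite /psi; case: ifP.
Qed.

Let bpsi m x : normc (psi m x) <= m%:R.
Proof. by rewrite /psi; case: ifP => h; rewrite ?normc_conj// Normc.normc0. Qed.

Let Lpsi m : L2 (psi m).
Proof. by apply: (@L2_bounded _ m%:R); [exact: mpsi|move=> x _; exact: bpsi]. Qed.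

Let mul_psi m x : Re (f x * psi m x) = normc (psi m x) ^+ 2.
Proof.
rewrite /psi; case: ifP => _; last by rewrite mulr0 Normc.normc0 expr0n.
by rewrite normc_conj Re_mul Re_conjc Im_conjc normc_sqrE; ring.
Qed.

Let dense m (e : R) : 0 < e -> exists l,
  mu.-integrable cube (EFin \o (fun x => normc (psi m x - trig_poly l x) ^+ 2 * w x)) /\
  \int[mu]_(x in cube) (normc (psi m x - trig_poly l x) ^+ 2 * w x) <= e.
Proof.
move=> e0.
have [l hl] := trig_density w w_ge0 iw (psi m) m%:R e (mpsi m) (fun x _ => bpsi m x) e0.
exists l.
have id : mu.-integrable cube (EFin \o (fun x => normc (psi m x - trig_poly l x) ^+ 2 * w x)).
  apply/integrableP; split.
    apply/measurable_EFinP; apply: measurable_funM; last by apply: measurable_funD => //; exact: measurable_cst.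
    apply: measurable_funX; apply: normc_measurable; apply: cmeasurableD; first exact: mpsi.
    by apply: cmeasurableN; exact: cmeasurable_trig_poly.
  apply: le_lt_trans (ltry e); apply: le_trans hl; rewrite le_eqVlt; apply/orP; left; apply/eqP.
  apply: eq_integral => x xc; rewrite /= ger0_norm// mulr_ge0 ?sqr_ge0// w_ge0//.
  exact/set_mem.
by split => //; rewrite -lee_fin fineK//; exact: (integrable_fin_num mcube id).
Qed.

(** Let P approximate the truncation psi in the weighted norm. Then 2 N2(psi), which is twice the
    integral of f psi, is close to 2 Re of the integral of f P, and the latter is a finite sum
    bounded by N2(P) + A. As N2(P) is close to N2(psi), one copy of N2(psi) cancels and N2(psi) <= A
    remains up to O(t). *)
Lemma bessel_truncation (A : R) m :
  (forall s, uniq s -> \sum_(nu <- s) normc (fourier_coef f nu) ^+ 2 <= A) -> N2 (psi m) <= A.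
Proof.
move=> hA.
apply: (@ler_linear_eps _ _ (N2 (psi m) + \int[mu]_(x in cube) normc (f x) + 2)) => t /andP[t0 t1].
(* With tolerance t^2 the weighted error, multiplied by 1 + 1/t, is t + t^2 <= 2 t. *)
have [l [id hd]] := dense m (t ^+ 2) ltac:(by rewrite exprn_gt0).
have iP := L2_trig_poly l; have iR := integrable_Re_trig_poly _ l intf.
have [i1 E1] := Rintegral_lin _ _ 2 1 (Lpsi m) iP.
have [i2 E2] := Rintegral_lin _ _ 2 t iR inf.
have [i3 E3] := Rintegral_lin _ _ (1 + t) (1 + t^-1) (Lpsi m) id.
have [i4 E4] := Rintegral_lin _ _ 1 1 i2 i3.
have t1_ge0 : 0 <= t^-1 by rewrite invr_ge0 ltW.
have pt x : cube x -> 2 * normc (psi m x) ^+ 2 + 1 * normc (trig_poly l x) ^+ 2 <=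
    1 * (2 * Re (f x * trig_poly l x) + t * normc (f x)) +
    1 * ((1 + t) * normc (psi m x) ^+ 2 + (1 + t^-1) * (normc (psi m x - trig_poly l x) ^+ 2 * w x)).
  move=> _; have h0 : normc (psi m x) ^+ 2 =
      Re (f x * trig_poly l x) + Re (f x * (psi m x - trig_poly l x)).
    by rewrite -Re_add -mul_psi; congr Re; ring.
  have h1 := @Re_mul_le (f x) (psi m x - trig_poly l x) t t0.
  have h2 := @sqr_normc_sub_le (psi m x) (trig_poly l x) t t0.
  have h3 : 0 <= normc (f x) * normc (psi m x - trig_poly l x) ^+ 2.
    by rewrite mulr_ge0 ?sqr_ge0 ?normc_ge0.
  by rewrite /w; move: h0 h1 h2 h3; lra.
have := le_Rintegral mcube i1 i4 pt; rewrite E4 E1 E2 E3 => H.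
have [s [c [us lE]]] := trig_poly_uniq (R := R) l.
have Es : N2 (trig_poly l) = \sum_(nu <- s) normc (c nu) ^+ 2.
  by rewrite -N2_char_sum//; apply: eq_Rintegral => x _; rewrite lE.
have Ec : \int[mu]_(x in cube) Re (f x * trig_poly l x) = \sum_(nu <- s) Re (c nu * fourier_coef f nu).
  rewrite -Re_sum; have := cintegral_mul_trig_poly f [seq (c nu, nu) | nu <- s] intf.
  rewrite big_map => /(congr1 Re) <-; apply: eq_Rintegral => x _.
  by rewrite char_sumE -lE.
(* The only use of the bound on the coefficients: 2 Re (c z) <= |c|^2 + |z|^2 for each frequency,
   with the frequencies of P merged so that the |c|^2 add up to N2(P). *)
have hB : 2 * \int[mu]_(x in cube) Re (f x * trig_poly l x) <= N2 (trig_poly l) + A.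
  apply: le_trans (lerD (lexx _) (hA s us)); rewrite Ec Es mulr_sumr -big_split /=.
  by apply: ler_sum => nu _; exact: Re_mul_le_sqr.
have hd2 : (1 + t^-1) * \int[mu]_(x in cube) (normc (psi m x - trig_poly l x) ^+ 2 * w x) <= 2 * t.
  apply: le_trans (_ : (1 + t^-1) * t ^+ 2 <= _); first by apply: ler_wpM2l => //; lra.
  have tt : t * t <= t by rewrite -[leRHS]mulr1 ler_pM2l.
  have -> : (1 + t^-1) * t ^+ 2 = t + t * t by field; rewrite gt_eqF.
  by lra.
move: H hB hd2; lra.
Qed.

Let psi_eventually x : exists N, forall m, (N <= m)%N -> psi m x = conjc (f x).
Proof.
exists (Num.truncn (normc (f x))).+1 => m hm; rewrite /psi ifT//.
by apply: le_trans (ltW (truncnS_gt _)) _; rewrite ler_nat.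
Qed.

(** Square summable coefficients put an integrable function in L^2: the truncations increase to |f|,
    and monotone convergence transfers their uniform bound. *)
Lemma bessel_L2 (A : R) :
  (forall s, uniq s -> \sum_(nu <- s) normc (fourier_coef f nu) ^+ 2 <= A) -> L2 f.
Proof.
move=> hA; apply/integrableP; split.
  by apply/measurable_EFinP; exact: measurable_funX.
apply: (@le_lt_trans _ _ A%:E); last exact: ltry.
rewrite (_ : integral _ _ _ = \int[mu]_(x in cube) (normc (f x) ^+ 2)%:E)%E; last first.
  by apply: eq_integral => x _; rewrite /= ger0_norm ?sqr_ge0.
have mp m : measurable_fun cube (EFin \o (fun x => normc (psi m x) ^+ 2)).
  by apply/measurable_EFinP; apply: measurable_funX; exact: normc_measurable.
have cv : (\int[mu]_(x in cube) (normc (psi m x) ^+ 2)%:E)%E @[m --> \oo] -->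
    (\int[mu]_(x in cube) (normc (f x) ^+ 2)%:E)%E.
  have -> : (\int[mu]_(x in cube) (normc (f x) ^+ 2)%:E)%E =
      (\int[mu]_(x in cube) (limn (fun m => (normc (psi m x) ^+ 2)%:E)))%E.
    apply: eq_integral => x _; apply/esym/cvg_lim => //.
    have [N hN] := psi_eventually x.
    apply: cvg_near_cst; exists N => // m /= /hN ->.
    by rewrite normc_conj.
  apply: cvg_monotone_convergence => //; first exact: mcube.
  - by move=> m x _; rewrite lee_fin sqr_ge0.
  - move=> x _ a b ab; rewrite lee_fin lerXn2r ?nnegrE ?normc_ge0//.
    rewrite /psi; case: ifP => ha; last by rewrite Normc.normc0; case: ifP => _; rewrite ?Normc.normc0 ?normc_ge0.
    by rewrite ifT// (le_trans ha)// ler_nat.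
apply: (cvge_le _ cv); apply: nearW => m.
rewrite -[leLHS]fineK; last exact: (integrable_fin_num mcube (Lpsi m)).
by rewrite lee_fin; exact: bessel_truncation.
Qed.

Lemma N2_sub_char_sum h s c : cintegrable cube h -> L2 h -> uniq s ->
  N2 (fun x => h x - conjc (char_sum s c x)) =
  N2 h - 2 * \sum_(nu <- s) Re (c nu * fourier_coef h nu) + \sum_(nu <- s) normc (c nu) ^+ 2.
Proof.
move=> ih lh us; have := N2_sub_conj h [seq (c nu, nu) | nu <- s] ih lh.
rewrite big_map Re_sum -N2_char_sum//= => H.
transitivity (N2 (fun x => h x - conjc (trig_poly [seq (c nu, nu) | nu <- s] x))).
  by apply: eq_Rintegral => x _; rewrite char_sumE.
by rewrite H; congr (_ + _); apply: eq_Rintegral => x _; rewrite char_sumE.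
Qed.

(** Truncation and weighted density give some polynomial close to f in L^2. Over the same
    frequencies the Fourier coefficients of f do at least as well, being those of the orthogonal
    projection. *)
Lemma partial_sum_dense (e : R) : L2 f -> 0 < e -> exists2 s, uniq s &
  N2 (fun x => f x - conjc (char_sum s (fun nu => conjc (fourier_coef f nu)) x)) <= e.
Proof.
move=> Lf e0; have e40 : 0 < e / 4 by rewrite divr_gt0.
have mconj := cmeasurable_conj _ _ mf.
have Ld m : L2 (fun x => conjc (f x) - psi m x).
  apply: (le_integrable mcube _ _ (integrableZl mcube 4 Lf)) => [|x _].
    apply/measurable_EFinP; apply: measurable_funX; apply: normc_measurable.
    by apply: cmeasurableD => //; exact: cmeasurableN.
  rewrite /= lee_fin ger0_norm ?sqr_ge0//; apply: le_trans _ (ler_norm _).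
  rewrite /psi; case: ifP => _; last by rewrite subr0 normc_conj; have := sqr_ge0 (normc (f x)); lra.
  by rewrite subrr Normc.normc0 expr0n/= mulr_ge0 ?sqr_ge0.
have cv : N2 (fun x => conjc (f x) - psi m x) @[m --> \oo] --> \int[mu]_(x in cube) (0 : R).
  apply: (@Rintegral_dominated_cvg _ _ _ _ _ _ _ (fun x => 4 * normc (f x) ^+ 2) mcube).
  - by move=> m; apply/measurable_EFinP; exact: measurable_int (Ld m).
  - move=> x _; have [N hN] := psi_eventually x.
    by apply: cvg_near_cst; exists N => // m /= /hN ->; rewrite subrr Normc.normc0 expr0n.
  - by apply: (integrable_eq mcube (integrableZl mcube 4 Lf)) => x _ /=; rewrite EFinM.
  - move=> m x _; rewrite ger0_norm ?sqr_ge0// /psi; case: ifP => _.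
      by rewrite subrr Normc.normc0 expr0n/= mulr_ge0 ?sqr_ge0.
    by rewrite subr0 normc_conj; have := sqr_ge0 (normc (f x)); lra.
have I0 : \int[mu]_(x in cube) (0 : R) = 0 by rewrite /Rintegral integral0.
rewrite I0 in cv; move/cvgrPdist_le : cv => /(_ _ e40)[N _ /(_ N (leqnn N))].
rewrite sub0r normrN ger0_norm ?N2_ge0// => hN.
have [l [id hd]] := dense N (e / 4) e40.
have [i1 E1] := Rintegral_lin _ _ 2 2 (Ld N) id.
have pt x : cube x -> normc (f x - conjc (trig_poly l x)) ^+ 2 <=
    2 * normc (conjc (f x) - psi N x) ^+ 2 + 2 * (normc (psi N x - trig_poly l x) ^+ 2 * w x).
  move=> _; apply: (@le_trans _ _ (2 * normc (conjc (f x) - psi N x) ^+ 2 +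
      2 * (normc (psi N x - trig_poly l x) ^+ 2 * 1))).
    rewrite mulr1 !normc_sqrE !(Re_add, Im_add, Re_opp, Im_opp, Re_conjc, Im_conjc).
    have H (a b c : R) : (a - c) ^+ 2 <= 2 * (a - b) ^+ 2 + 2 * (b - c) ^+ 2.
      by have := sqr_ge0 (a - 2 * b + c); lra.
    have h1 := H (Re (f x)) (Re (psi N x)) (Re (trig_poly l x)).
    have h2 := H (- Im (f x)) (Im (psi N x)) (Im (trig_poly l x)).
    lra.
  by rewrite lerD2l; apply: ler_wpM2l => //; apply: ler_wpM2l; rewrite ?sqr_ge0.
have Lfl : L2 (fun x => f x - conjc (trig_poly l x)).
  apply: (le_integrable mcube _ _ i1) => [|x cx].
    apply/measurable_EFinP; apply: measurable_funX; apply: normc_measurable.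
    by apply: cmeasurableD => //; apply: cmeasurableN; apply: cmeasurable_conj; exact: cmeasurable_trig_poly.
  by rewrite /= lee_fin ger0_norm ?sqr_ge0//; exact: le_trans (pt x cx) (ler_norm _).
have hl : N2 (fun x => f x - conjc (trig_poly l x)) <= e.
  by apply: le_trans (le_Rintegral mcube Lfl i1 pt) _; rewrite E1; lra.
have [s [c [us lE]]] := trig_poly_uniq (R := R) l.
exists s => //; apply: le_trans hl.
have -> : N2 (fun x => f x - conjc (trig_poly l x)) = N2 (fun x => f x - conjc (char_sum s c x)).
  by apply: eq_Rintegral => x _; rewrite lE.
rewrite !N2_sub_char_sum// -!addrA lerD2l !mulr_sumr -!sumrN -!big_split.
(* For fixed z the quantity |a|^2 - 2 Re (a z) is smallest when a is the conjugate of z. *)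
have K (a z : R[i]) : - (2 * Re (conjc z * z)) + normc (conjc z) ^+ 2 <=
    - (2 * Re (a * z)) + normc a ^+ 2.
  by have := Re_mul_le_sqr a z; rewrite normc_conj !Re_mul Re_conjc Im_conjc !normc_sqrE; lra.
by apply: ler_sum => nu _; exact: K.
Qed.

End bessel.
End parseval.

Lemma continuous_Re_Im {R : realType} {T : topologicalType} (g : T -> R[i]) :
  continuous (g : T -> R[i]^o) ->
  continuous (fun x => Re (g x)) /\ continuous (fun x => Im (g x)).
Proof.
(* The norm of [R[i]] has values in [R[i]], so the radius handed to the continuity of g is e
   regarded as [Complex e 0]. *)
move=> cg; split=> x; apply/cvgrPdist_lt => /= e e0; have := cg x;
  move=> /cvgrPdist_lt /(_ (Complex e 0)); rewrite ltcE /= eqxx e0 => /(_ isT);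
  apply: filterS => t; rewrite ltcE /= => /andP[_]; apply: le_lt_trans.
- by rewrite -Re_opp -Re_add; exact: normr_Re_le.
- by rewrite -Im_opp -Im_add; exact: normr_Im_le.
Qed.

Lemma continuous_complex {R : realType} {T : topologicalType} (g : T -> R[i]) :
  continuous (fun x => Re (g x)) -> continuous (fun x => Im (g x)) ->
  continuous (g : T -> R[i]^o).
Proof.
move=> cr ci x; apply/cvgrPdist_lt => /= e; rewrite ltcE /= => /andP[/eqP e1 e0].
have e20 : 0 < Re e / 2 by rewrite divr_gt0.
have := cr x => /cvgrPdist_lt /(_ _ e20) h1; have := ci x => /cvgrPdist_lt /(_ _ e20).
move: h1; apply: filterS2 => t h1 h2; rewrite ltcE /= e1 eqxx /=.
by apply: le_lt_trans (normc_le _) _; rewrite Re_add Im_add Re_opp Im_opp; lra.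
Qed.

Lemma periodic_continuous_bounded {R : realType} {n} (u : 'rV[R]_n -> R) : continuous u ->
  (forall k x, u (x + int_vec k) = u x) -> exists M : R, forall x, `|u x| <= M.
Proof.
move=> cu pu.
pose K : set 'rV[R]_n := [set x | forall i, `[- 2^-1, 2^-1]%classic (x ord0 i)].
have cK : compact K.
  by apply: (@rV_compact R n (fun=> `[- 2^-1, 2^-1]%classic)) => i; exact: segment_compact.
have [M [_ hM]] : bounded_set (u @` K).
  apply: compact_bounded; apply: continuous_compact => //; exact: continuous_subspaceT.
exists (M + 1) => x.
pose k : 'rV[int]_n := \row_i (- Num.floor (x ord0 i + 2^-1)).
rewrite -(pu k x); apply: (hM (M + 1)); first by rewrite ltrDl.
exists (x + int_vec k) => // i; rewrite /= in_itv/= !mxE intrN.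
have h1 := ge_floor (x ord0 i + 2^-1); have h2 := floorD1_gt (x ord0 i + 2^-1).
by rewrite intrD1 in h2; apply/andP; split; lra.
Qed.

Lemma int_norm_lt1 {R : realType} (k : int) : `|k%:~R : R| < 1 -> k = 0.
Proof.
by rewrite -intr_norm -[1]/(1%:~R) ltr_int -[1 in X in X -> _]add0r ltzD1 normr_le0 => /eqP.
Qed.

(** * The Wiener-Turan inequality *)

Section wiener_turan.
Context {R : realType} {n : nat}.
Variables (D : set 'rV[R]_n) (f g : 'rV[R]_n -> R[i]).
Hypotheses (mD : measurable D) (D_cube : D `<=` cube).
Hypotheses (intf : cintegrable cube f) (f_ge0 : forall nu, 0 <= fourier_coef f nu).
Hypothesis (f_fin : (sqr_integral D f < +oo)%E).
Hypotheses (g_plus : L1_plus g) (cg : continuous (g : 'rV[R]_n -> R[i]^o)).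
Hypotheses (g_supp : supp g `<=` translates D) (g01 : g 0 = 1).
Local Notation mu := (lebesgue_rV n).
Local Notation mcube := (@measurable_cube R n).
Local Notation N2 h := (\int[mu]_(x in cube) (normc (h x) ^+ 2)).
Local Notation L2 h := (mu.-integrable cube (EFin \o (fun x => normc (h x) ^+ 2))).
Local Notation char_sum s c := (fun x => \sum_(nu <- s) c nu * expN2pii (int_vec nu) x).

Let c0 := Re (fourier_coef g 0).

Let g_per : Defs.periodic g. Proof. by have [[]] := g_plus. Qed.

Let g_ge0 nu : 0 <= fourier_coef g nu. Proof. by have [] := g_plus. Qed.

Let c0_ge0 : 0 <= c0. Proof. by have /complex_ge0P[] := g_ge0 0. Qed.

Let cRe : continuous (fun x => Re (g x)). Proof. by have [] := continuous_Re_Im _ cg. Qed.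
Let cIm : continuous (fun x => Im (g x)). Proof. by have [] := continuous_Re_Im _ cg. Qed.

Let g_bounded : exists M : R, forall x, normc (g x) <= M.
Proof.
have [M1 h1] := periodic_continuous_bounded _ cRe (fun k x => congr1 Re (g_per k x)).
have [M2 h2] := periodic_continuous_bounded _ cIm (fun k x => congr1 Im (g_per k x)).
by exists (M1 + M2) => x; apply: le_trans (normc_le _) _; rewrite lerD.
Qed.

(** The support lies in the lattice translates of D, and two points of the half-open cube that
    differ by an integral vector coincide; hence inside the cube only D itself is met. *)
Lemma turan_vanish x : cube x -> ~ D x -> g x = 0.
Proof.
move=> cx nDx; apply: contrapT => /eqP gx0.
have /g_supp [d Dd [k xE]] : supp g x by exact: subset_closure.
suff k0 : k = 0 by apply: nDx; rewrite xE k0 int_vec0 addr0.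
apply/rowP => i; rewrite mxE.
have := D_cube _ Dd i; have := cx i; rewrite xE !mxE => /andP[h1 h2] /andP[h3 h4].
apply: (@int_norm_lt1 R); rewrite ltr_norml; apply/andP; split; lra.
Qed.

Lemma turan_Re_le1 x : Re (g x) <= 1.
Proof.
have [M hM] := g_bounded.
by have := pos_def_Re_le0 _ M cRe cIm g_per hM g_ge0 x; rewrite g01.
Qed.

Let mg A : cmeasurable_fun A g. Proof. exact: cmeasurable_continuous. Qed.

Let intfg : cintegrable cube (fun x => f x * g x).
Proof.
have [M hM] := g_bounded.
by apply: (@cintegrableMb _ _ _ _ _ M) => //; exact: mcube.
Qed.

Let coef_mul_ge nu : exists2 r, 0 <= r &
  fourier_coef (fun x => f x * g x) nu = fourier_coef f nu * Complex c0 0 + Complex r 0.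
Proof.
have [M hM] := g_bounded.
pose G x := g x + Complex (- c0) 0.
(* Multiplication by the character shifts the coefficients of f by nu, which keeps them nonnegative,
   and the integral of F G is the coefficient at nu of f G. *)
pose F x := f x * expN2pii (int_vec nu) x.
have intg : cintegrable cube g by apply: (cintegrable_cube M).
have icst : cintegrable cube (fun _ : 'rV[R]_n => Complex (- c0) 0).
  by apply: (cintegrable_cube (normc (Complex (- c0) 0))) => //; exact: cmeasurable_cst.
have g0E : fourier_coef g 0 = Complex c0 0.
  by have /complex_ge0P[_ h] := g_ge0 0; apply: complex_eqP.
have G0 k : 0 <= fourier_coef G k.
  rewrite /fourier_coef (@eq_cintegral _ _ _ _ (fun x => g x * expN2pii (int_vec k) x +
    Complex (- c0) 0 * expN2pii (int_vec k) x)); last by move=> x _; rewrite mulrDl.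
  have i1 := cintegrable_mul_char _ k intg; have i2 := @cintegrable_cube_char R _ k.
  rewrite (cintegralD _ _ _ mcube i1 (cintegrableZ _ _ _ mcube i2)).
  rewrite (cintegralZ _ _ _ mcube i2) cintegral_cube_char.
  rewrite -/(fourier_coef g k); have [->|_] := eqVneq k 0; last by rewrite mulr0 addr0.
  by rewrite mulr1 g0E; apply/complex_ge0P; rewrite Re_add Im_add /= subrr addr0.
have F0 k : 0 <= fourier_coef F k.
  rewrite /fourier_coef /F; under eq_cintegral => x _ do rewrite -mulrA -expN2piiDl -int_vecD.
  exact: f_ge0.
have iF : cintegrable cube F by exact: cintegrable_mul_char.
have pG : Defs.periodic G by move=> k x; rewrite /G g_per.
have bG x : normc (G x) <= M + normc (Complex (- c0) 0).
  apply: le_trans (_ : normc (g x) + normc (Complex (- c0) 0) <= _); last by rewrite lerD2r.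
  by have := ler_normD (g x) (Complex (- c0) 0); rewrite lecE => /andP[].
have cGr : continuous (fun x => Re (G x)).
  rewrite (_ : (fun _ => _) = fun x => 1 * (- c0 + Re (g x))); first exact: continuous_affine.
  by apply/funext => x; rewrite Re_add mul1r addrC.
have cGi : continuous (fun x => Im (G x)).
  rewrite (_ : (fun _ => _) = fun x => Im (g x)); first exact: cIm.
  by apply/funext => x; rewrite Im_add addr0.
have /complex_ge0P[r0 i0] := pos_def_pairing G _ cGr cGi pG bG G0 F iF F0.
exists (Re (cintegral cube (fun x => F x * G x))) => //.
have -> : Complex (Re (cintegral cube (fun x => F x * G x))) 0 = cintegral cube (fun x => F x * G x).
  exact: complex_eqP.
rewrite (@eq_cintegral _ _ _ (fun x => F x * G x) (fun x => f x * g x * expN2pii (int_vec nu) x +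
    Complex (- c0) 0 * F x)); last by move=> x _; rewrite /F /G; ring.
have i1 := cintegrable_mul_char _ nu intfg.
rewrite (cintegralD _ _ _ mcube i1 (cintegrableZ _ _ _ mcube iF)) (cintegralZ _ _ _ mcube iF).
rewrite -/(fourier_coef f nu) -/(fourier_coef _ nu).
have -> : Complex (- c0) 0 = - Complex c0 0 by apply: complex_eqP; rewrite ?Re_opp ?Im_opp /= ?oppr0.
by rewrite mulNr mulrC addrCA subrr addr0.
Qed.

Let mnf2 A : A `<=` cube -> measurable A -> measurable_fun A (fun x => normc (f x) ^+ 2).
Proof.
move=> Ac mA; apply: measurable_funX; apply: normc_measurable.
by have [mr mi] := cintegrable_meas _ _ intf; split; exact: measurable_funS mcube Ac _.
Qed.

Let nfD : 'rV[R]_n -> R := (fun x => normc (f x) ^+ 2) \_ D.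

Let inf_D : mu.-integrable D (EFin \o (fun x => normc (f x) ^+ 2)).
Proof.
apply/integrableP; split; first by apply/measurable_EFinP; exact: mnf2.
apply: le_lt_trans f_fin; rewrite le_eqVlt; apply/orP; left; apply/eqP.
by apply: eq_integral => x _; rewrite /= ger0_norm ?sqr_ge0.
Qed.

Let inf_nfD : mu.-integrable cube (EFin \o nfD).
Proof.
have := (integrable_mkcond _ mD).1 inf_D; rewrite restrict_EFin => h.
by apply: integrableS h => //; exact: mcube.
Qed.

Let sqr_integralD : sqr_integral D f = (\int[mu]_(x in cube) nfD x)%:E.
Proof.
rewrite /Rintegral fineK; last exact: (integrable_fin_num mcube inf_nfD).
rewrite /sqr_integral [LHS]integral_mkcond [RHS]integral_mkcond; apply: eq_integral => x _.
rewrite /nfD !patchE; case: ifPn => [/set_mem Dx|_]; last by case: ifP.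
by rewrite mem_set//; exact: D_cube.
Qed.

Let nfD_in x : D x -> nfD x = normc (f x) ^+ 2.
Proof. by move=> Dx; rewrite /nfD patchE mem_set. Qed.

Let nfD_out x : ~ D x -> nfD x = 0.
Proof. by move=> nDx; rewrite /nfD patchE memNset. Qed.

(** On the cube g vanishes off D and is bounded, so the square integrability of f on D suffices. *)
Let L2_fg : L2 (fun x => f x * g x).
Proof.
have [M hM] := g_bounded.
apply: (le_integrable mcube _ _ (integrableZl mcube (M ^+ 2) inf_nfD)) => [|x cx].
  apply/measurable_EFinP; apply: measurable_funX; apply: normc_measurable.
  exact: cintegrable_meas intfg.
rewrite /= lee_fin ger0_norm ?sqr_ge0// Normc.normcM exprMn.
have [Dx|nDx] := pselect (D x); last first.
  by rewrite (turan_vanish _ cx nDx) Normc.normc0 expr0n mulr0.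
rewrite nfD_in//; apply: le_trans _ (ler_norm _).
rewrite mulrC; apply: ler_wpM2r; first exact: sqr_ge0.
by rewrite lerXn2r ?nnegrE ?normc_ge0//; apply: le_trans (hM x); exact: normc_ge0.
Qed.

Let coef_real nu : exists2 a, 0 <= a & fourier_coef f nu = Complex a 0.
Proof.
by have /complex_ge0P[h1 h2] := f_ge0 nu; exists (Re (fourier_coef f nu)) => //; exact: complex_eqP.
Qed.

Let bessel_bound s : 0 < c0 -> uniq s ->
  \sum_(nu <- s) normc (fourier_coef f nu) ^+ 2 <= N2 (fun x => f x * g x) / c0 ^+ 2.
Proof.
move=> c00 us; rewrite ler_pdivlMr ?exprn_gt0//.
(* The sum subtracted uses c0 times the coefficients of f, not those of f g. Since the coefficients
   of f g exceed these by r >= 0, the cross term is at least twice the quadratic one, and one copy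
   of c0^2 |hat f|^2 is left. *)
have := N2_ge0 (fun x => f x * g x -
  conjc (char_sum s (fun nu => Complex c0 0 * fourier_coef f nu) x)).
rewrite N2_sub_char_sum// mulr_suml => H.
rewrite -subr_ge0; apply: le_trans H _.
rewrite -addrA lerD2l mulr_sumr -!sumrN -big_split; apply: ler_sum => nu _.
have [a a0 fE] := coef_real nu; have [r r0 E] := coef_mul_ge nu.
rewrite E fE !normc_sqrE !(Re_mul, Im_mul, Re_add, Im_add) /=.
have h : 0 <= c0 * a * r by rewrite !mulr_ge0.
lra.
Qed.

Lemma turan_L2 : 0 < c0 -> L2 f.
Proof. by move=> c00; apply: bessel_L2 => // s; exact: bessel_bound. Qed.

Let Re_mul_ge (a b : R[i]) (t : R) : 0 < t ->
  - Re (a * b) <= t * normc a ^+ 2 + t^-1 * normc b ^+ 2.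
Proof.
move=> t0.
have H (p u : R) : - (p * u) <= t * p ^+ 2 + t^-1 * u ^+ 2 /\ p * u <= t * p ^+ 2 + t^-1 * u ^+ 2.
  split; rewrite -subr_ge0.
    rewrite (_ : _ - _ = t^-1 * ((t * p + u / 2) ^+ 2 + 3 / 4 * u ^+ 2)); last by field; rewrite gt_eqF.
    apply: mulr_ge0; first by rewrite invr_ge0 ltW.
    by have := sqr_ge0 (t * p + u / 2); have := sqr_ge0 u; lra.
  rewrite (_ : _ - _ = t^-1 * ((t * p - u / 2) ^+ 2 + 3 / 4 * u ^+ 2)); last by field; rewrite gt_eqF.
  apply: mulr_ge0; first by rewrite invr_ge0 ltW.
  by have := sqr_ge0 (t * p - u / 2); have := sqr_ge0 u; lra.
rewrite Re_mul !normc_sqrE.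
by have [h1 _] := H (Re a) (Re b); have [_ h2] := H (Im a) (Im b); lra.
Qed.

(** Formally, the integral of f (g - c0) against the conjugate of f is the sum of the products of
    hat f with the nonnegative excess of hat (f g) over c0 hat f. The conjugate is replaced by a
    partial sum S, for which this is a finite sum, and [M'], a bound for |g - c0|, controls the
    error through Young's inequality. *)
Lemma wiener_turan_L2 : 0 < c0 -> c0 * N2 f <= \int[mu]_(x in cube) nfD x.
Proof.
move=> c00; have Lf := turan_L2 c00; have [M hM] := g_bounded.
pose M' := M + c0.
have iX : mu.-integrable cube (EFin \o (fun x => normc (f x) ^+ 2 * Re (g x))).
  apply: (le_integrable mcube _ _ (integrableZl mcube M Lf)) => [|x cx].
    apply/measurable_EFinP; apply: measurable_funM; last by have [] := mg cube.
    exact: mnf2 _ mcube.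
  rewrite /= lee_fin normrM ger0_norm ?sqr_ge0// mulrC; apply: le_trans _ (ler_norm _).
  apply: ler_wpM2r; first exact: sqr_ge0.
  exact: le_trans (normr_Re_le _) (hM x).
apply: (@le_trans _ _ (\int[mu]_(x in cube) (normc (f x) ^+ 2 * Re (g x)))); last first.
  apply: (le_Rintegral mcube iX inf_nfD) => x cx.
  have [Dx|nDx] := pselect (D x); last by rewrite (turan_vanish _ cx nDx) mulr0 nfD_out.
  by rewrite nfD_in// -[leRHS]mulr1 ler_wpM2l ?sqr_ge0 ?turan_Re_le1.
apply: (@ler_linear_eps _ _ _ (M' ^+ 2 * N2 f + 1)) => t /andP[t0 t1].
have [s us hs] := partial_sum_dense _ intf (t ^+ 2) Lf ltac:(by rewrite exprn_gt0).
set S := char_sum s (fun nu => conjc (fourier_coef f nu)) in hs.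
pose l := [seq (conjc (fourier_coef f nu), nu) | nu <- s].
have SE x : S x = trig_poly l x by rewrite /S char_sumE.
have iS1 := integrable_Re_trig_poly _ l intf.
have iS2 := integrable_Re_trig_poly _ l intfg.
have id : L2 (fun x => f x - conjc (S x)).
  have [B hB] := trig_poly_bounded (R := R) l.
  have iP := L2_trig_poly l.
  have [i1 _] := Rintegral_lin _ _ 2 2 Lf iP.
  apply: (le_integrable mcube _ _ i1) => [|x cx].
    apply/measurable_EFinP; apply: measurable_funX; apply: normc_measurable.
    apply: cmeasurableD; first exact: cintegrable_meas intf.
    apply: cmeasurableN; apply: cmeasurable_conj.
    by rewrite (_ : S = trig_poly l); [exact: cmeasurable_trig_poly|apply/funext => x; rewrite SE].
  rewrite /= lee_fin ger0_norm ?sqr_ge0//; apply: le_trans _ (ler_norm _).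
  rewrite SE !normc_sqrE !(Re_add, Im_add, Re_opp, Im_opp, Re_conjc, Im_conjc).
  have := sqr_ge0 (Re (f x) + Re (trig_poly l x)).
  have := sqr_ge0 (Im (f x) - Im (trig_poly l x)); lra.
(* Both sides are finite sums over s, and their terms differ by a r with a the coefficient of f and
   r the excess from [coef_mul_ge]. *)
have hS : c0 * \int[mu]_(x in cube) Re (f x * trig_poly l x) <=
    \int[mu]_(x in cube) Re (f x * g x * trig_poly l x).
  rewrite -!Re_cintegral !cintegral_mul_trig_poly// !big_map !Re_sum mulr_sumr.
  have K nu : c0 * Re (conjc (fourier_coef f nu) * fourier_coef f nu) <=
      Re (conjc (fourier_coef f nu) * fourier_coef (fun x => f x * g x) nu).
    have [a a0 fE] := coef_real nu; have [r r0 E] := coef_mul_ge nu.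
    rewrite E fE !(Re_mul, Im_mul, Re_add, Im_add) /=.
    have h : 0 <= a * r by rewrite mulr_ge0.
    lra.
  by apply: ler_sum => nu _; exact: K.
have [i1 E1] := Rintegral_lin _ _ c0 1 Lf iS2.
have [i2 E2] := Rintegral_lin _ _ 1 c0 iX iS1.
have [i3 E3] := Rintegral_lin _ _ (t * M' ^+ 2) t^-1 Lf id.
have [i4 E4] := Rintegral_lin _ _ 1 1 i2 i3.
have pt x : cube x -> c0 * normc (f x) ^+ 2 + 1 * Re (f x * g x * trig_poly l x) <=
    1 * (1 * (normc (f x) ^+ 2 * Re (g x)) + c0 * Re (f x * trig_poly l x)) +
    1 * (t * M' ^+ 2 * normc (f x) ^+ 2 + t^-1 * normc (f x - conjc (S x)) ^+ 2).
  move=> _; set z := f x.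
  pose G := g x + Complex (- c0) 0.
  pose b := conjc z - S x.
  have h1 : normc (z * G) ^+ 2 <= M' ^+ 2 * normc z ^+ 2.
    rewrite Normc.normcM exprMn mulrC; apply: ler_wpM2r; first exact: sqr_ge0.
    have GM : normc G <= M'.
      apply: le_trans (_ : normc (g x) + normc (Complex (- c0) 0) <= _).
        by have := ler_normD (g x) (Complex (- c0) 0); rewrite lecE => /andP[].
      by rewrite lerD// /= expr0n/= addr0 sqrtr_sqr normrN ger0_norm.
    by rewrite lerXn2r ?nnegrE ?normc_ge0//; apply: le_trans GM; exact: normc_ge0.
  have h2 : normc (z - conjc (S x)) ^+ 2 = normc b ^+ 2.
    by rewrite !normc_sqrE !(Re_add, Im_add, Re_opp, Im_opp, Re_conjc, Im_conjc); ring.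
  have h3 := Re_mul_ge (z * G) b t t0.
  have h4 : Re (z * G * b) = normc z ^+ 2 * Re (g x) - c0 * normc z ^+ 2 -
      Re (z * g x * trig_poly l x) + c0 * Re (z * trig_poly l x).
    rewrite /b SE /G.
    by rewrite !normc_sqrE !(Re_mul, Im_mul, Re_add, Im_add, Re_opp, Im_opp, Re_conjc, Im_conjc) /=; ring.
  have h5 := ler_wpM2l (ltW t0) h1.
  by rewrite h2; move: h3 h4 h5; lra.
have := le_Rintegral mcube i1 i4 pt; rewrite E4 E1 E2 E3 => H.
have hs' : t^-1 * N2 (fun x => f x - conjc (S x)) <= t.
  by rewrite mulrC ler_pdivrMr// -expr2.
move: H hS hs'; lra.
Qed.

Lemma wiener_turan_le :
  ((Re (fourier_coef g 0))%:E * sqr_integral cube f <= sqr_integral D f)%E.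
Proof.
rewrite -/c0; have [c00|] := ltP 0 c0; last first.
  (* In this case the square integral over the cube may be infinite; the convention that 0 times +oo
     is 0 makes the left side vanish. *)
  move=> c00; have -> : c0 = 0 by apply/eqP; rewrite eq_le c00 c0_ge0.
  by rewrite mul0e; apply: integral_ge0 => x _; rewrite lee_fin sqr_ge0.
have Lf := turan_L2 c00.
rewrite sqr_integralD /sqr_integral -[X in (_ * X <= _)%E]fineK; last exact: (integrable_fin_num mcube Lf).
by rewrite -EFinM lee_fin; exact: wiener_turan_L2.
Qed.

End wiener_turan.

Lemma turan_coef_le1 {R : realType} {n : nat} (g : 'rV[R]_n -> R[i]) :
  L1_plus g -> continuous (g : 'rV[R]_n -> R[i]^o) -> g 0 = 1 -> Re (fourier_coef g 0) <= 1.
Proof.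
move=> g_plus cg g01; have [[_ ig] _] := g_plus.
have i1 : (lebesgue_rV n).-integrable cube (EFin \o (fun _ : 'rV[R]_n => 1 : R)).
  by apply: (integrable_cube 1) => [|x _]; [exact: measurable_cst|rewrite normr1].
have [ir _] := (cintegrableP _ _ measurable_cube).1 (cintegrable_mul_char _ 0 ig).
rewrite /fourier_coef Re_cintegral.
have E1 : \int[lebesgue_rV n]_(x in cube) (1 : R) = 1.
  by have /(congr1 (@complex.Re R)) := cintegral_cube_cst (n := n) (Complex (1 : R) 0).
rewrite -[leRHS]E1; apply: (le_Rintegral measurable_cube ir i1) => x _.
by rewrite int_vec0 expN2pii0l mulr1; exact: turan_Re_le1.
Qed.

(** * Periodization *)

(** D misses the faces x_i = 1/2 because the cube is half-open, and the opposite faces by symmetry.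
    The sup norm attains its maximum on the compact D, hence below 1/2; half the gap is a margin. *)
Lemma body_margin {R : realType} {n} (D : set 'rV[R]_n) : compact D -> D `<=` cube ->
  (forall x, D x -> D (- x)) ->
  exists2 e : R, 0 < e & forall x, D x -> forall i, `|x ord0 i| + e < 2^-1.
Proof.
move=> cD Dc sD; have [->|/set0P D0] := eqVneq D set0; first by exists 1.
have cn : {within D, continuous (fun x : 'rV[R]_n => `|x|)}.
  by apply: continuous_subspaceT; exact: norm_continuous.
have [c /set_mem Dcc cmax] := compact_EVT_max D0 cD cn.
have nb (r : R) (x : 'rV[R]_n) : 0 < r -> (`|x| < r) <-> (forall i, `|x ord0 i| < r).
  move=> r0; have := rV_ballE r0 (c := 0) (x := x).
  rewrite -ball_normE /ball_ /= sub0r normrN => ->.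
  by split=> h i; have := h i; rewrite mxE sub0r normrN.
have c12 : `|c| < 2^-1.
  apply/nb => // i; rewrite ltr_norml.
  have /(_ i)/andP[_ ->] := Dc _ Dcc; have /(_ i)/andP[_] := Dc _ (sD _ Dcc).
  by rewrite mxE andbT => h; lra.
exists ((2^-1 - `|c|) / 2) => [|x Dx i]; first by lra.
have h := cmax x (mem_set Dx).
have /nb : `|x| < `|c| + (2^-1 - `|c|) / 2 by apply: le_lt_trans h _; lra.
have c0 := normr_ge0 c.
by move=> /(_ _)/(_ i) => /(_ ltac:(lra)) => h2; lra.
Qed.

Section periodization.
Context {R : realType} {n : nat}.
Implicit Types (x y : 'rV[R]_n) (k : 'rV[int]_n).

Definition round x : 'rV[int]_n := \row_i Num.floor (x ord0 i + 2^-1).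

Lemma round_cube x : cube (x - int_vec (round x)).
Proof.
move=> i; rewrite !mxE.
have h1 := ge_floor (x ord0 i + 2^-1); have h2 := floorD1_gt (x ord0 i + 2^-1).
by rewrite intrD1 in h2; apply/andP; split; lra.
Qed.

Lemma round_uniq x k : cube (x - int_vec k) -> round x = k.
Proof.
move=> h; have h2 := round_cube x; apply/rowP => i; apply/eqP; rewrite -subr_eq0; apply/eqP.
apply: (@int_norm_lt1 R); move: (h i) (h2 i); rewrite !mxE intrB ltr_norml.
by move=> /andP[? ?] /andP[? ?]; apply/andP; split; lra.
Qed.

Lemma round_id x : cube x -> round x = 0.
Proof. by move=> cx; apply: round_uniq; rewrite int_vec0 subr0. Qed.

Lemma roundD x k : round (x + int_vec k) = round x + k.
Proof.
apply: round_uniq; rewrite int_vecD; have := round_cube x; congr cube.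
by rewrite opprD [- _ - _]addrC addrA addrK.
Qed.

(** For h vanishing off the cube this is the usual sum of h over all lattice translates, of which
    only the one that brings x into the cube can be nonzero. *)
Definition periodization (h : 'rV[R]_n -> R[i]) x : R[i] := h (x - int_vec (round x)).

End periodization.

Lemma continuous_subl {R : realType} (V : normedModType R) (a : V) :
  continuous (fun y : V => y - a).
Proof. by move=> y; apply: cvgB; [exact: cvg_id|exact: cvg_cst]. Qed.

Section periodization_turan.
Context {R : realType} {n : nat}.
Variables (D : set 'rV[R]_n) (h : 'rV[R]_n -> R[i]).
Hypotheses (cD : compact D) (D_cube : D `<=` cube) (D_sym : forall x, D x -> D (- x)).
Hypotheses (ch : continuous (h : 'rV[R]_n -> R[i]^o)) (h_supp : supp h `<=` D).
Local Notation mu := (lebesgue_rV n).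

Let h_out x : ~ D x -> h x = 0.
Proof.
move=> nDx; apply/eqP/negPn/negP => hx; apply: nDx; apply: h_supp.
exact: subset_closure.
Qed.

Lemma periodization_cube x : cube x -> periodization h x = h x.
Proof. by move=> cx; rewrite /periodization round_id// int_vec0 subr0. Qed.

Lemma periodic_periodization : Defs.periodic (periodization h).
Proof.
by move=> k x; rewrite /periodization roundD int_vecD opprD addrACA subrr addr0.
Qed.

(** [round] jumps at the boundary of the cube, but near y the vector [round y] may be used
    throughout. If z - [round y] is not in D, then neither is z - [round z]: the margin e would
    otherwise put y - [round z] in the cube and force the two roundings to agree. So both values of
    h are 0. *)
Lemma periodization_near : exists2 e : R, 0 < e & forall y z, ball y e z ->
  periodization h z = h (z - int_vec (round y)).
Proof.
have [e e0 he] := body_margin _ cD D_cube D_sym; exists e => // y z /(rV_ballE e0) yz.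
rewrite /periodization; have [Dw|nDw] := pselect (D (z - int_vec (round y))).
  by rewrite (round_uniq z (round y))//; exact: D_cube.
rewrite (h_out _ nDw) h_out// => Dw; apply: nDw; rewrite (_ : round y = round z)//.
apply: round_uniq => i; have := he _ Dw i; have := yz i.
rewrite !mxE => h1 h2; apply/andP.
have : `|y ord0 i - (round z ord0 i)%:~R| < 2^-1.
  rewrite (_ : _ - _ = (y ord0 i - z ord0 i) + (z ord0 i - (round z ord0 i)%:~R)); last by ring.
  apply: le_lt_trans (ler_normD _ _) _; rewrite mxE; apply: lt_trans _ h2.
  by rewrite [ltLHS]addrC ltrD2l.
by rewrite mxE ltr_norml => /andP[? ?]; split=> //; exact: ltW.
Qed.

Lemma continuous_periodization : continuous (periodization h : 'rV[R]_n -> R[i]^o).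
Proof.
move=> y; have [e e0 he] := periodization_near.
have K : continuous_at y ((h : 'rV[R]_n -> R[i]^o) \o (fun z => z - int_vec (round y))).
  by apply: continuous_comp; [exact: continuous_subl|exact: ch].
move=> A /K; apply: filterS2 (nbhsx_ballx y _ e0) => z /he yz /=.
by rewrite yz.
Qed.

Lemma supp_periodization : supp (periodization h) `<=` translates D.
Proof.
move=> z zs; have [e e0 he] := periodization_near.
exists (z - int_vec (round z)); last by exists (round z); rewrite subrK.
have clD : closed ((fun y => y - int_vec (round z)) @^-1` D).
  apply: closed_comp; first by move=> y _; exact: continuous_subl.
  by apply: compact_closed => //; exact: norm_hausdorff.
apply: clD => B Bz; have := nbhsx_ballx z _ e0.
move=> /(filterI Bz) /zs[z' [/= nz [Bz' ez']]]; exists z'; split => //=.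
apply/not_notP => nD; move: nz; rewrite (he z)//.
by rewrite h_out// eqxx.
Qed.

Lemma cintegral_setT_cube (F : 'rV[R]_n -> R[i]) : (forall x, ~ D x -> F x = 0) ->
  cintegral setT F = cintegral cube F.
Proof.
move=> F0; congr Complex; rewrite [RHS]Rintegral_mkcond; apply: eq_Rintegral => x _.
  by rewrite patchE; case: ifPn => // /negP nc; rewrite F0// => /D_cube/mem_set.
by rewrite patchE; case: ifPn => // /negP nc; rewrite F0// => /D_cube/mem_set.
Qed.

Lemma fourier_coef_periodization nu :
  fourier_coef (periodization h) nu = fourier h (int_vec nu).
Proof.
rewrite /fourier /fourier_coef cintegral_setT_cube => [|x nD]; last by rewrite h_out// mul0r.
by congr Complex; apply: eq_Rintegral => x /set_mem cx; rewrite periodization_cube.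
Qed.

End periodization_turan.

Lemma turan_space_le_torus {R : realType} {n : nat} (D : set 'rV[R]_n) :
  compact D -> D `<=` cube -> (forall x, D x -> D (- x)) -> (turan_space D <= turan_torus D)%E.
Proof.
move=> cD Dc sD; apply: ereal_sup_le => _ [h [[ih h0] ch sh h01] <-].
have per := periodic_periodization h; have cg := continuous_periodization _ _ cD Dc sD ch sh.
exists (periodization h).
  split; [split; [split=> //|move=> nu]|exact: cg|exact: supp_periodization|].
  - have [cr ci] := continuous_Re_Im _ cg.
    have [M1 h1] := periodic_continuous_bounded _ cr (fun k x => congr1 Re (per k x)).
    have [M2 h2] := periodic_continuous_bounded _ ci (fun k x => congr1 Im (per k x)).
    apply: (@cintegrable_continuous _ _ _ (M1 + M2)) => // x.
    by apply: le_trans (normc_le _) _; rewrite lerD.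
  - by rewrite (fourier_coef_periodization D).
  - rewrite periodization_cube// => i; rewrite mxE; apply/andP; split; lra.
by rewrite (fourier_coef_periodization D)// int_vec0.
Qed.

(** * Autocorrelation of a symmetric compact set *)

Lemma measurable_rV_addp {R : realType} {n} :
  measurable_fun setT (fun p : 'rV[R]_n * 'rV[R]_n => p.1 + p.2).
Proof.
apply: measurable_fun_rVP => i.
rewrite (_ : (fun _ => _) = (fun p : 'rV[R]_n * 'rV[R]_n => p.1 ord0 i + p.2 ord0 i)).
  by apply: measurable_funD; [exact: (measurableT_comp (@measurable_rV_coord _ R n i) measurable_fst)|
    exact: (measurableT_comp (@measurable_rV_coord _ R n i) measurable_snd)].
by apply/funext => p; rewrite mxE.
Qed.

Lemma measurable_rV_subp {R : realType} {n} :
  measurable_fun setT (fun p : 'rV[R]_n * 'rV[R]_n => p.1 - p.2).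
Proof.
apply: measurable_fun_rVP => i.
rewrite (_ : (fun _ => _) = (fun p : 'rV[R]_n * 'rV[R]_n => p.1 ord0 i - p.2 ord0 i)).
  by apply: measurable_funB; [exact: (measurableT_comp (@measurable_rV_coord _ R n i) measurable_fst)|
    exact: (measurableT_comp (@measurable_rV_coord _ R n i) measurable_snd)].
by apply/funext => p; rewrite !mxE.
Qed.

Lemma measurable_rV_subr {R : realType} {n} (x : 'rV[R]_n) :
  measurable_fun setT (fun y : 'rV[R]_n => x - y).
Proof.
apply: (@measurableT_comp _ _ _ _ _ _ _ _ (fun y => (x, y)) measurable_rV_subp).
by apply/measurable_fun_pair.
Qed.

Section autocorrelation.
Context {R : realType} {n : nat}.
Variable A : set 'rV[R]_n.
Hypotheses (cA : compact A) (A_sym : forall x, A x -> A (- x)).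
Hypothesis A_quarter : forall x, A x -> forall i, `|x ord0 i| <= 4^-1.
Hypothesis A_gt0 : (0 < lebesgue_rV n A)%E.
Local Notation mu := (lebesgue_rV n).

Lemma measurable_reflect (B : set 'rV[R]_n) x : measurable B -> measurable [set y | B (x - y)].
Proof.
move=> mB; rewrite -[X in measurable X]setTI; exact: measurable_rV_subr.
Qed.

Let mu_indic (B : set 'rV[R]_n) : measurable B -> mu B = (\int[mu]_y (\1_B y)%:E)%E.
Proof. by move=> mB; rewrite integral_indic// setIT. Qed.

Lemma lebesgue_rV_reflect (B : set 'rV[R]_n) x : measurable B ->
  mu [set y | B (x - y)] = mu B.
Proof.
move=> mB; have mB' := measurable_reflect _ x mB.
rewrite !mu_indic//.
rewrite -[RHS]ge0_integral_rV_opp; [|exact/measurable_EFinP/measurable_indic|by move=> t; rewrite lee_fin].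
rewrite -[RHS](ge0_integral_rV_shift (- x)) /=.
- apply: eq_integral => y _; rewrite opprD opprK addrC !indicE.
  by congr (_%:R)%:E; congr nat_of_bool; apply/idP/idP => /set_mem h; apply/mem_set.
- apply/measurable_EFinP; apply: (measurableT_comp (measurable_indic mB)).
  exact: measurable_rV_opp.
- by move=> y; rewrite lee_fin.
Qed.

Let mA : measurable A.
Proof. by apply: closed_measurable_rV; apply: compact_closed => //; exact: norm_hausdorff. Qed.

(** The e-neighbourhood of A. Continuity of the autocorrelation comes from the measure of [thick e]
    minus A, a modulus of continuity independent of the point. *)
Let thick (e : R) : set 'rV[R]_n := \bigcup_(a in A) ball a e.

Let measurable_thick (e : R) : 0 < e -> measurable (thick e).
Proof.
by move=> e0; apply: open_measurable_rV; apply: bigcup_open => a _; exact: ball_open.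
Qed.

Let sub_cube (e : R) : 0 < e <= 4^-1 -> thick e `<=` cube.
Proof.
move=> /andP[e0 e4] y [a Aa /(rV_ballE e0) ay] i.
move: (A_quarter _ Aa i) (ay i); rewrite ler_norml ltr_norml => /andP[? ?] /andP[? ?].
by apply/andP; split; lra.
Qed.

(** A closed set is the intersection of its neighbourhoods, and measures are continuous from above.
    The radii are at most 1/4 so that the neighbourhoods stay in the cube and have finite
    measure. *)
Let thick_cvg : mu (thick ((4 * k.+1%:R)^-1)) @[k --> \oo] --> mu A.
Proof.
have e0 (k : nat) : 0 < (4 * k.+1%:R)^-1 :> R by rewrite invr_gt0 mulr_gt0.
have e4 (k : nat) : (4 * k.+1%:R)^-1 <= 4^-1 :> R.
  by rewrite lef_pV2 ?posrE ?mulr_gt0// ler_peMr// ler1n.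
have -> : A = \bigcap_k thick ((4 * k.+1%:R)^-1).
  apply/seteqP; split=> [x Ax k _|x hx]; first by exists x => //; exact: ballxx.
  have clA : closed A by apply: compact_closed => //; exact: norm_hausdorff.
  apply: clA => B /nbhs_ballP[e /= e_gt0 eB].
  have [k hk] : exists k : nat, (4 * k.+1%:R)^-1 < e.
    exists (Num.truncn e^-1); rewrite invf_plt ?posrE ?mulr_gt0//.
    apply: (lt_le_trans (truncnS_gt _)); rewrite ler_peMl// ler1n//.
  have [a Aa ax] := hx k I; exists a; split=> //; apply: eB.
  by apply: le_ball (ltW hk) _ _; exact: ball_sym.
apply: (@nonincreasing_cvg_mu _ _ _ mu (fun k => thick ((4 * k.+1%:R)^-1))).
- apply: le_lt_trans (@lebesgue_cube_lty R n); apply: le_measure; rewrite ?inE//.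
  - exact: measurable_thick (e0 0).
  - exact: measurable_cube.
  - by apply: (sub_cube (4 * 1%:R)^-1); rewrite (e0 0) (e4 0).
- by move=> k; exact: measurable_thick.
- by apply: bigcapT_measurable => k; exact: measurable_thick.
- move=> k l kl; apply/subsetPset => x [a Aa ax]; exists a => //.
  apply: le_ball ax; rewrite lef_pV2 ?posrE ?mulr_gt0// ler_pM2l//.
  by rewrite ler_nat.
Qed.

(** The convolution of the indicator of A with itself, which is its autocorrelation because A is
    symmetric. *)
Definition autocorr x : R := fine (mu (A `&` [set y | A (x - y)])).

Let mAr x : measurable [set y | A (x - y)].
Proof. exact: measurable_reflect. Qed.

Let mAA x : measurable (A `&` [set y | A (x - y)]).
Proof. exact: measurableI. Qed.

Let A_cube : A `<=` cube.
Proof.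
move=> x /A_quarter h i; have := h i; rewrite ler_norml => /andP[? ?].
by apply/andP; split; lra.
Qed.

Let fin_sub (B : set 'rV[R]_n) : measurable B -> B `<=` cube -> mu B \is a fin_num.
Proof.
move=> mB sB; rewrite ge0_fin_numE//; apply: le_lt_trans (@lebesgue_cube_lty R n).
by apply: le_measure; rewrite ?inE//; exact: measurable_cube.
Qed.

Let finA : mu A \is a fin_num. Proof. exact: fin_sub. Qed.

Let autocorrE x : (autocorr x)%:E = mu (A `&` [set y | A (x - y)]).
Proof. by rewrite fineK// fin_sub// => y [/A_cube]. Qed.

Let autocorr_ge0 x : 0 <= autocorr x. Proof. exact: fine_ge0. Qed.

Lemma autocorr0 : autocorr 0 = fine (mu A).
Proof.
rewrite /autocorr; congr (fine (mu _)); apply/seteqP; split=> [y []//|y Ay].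
by split=> //=; rewrite sub0r; exact: A_sym.
Qed.

(** A point y counted for x' but not for x has x' - y in A and x - y outside A, hence x - y in
    [thick e] minus A; reflection preserves the measure of that set. *)
Let autocorr_le (e : R) x x' : 0 < e <= 4^-1 -> ball x e x' ->
  autocorr x' <= autocorr x + (fine (mu (thick e)) - fine (mu A)).
Proof.
move=> e04; have /andP[e0 e4] := e04 => xx'.
have mT := measurable_thick _ e0.
have finT := fin_sub _ mT (sub_cube _ e04).
have AT : A `<=` thick e by move=> a Aa; exists a => //; exact: ballxx.
have mTA : measurable (thick e `\` A) by exact: measurableD.
have muTA : (mu (thick e) - mu A)%E = mu (thick e `\` A).
  rewrite (measureD mT mA) -?ge0_fin_numE// setIC.
  by congr (_ - mu _)%E; apply/esym/setIidPl.
rewrite -lee_fin EFinD EFinB (autocorrE x') (autocorrE x) (fineK finT) (fineK finA) muTA.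
rewrite -(lebesgue_rV_reflect _ x mTA).
apply: le_trans (measureU2 mu (mAA x) (measurable_reflect _ x mTA)).
apply: le_measure; rewrite ?inE//; first by apply: measurableU => //; exact: measurable_reflect.
move=> y /= [Ay Ax'y]; have [Axy|nAxy] := pselect (A (x - y)); [by left|right; split=> //].
exists (x' - y) => //; apply/(rV_ballE e0) => i; move/(rV_ballE e0) : xx' => /(_ i).
by rewrite !mxE distrC opprD addrACA subrr addr0.
Qed.

Lemma continuous_near_le (T : topologicalType) (f : T -> R) :
  (forall x (e : R), 0 < e -> \forall y \near x, `|f x - f y| <= e) -> continuous f.
Proof. by move=> hf x; apply/cvgrPdist_le => /= e e0; exact: hf. Qed.

Lemma continuous_autocorr : continuous autocorr.
Proof.
apply: continuous_near_le => x e e0.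
have := thick_cvg; rewrite -(fineK finA) => /fine_cvgP[_ /cvgrPdist_le/(_ _ e0)[k _ /(_ k (leqnn k))]].
rewrite /=; set d := (4 * _)^-1 => hk.
have d0 : 0 < d <= 4^-1.
  by rewrite invr_gt0 mulr_gt0//= lef_pV2 ?posrE ?mulr_gt0// ler_peMr// ler1n.
have := nbhsx_ballx x d; have /andP[d1 _] := d0 => /(_ d1); apply: filterS => y xy.
have h1 := autocorr_le _ _ _ d0 xy; have h2 := autocorr_le _ _ _ d0 (ball_sym xy).
move: hk; rewrite !ler_norml => /andP[? ?]; apply/andP; split; lra.
Qed.

Lemma autocorr_neq0 x : autocorr x != 0 -> exists y z, [/\ A y, A z & x = y + z].
Proof.
move=> h; have /set0P[y [Ay Axy]] : A `&` [set y | A (x - y)] != set0.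
  by apply: contra_neq h; rewrite /autocorr => ->; rewrite measure0.
by exists y, (x - y); split=> //; rewrite addrC subrK.
Qed.

(** Write the autocorrelation as an integral of indicators, exchange the integrals by Tonelli and
    translate the variable x by y. *)
Lemma ge0_integral_autocorr (c : 'rV[R]_n -> \bar R) : measurable_fun setT c ->
  (forall x, (0 <= c x)%E) ->
  (\int[mu]_x ((autocorr x)%:E * c x) = \int[mu]_(y in A) \int[mu]_(x in A) c (x + y)%R)%E.
Proof.
move=> mc c0.
have mI : measurable_fun setT (fun x : 'rV[R]_n => ((\1_A x : R)%:E)).
  by apply/measurable_EFinP; exact: measurable_indic.
have I0 x : (0 <= (\1_A x)%:E :> \bar R)%E by rewrite lee_fin.
have mT (p : 'rV[R]_n -> \bar R) (y : 'rV[R]_n) : measurable_fun setT p ->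
    measurable_fun setT (fun x : 'rV[R]_n => p (x + y)%R).
  move=> mp; apply: (measurableT_comp mp).
  apply: (@measurableT_comp _ _ _ _ _ _ _ _ (fun x => (x, y)) measurable_rV_addp).
  by apply/measurable_fun_pair.
transitivity (\int[mu]_x \int[mu]_y ((\1_A y)%:E * (\1_A (x - y)%R)%:E * c x))%E.
  apply: eq_integral => x _; rewrite autocorrE mu_indic//.
  rewrite -ge0_integralZr//.
  - by apply: eq_integral => y _; rewrite indicI -EFinM.
  - by apply/measurable_EFinP; exact: measurable_indic.
rewrite (fubini_tonelli (fun p : 'rV[R]_n * 'rV[R]_n => ((\1_A p.2)%:E * (\1_A (p.1 - p.2)%R)%:E * c p.1)%E)) /=; last 2 first.
- apply: emeasurable_funM; last exact: (measurableT_comp mc measurable_fst).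
  apply: emeasurable_funM; first exact: (measurableT_comp mI measurable_snd).
  exact: (measurableT_comp mI measurable_rV_subp).
- by move=> p; rewrite mule_ge0// mule_ge0.
rewrite [RHS]integral_mkcond; apply: eq_integral => y _; rewrite patchE.
under eq_integral do rewrite -muleA.
rewrite ge0_integralZl//; last 2 first.
- apply: emeasurable_funM => //; apply: (mT (fun x => (\1_A x)%:E)) => //.
- by move=> x _; rewrite mule_ge0.
rewrite -(ge0_integral_rV_shift y); last 2 first.
- apply: emeasurable_funM => //; apply: (mT (fun x => (\1_A x)%:E)) => //.
- by move=> x; rewrite mule_ge0.
rewrite indicE; case: (y \in A); rewrite ?mul0e// mul1e.
rewrite [RHS]integral_mkcond; apply: eq_integral => x _; rewrite patchE addrK indicE.
by case: (x \in A); rewrite ?mul0e ?mul1e.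
Qed.

Lemma Rintegral_rV_odd (f : 'rV[R]_n -> R) : measurable_fun setT f ->
  (forall x, f (- x) = - f x) -> \int[mu]_x f x = 0.
Proof.
move=> mf fN; rewrite /Rintegral integralE.
rewrite [X in (_ - X)%E](_ : _ = (\int[mu]_x (EFin \o f)^\+ x)%E); last first.
  rewrite -ge0_integral_rV_opp; last 2 first.
  - by apply: measurable_funepos; exact/measurable_EFinP.
  - by move=> x; exact: funepos_ge0.
  by apply: eq_integral => x _; rewrite funenegE funeposE /= fN EFinN.
have : (0 <= \int[mu]_x (EFin \o f)^\+ x)%E by apply: integral_ge0 => x _; exact: funepos_ge0.
(* When the common value is infinite, the difference is infinite too and [fine] sends it to 0. *)
by case: integral => [r _||]//=; rewrite subrr.
Qed.

Let mphi : measurable_fun setT autocorr.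
Proof. exact: continuous_measurable_rV continuous_autocorr. Qed.

Lemma integral_autocorr : (\int[mu]_x (autocorr x)%:E = (fine (mu A) ^+ 2)%:E)%E.
Proof.
transitivity (\int[mu]_x ((autocorr x)%:E * 1))%E.
  by apply: eq_integral => x _; rewrite mule1.
rewrite (ge0_integral_autocorr (fun=> 1%E))//.
by under eq_integral do rewrite integral_cst// mul1e; rewrite integral_cst// expr2 EFinM !fineK.
Qed.

Lemma integrable_autocorr : mu.-integrable setT (EFin \o autocorr).
Proof.
apply/integrableP; split; first exact/measurable_EFinP.
by under eq_integral do rewrite /= ger0_norm//; rewrite integral_autocorr ltry.
Qed.

Section fourier_autocorr.
Variable xi : 'rV[R]_n.
Let t (x : 'rV[R]_n) := 2 * pi * \sum_(i < n) xi ord0 i * x ord0 i.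

Let tD x y : t (x + y) = t x + t y.
Proof.
rewrite /t -mulrDr -big_split; congr (_ * _); apply: eq_bigr => i _.
by rewrite mxE mulrDr.
Qed.

Let tN x : t (- x) = - t x.
Proof.
rewrite /t -mulrN -sumrN; congr (_ * _); apply: eq_bigr => i _.
by rewrite mxE mulrN.
Qed.

Let mt : measurable_fun setT t. Proof. exact: measurable_dot. Qed.

Let C := \int[mu]_(x in A) cos (t x).
Let V := fine (mu A).

Let mcos (s : R) : measurable_fun setT (fun x => cos (t x + s)).
Proof.
apply: (measurableT_comp (continuous_measurable_fun (@continuous_cos R))).
exact: measurable_funD.
Qed.

Let iA (f : 'rV[R]_n -> R) (M : R) : measurable_fun setT f -> (forall x, `|f x| <= M) ->
  mu.-integrable A (EFin \o f).
Proof.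
move=> mf fM; apply: (integrable_bounded M) => //; first by rewrite -ge0_fin_numE.
exact: measurable_funTS.
Qed.

Let msin : measurable_fun setT (fun x => sin (t x)).
Proof. exact: (measurableT_comp (continuous_measurable_fun (@continuous_sin R))). Qed.

Let mcos0 : measurable_fun setT (fun x => cos (t x)).
Proof. exact: (measurableT_comp (continuous_measurable_fun (@continuous_cos R))). Qed.

Let norm_cos_le1 (s : R) : `|cos s| <= 1.
Proof. by rewrite ler_norml cos_geN1 cos_le1. Qed.

Let norm_sin_le1 (s : R) : `|sin s| <= 1.
Proof. by rewrite ler_norml sin_geN1 sin_le1. Qed.

Let iZ (r : R) (f : 'rV[R]_n -> R) : mu.-integrable A (EFin \o f) ->
  mu.-integrable A (EFin \o (fun x => r * f x)).
Proof. by move=> h; exact: (integrableZl mA r h). Qed.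

Let int_sin : \int[mu]_(x in A) sin (t x) = 0.
Proof.
rewrite Rintegral_mkcond; apply: Rintegral_rV_odd.
  by apply/(measurable_restrictT _ _).1 => //; exact: measurable_funTS.
move=> x; rewrite !patchE tN sinN (_ : (- x \in A) = (x \in A)).
  by case: ifP; rewrite ?oppr0.
by apply/idP/idP => /set_mem h; apply/mem_set; [rewrite -[x]opprK|]; exact: A_sym.
Qed.

Let int_cos_shift y : \int[mu]_(x in A) cos (t x + t y) = C * cos (t y).
Proof.
transitivity (\int[mu]_(x in A) (cos (t y) * cos (t x) + - sin (t y) * sin (t x))).
  by apply: eq_Rintegral => x _; rewrite cosD; ring.
have i1 := iA _ 1 mcos0 (fun x => norm_cos_le1 _).
have i2 := iA _ 1 msin (fun x => norm_sin_le1 _).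
rewrite RintegralD//; [|exact: iZ|exact: iZ].
by rewrite !RintegralZl// int_sin mulr0 addr0 mulrC.
Qed.

(** Adding 1 makes the integrand nonnegative, as [ge0_integral_autocorr] requires; the contribution
    V^2 of the constant is subtracted again in [int_phi_cos]. *)
Let int_autocorr_cos :
  (\int[mu]_x ((autocorr x)%:E * (1 + cos (t x))%:E) = (V ^+ 2 + C ^+ 2)%:E)%E.
Proof.
have cge (s : R) : 0 <= 1 + cos s <= 2.
  have := cos_geN1 s; have := cos_le1 s => h1 h2; apply/andP; split; lra.
have mb (s : R) : measurable_fun setT (fun x => 1 + cos (t x + s)) by exact: measurable_funD.
have ib (s : R) : mu.-integrable A (EFin \o (fun x => 1 + cos (t x + s))).
  by apply: (iA _ 2) => // x; have /andP[? ?] := cge (t x + s); rewrite ger0_norm.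
have icst (r : R) : mu.-integrable A (EFin \o (fun=> r)) by apply: (iA _ `|r|).
rewrite (ge0_integral_autocorr (fun x => (1 + cos (t x))%:E)); last 2 first.
- by apply/measurable_EFinP; exact: measurable_funD.
- by move=> x; rewrite lee_fin; have /andP[] := cge (t x).
transitivity (\int[mu]_(y in A) (V + C * cos (t y))%:E)%E.
  apply: eq_integral => y _; under eq_integral do rewrite tD.
  rewrite -[LHS]fineK; last exact: (integrable_fin_num mA (ib _)).
  congr EFin; rewrite -/(Rintegral _ _ _) RintegralD//; last by apply: (iA _ 1).
  by rewrite Rintegral_cst// mul1r int_cos_shift.
have i1 := iZ C _ (iA _ 1 mcos0 (fun x => norm_cos_le1 _)).
rewrite -[LHS]fineK; last exact: (integrable_fin_num mA (integrableD mA (icst V) i1)).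
congr EFin; rewrite -/(Rintegral _ _ _) (RintegralD mA (icst V) i1) Rintegral_cst//.
by rewrite RintegralZl// -?/C -?/V ?expr2//; apply: (iA _ 1).
Qed.

Let iphiM (f : 'rV[R]_n -> R) : measurable_fun setT f -> (forall x, `|f x| <= 1) ->
  mu.-integrable setT (EFin \o (fun x => autocorr x * f x)).
Proof.
move=> mf f1; apply: (le_integrable measurableT _ _ integrable_autocorr).
  by apply/measurable_EFinP; exact: measurable_funM.
move=> x _ /=; rewrite lee_fin normrM ler_piMr//.
Qed.

Let int_phi_cos : \int[mu]_x (autocorr x * cos (t x)) = C ^+ 2.
Proof.
have : \int[mu]_x (autocorr x + autocorr x * cos (t x)) = V ^+ 2 + C ^+ 2.
  rewrite -[RHS]/(fine (V ^+ 2 + C ^+ 2)%:E) -int_autocorr_cos; congr fine.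
  by apply: eq_integral => x _; rewrite -EFinM mulrDr mulr1.
rewrite RintegralD//; [|exact: integrable_autocorr|exact: iphiM].
by rewrite /Rintegral integral_autocorr; exact: addrI.
Qed.

Let int_phi_sin : \int[mu]_x (autocorr x * sin (t x)) = 0.
Proof.
apply: Rintegral_rV_odd; first exact: measurable_funM.
move=> x; rewrite tN sinN mulrN; congr (- (_ * _)).
rewrite /autocorr -(lebesgue_rV_reflect _ 0 (mAA x)); congr (fine (mu _)).
apply/seteqP; split=> y /=; rewrite !sub0r ?opprK => -[h1 h2]; split.
- exact: A_sym.
- by have := A_sym _ h2; rewrite opprD !opprK.
- by rewrite -[y]opprK; exact: A_sym.
- by have := A_sym _ h2; rewrite opprD.
Qed.

(** Over A the sine integrates to 0 by symmetry, so the cosine of a sum integrates over A x A to the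
    square of C. At xi = 0 the cosine integral C is the volume V, and the transform there is V. *)
Lemma fourier_autocorr :
  fourier (fun x => Complex (V^-1 * autocorr x) 0) xi = Complex (V^-1 * C ^+ 2) 0.
Proof.
congr Complex.
  transitivity (\int[mu]_x (V^-1 * (autocorr x * cos (t x)))).
    by apply: eq_Rintegral => x _; rewrite /= mul0r subr0 mulrA.
  by rewrite RintegralZl// ?int_phi_cos//; exact: iphiM.
transitivity (\int[mu]_x (- V^-1 * (autocorr x * sin (t x)))).
  by apply: eq_Rintegral => x _; rewrite /= mul0r addr0; ring.
by rewrite RintegralZl// ?int_phi_sin ?mulr0//; exact: iphiM.
Qed.

End fourier_autocorr.

Let V_gt0 : 0 < fine (mu A).
Proof. by rewrite fine_gt0// A_gt0/= -ge0_fin_numE. Qed.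

(** The autocorrelation can be nonzero only on A + A, which the hypothesis places in D; division by
    its value V at the origin normalizes it. *)
Lemma lebesgue_rV_le_turan_space (D : set 'rV[R]_n) : closed D ->
  (forall y z, A y -> A z -> D (y + z)) -> (mu A <= turan_space D)%E.
Proof.
move=> clD AD; set V := fine (mu A).
pose h (x : 'rV[R]_n) := Complex (V^-1 * autocorr x) 0.
apply: ereal_sup_ubound; exists h; last first.
  rewrite /h fourier_autocorr -[RHS]fineK//; congr EFin => /=.
  rewrite (eq_Rintegral _ (g := fun=> 1)) => [|x _].
    by rewrite Rintegral_cst// mul1r -/V expr2 mulKf// gt_eqF.
  by rewrite big1 ?mulr0 ?cos0// => i _; rewrite mxE mul0r.
split; [split| | |].
- apply/(cintegrableP _ h measurableT).2; split; last exact: integrable0.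
  by have := integrableZl measurableT V^-1 integrable_autocorr.
- move=> xi; rewrite fourier_autocorr; apply/complex_ge0P; split=> //=.
  by rewrite mulr_ge0 ?invr_ge0 ?sqr_ge0// ltW.
- apply: continuous_complex => /=; last exact: cst_continuous.
  rewrite (_ : (fun _ => _) = (fun x => V^-1 * (0 + autocorr x))).
    exact: continuous_affine continuous_autocorr.
  by apply/funext => x; rewrite add0r.
- rewrite [X in _ `<=` X](closure_id D).1//; apply: closure_subset => x /= hx.
  have /autocorr_neq0[y [z [Ay Az ->]]] : autocorr x != 0; last exact: AD.
  by apply: contra_neq hx => h0; rewrite /h h0 mulr0.
- by rewrite /h autocorr0 mulVf// gt_eqF.
Qed.
End autocorrelation.

(** * The three inequalities for a symmetric convex body *)

Lemma lebesgue_rV_nbhs_gt0 {R : realType} {n} (D : set 'rV[R]_n) : measurable D -> D° !=set0 ->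
  (0 < lebesgue_rV n D)%E.
Proof.
move=> mD [c /nbhs_ballP[r /= r0 rD]]; apply: lt_le_trans (_ : lebesgue_rV n (ball c r) <= _)%E; first exact: lebesgue_rV_ball_gt0.
by apply: le_measure; rewrite ?inE//; exact: measurable_rV_ball.
Qed.

Lemma inve_anti {R : realType} (x y : \bar R) : (0 <= x)%E -> (x <= y)%E -> (y^-1 <= x^-1)%E.
Proof.
by move=> x0 xy; rewrite inve_ple ?inE ?inve_ge0 ?inveK//; exact: le_trans xy.
Qed.

Section convex_body.
Context {R : realType} {n : nat}.
Variable D : set 'rV[R]_n.
Hypotheses (D_body : sym_convex_body D) (D_cube : D `<=` cube).
Local Notation mu := (lebesgue_rV n).

Let cD : compact D. Proof. by have [] := D_body. Qed.
Let D_sym x : D x -> D (- x). Proof. by have [_ _ _] := D_body; exact. Qed.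

Let closedD : closed D.
Proof. by apply: compact_closed => //; exact: norm_hausdorff. Qed.

Let mD : measurable D. Proof. exact: closed_measurable_rV. Qed.

Let half : set 'rV[R]_n := [set 2^-1 *: x | x in D].

Let compact_half : compact half.
Proof.
apply: continuous_compact => //; apply: continuous_subspaceT; exact: scaler_continuous.
Qed.

Let half_gt0 : (0 < volume half)%E.
Proof.
apply: lebesgue_rV_nbhs_gt0.
  by apply: closed_measurable_rV; apply: compact_closed => //; exact: norm_hausdorff.
have [_ [c Dc] _ _] := D_body; exists (2^-1 *: c).
have K : continuous (fun x : 'rV[R]_n => (2 : R) *: x) by exact: scaler_continuous.
have h : nbhs (2^-1 *: c) ((fun x : 'rV[R]_n => (2 : R) *: x) @^-1` D).
  by apply: K; rewrite scalerA divff// scale1r.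
rewrite /interior; apply: filterS h => x Dx; exists (2 *: x) => //.
by rewrite scalerA mulVf// scale1r.
Qed.

Lemma volume_half_le_turan_space : (volume half <= turan_space D)%E.
Proof.
have [_ _ convD _] := D_body.
apply: lebesgue_rV_le_turan_space => //.
- by move=> _ [x Dx <-]; exists (- x); [exact: D_sym|rewrite scalerN].
- move=> _ [x Dx <-] i; rewrite mxE; have /andP[h1 h2] := D_cube _ Dx i.
  have /andP[h3 _] := D_cube _ (D_sym _ Dx) i; move: h3; rewrite mxE => h3.
  rewrite ler_norml; apply/andP; split; lra.
- move=> _ _ [x Dx <-] [y Dy <-].
  have h0 : (0 : R) <= 2^-1 by lra.
  (* The sum of two points of [half] is the midpoint of two points of D, whence the convexity
     parameter 1/2. *)
  have h1 : (2^-1 : R) <= 1 by lra.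
  pose t : {i01 R} := Itv01 h0 h1.
  have := convD x y t (mem_set Dx) (mem_set Dy).
  rewrite inE; congr (D (_ *: _ + _ *: _)); rewrite /= /unstable.onem; lra.
Qed.

Let half_le_torus : (volume half <= turan_torus D)%E.
Proof.
apply: le_trans volume_half_le_turan_space _; exact: turan_space_le_torus.
Qed.

Lemma wiener_constant_le : ((volume D)^-1 * wiener_constant D <= (turan_torus D)^-1)%E.
Proof.
(* Positivity is borrowed from the lower bound by the volume of [half]; together with [c_le1] it
   allows the computation to take place in the reals. *)
have c_gt0 : (0 < turan_torus D)%E by exact: lt_le_trans half_le_torus.
have c_le1 : (turan_torus D <= 1)%E.
  apply: ge_ereal_sup => _ [g [gp cg _ g0] <-]; rewrite lee_fin; exact: turan_coef_le1.
have /fineK cE : turan_torus D \is a fin_num.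
  by rewrite ge0_fin_numE ?(ltW c_gt0)//; apply: le_lt_trans c_le1 (ltry _).
have V_gt0 : (0 < volume D)%E.
  by apply: lebesgue_rV_nbhs_gt0 => //; have [] := D_body.
have /fineK VE : volume D \is a fin_num.
  rewrite ge0_fin_numE ?(ltW V_gt0)//; apply: le_lt_trans (@lebesgue_cube_lty R n).
  by apply: le_measure; rewrite ?inE//; exact: measurable_cube.
move: c_gt0 V_gt0; rewrite -cE -VE !lte_fin; set c := fine _; set v := fine (volume D) => c0 v0.
rewrite !inver !gt_eqF// lee_pdivrMl//; apply: ge_ereal_sup => _ [f [fp f_neq0 Jfin] <-].
have [[_ intf] f_ge0] := fp.
set I := sqr_integral cube f; set J := sqr_integral D f.
have I_ge0 : (0 <= I)%E by apply: integral_ge0 => x _; rewrite lee_fin sqr_ge0.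
have J_ge0 : (0 <= J)%E by apply: integral_ge0 => x _; rewrite lee_fin sqr_ge0.
have coef_le g : L1_plus g -> continuous (g : 'rV[R]_n -> R[i]^o) -> supp g `<=` translates D ->
    g 0 = 1 -> ((Re (fourier_coef g 0))%:E * I <= J)%E.
  by move=> gp cg sg g0; exact: wiener_turan_le.
have I_gt0 : (0 < I)%E.
  rewrite lt_def I_ge0 andbT; apply/eqP => I0; apply: f_neq0.
  have mI : measurable_fun cube (fun x : 'rV[R]_n => (normc (f x) ^+ 2)%:E).
    apply/measurable_EFinP; apply: measurable_funX; apply: normc_measurable.
    by have [] := intf.
  have : ae_eq mu cube (fun x : 'rV[R]_n => (normc (f x) ^+ 2)%:E) (cst 0%E).
    apply/(ae_eq_integral_abs mu (@measurable_cube R n) mI); rewrite -[RHS]I0.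
    by apply: eq_integral => x _; rewrite gee0_abs// lee_fin sqr_ge0.
  apply: filterS => x /= h cx; have [/eqP] := h cx.
  by rewrite sqrf_eq0 => /eqP; exact: Normc.eq0_normc.
(* As the supremum is positive, some admissible g has a positive zeroth coefficient; an infinite I
   would then make J infinite as well. *)
have I_fin : I \is a fin_num.
  rewrite ge0_fin_numE// ltNge leye_eq; apply/negP => /eqP Iy.
  have : (0%:E < turan_torus D)%E by rewrite -cE lte_fin.
  move=> /ereal_sup_gt[_ [g [gp cg sg g0] <-]]; rewrite lte_fin => a0.
  by have := coef_le _ gp cg sg g0; rewrite Iy gt0_muley ?lte_fin// leye_eq => /eqP Jy; rewrite -/J Jy in Jfin.
have J_fin : J \is a fin_num by rewrite ge0_fin_numE.
move: I_gt0 coef_le; rewrite -(fineK I_fin) -(fineK J_fin) lte_fin.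
set i := fine I; set j := fine J => i0 coef_le.
have cij : c * i <= j.
  rewrite -ler_pdivlMr// -lee_fin cE; apply: ge_ereal_sup => _ [g [gp cg sg g0] <-].
  by rewrite lee_fin ler_pdivlMr// -lee_fin EFinM; exact: coef_le.
(* A positive J keeps the quotient away from the convention c/0 = +oo, so that the inverses below
   are inverses of real numbers. *)
have j0 : 0 < j by apply: lt_le_trans cij; exact: mulr_gt0.
have vj : 0 < v^-1 * j by rewrite mulr_gt0 ?invr_gt0.
rewrite -VE -/v inver gt_eqF// -EFinM inver gt_eqF// -!EFinM lee_fin ler_pdivrMr//.
rewrite (_ : v / c * (v^-1 * j) = j / c); first by rewrite ler_pdivlMr// mulrC.
by field; rewrite !gt_eqF.
Qed.

Lemma turan_torus_inv_le : ((turan_torus D)^-1 <= (turan_space D)^-1)%E.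
Proof.
apply: inve_anti; last exact: turan_space_le_torus.
exact: le_trans (ltW half_gt0) volume_half_le_turan_space.
Qed.

Lemma turan_space_inv_le : ((turan_space D)^-1 <= (volume half)^-1)%E.
Proof. by apply: inve_anti volume_half_le_turan_space; exact: ltW. Qed.

End convex_body.

Theorem theorem6 (R : realType) (n : nat) (n_gt0 : (0 < n)%N)
    (D : set 'rV[R]_n) (D_body : sym_convex_body D) (D_cube : D `<=` cube) :
  [/\ ((volume D)^-1 * wiener_constant D <= (turan_torus D)^-1)%E,
      ((turan_torus D)^-1 <= (turan_space D)^-1)%E
    & ((turan_space D)^-1 <= (volume [set 2^-1 *: x | x in D])^-1)%E].
Proof.
split; [exact: wiener_constant_le|exact: turan_torus_inv_le|exact: turan_space_inv_le].
Qed.
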